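(* No $3$-quasi-Sasakian manifold $(M,\phi_\delta,\xi_\delta,\eta_\delta,g)$, $\delta\in\{1,2,3\}$, is $\eta$-Einstein except in the following cases: (i) $3$-$\alpha$-Sasakian manifolds, which are Einstein with strictly positive scalar curvature; (ii) $3$-cosymplectic manifolds, which are Ricci-flat; (iii) $3$-quasi-Sasakian manifolds of rank $3$, which are $\eta$-Einstein and non-Einstein.
   Context: Conventions: for a $1$-form $\eta$, $2d\eta(X,Y)=X(\eta(Y))-Y(\eta(X))-\eta([X,Y])$. An almost contact metric structure $(\phi,\xi,\eta,g)$ consists of a $(1,1)$-tensor $\phi$, a vector field $\xi$, a $1$-form $\eta$ and a Riemannian metric $g$ with $\phi^2=-I+\eta\otimes\xi$, $\eta(\xi)=1$, $g(\phi X,\phi Y)=g(X,Y)-\eta(X)\eta(Y)$. Its fundamental $2$-form is $\Phi(X,Y)=g(X,\phi Y)$. It is normal if $[\phi,\phi]+2d\eta\otimes\xi=0$ ($[\phi,\phi]$ the Nijenhuis torsion), quasi-Sasakian if it is normal and $d\Phi=0$, cosymplectic if it is normal, $d\Phi=0$ and $d\eta=0$, and $\alpha$-Sasakian if it is normal and $d\eta=\alpha\Phi$ for some real constant $\alpha\ne0$. A quasi-Sasakian structure has rank $2p+1$ if $\eta\wedge(d\eta)^p\neq0$ and $(d\eta)^{p+1}=0$ on $M$; only structures of constant rank are considered. An almost $3$-contact metric manifold is a $(4n+3)$-dimensional manifold with three almost contact metric structures $(\phi_\delta,\xi_\delta,\eta_\delta,g)$, $\delta=1,2,3$, with the same metric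 $g$, such that for every even permutation $(\alpha,\beta,\gamma)$ of $\{1,2,3\}$: $\phi_\gamma=\phi_\alpha\phi_\beta-\eta_\beta\otimes\xi_\alpha=-\phi_\beta\phi_\alpha+\eta_\alpha\otimes\xi_\beta$, $\xi_\gamma=\phi_\alpha\xi_\beta=-\phi_\beta\xi_\alpha$, $\eta_\gamma=\eta_\alpha\circ\phi_\beta=-\eta_\beta\circ\phi_\alpha$. It is $3$-quasi-Sasakian (resp. $3$-cosymplectic, resp. $3$-$\alpha$-Sasakian) if each of the three structures is quasi-Sasakian (resp. cosymplectic, resp. $\alpha$-Sasakian; in the last case it is known that the three constants coincide). On a $3$-quasi-Sasakian manifold it is known that $\eta_1,\eta_2,\eta_3$ have the same rank, called the rank of $M$, of the form $4l+1$ or $4l+3$ for some $0\le l\le n$. $M$ is $\eta$-Einstein if $\mathrm{Ric}=a\,g+b\sum_{\delta=1}^3\eta_\delta\otimes\eta_\delta$ for some functions $a,b$ (Einstein manifolds being included as the case $b=0$).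
   Formalization: M is assumed connected (else a disjoint union of 3-α-Sasakian manifolds with different constants is an Einstein counterexample), and ''non-Einstein'' in (iii) is claimed only for n ≥ 1, since for n = 0 rank-3 manifolds such as the 3-sphere are Einstein. *)

(* Defs.v *)
From HB Require Import structures.
From mathcomp Require Import all_boot all_order all_algebra.
From mathcomp Require Import fingroup perm ring.
From mathcomp Require Import all_classical reals topology normedtype derive.

Set Implicit Arguments.
Unset Strict Implicit.
Unset Printing Implicit Defensive.

Import Order.TTheory GRing.Theory Num.Theory.
Import numFieldNormedType.Exports.

Local Open Scope classical_set_scope.
Local Open Scope ring_scope.

(** * Smooth functions on open subsets of [R^m] *)

Section Smoothness.
Variables (R : realType) (m : nat).
Implicit Types (U : set 'rV[R]_m) (f g : 'rV[R]_m -> R).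

(* Only meaningful for open [U]. *)
Fixpoint Ck (k : nat) U f : Prop :=
  (forall x, U x -> {for x, continuous f}) /\
  if k is k'.+1 then
    forall i : 'I_m, (forall x, U x -> derivable f x (delta_mx 0 i)) /\
                     Ck k' U ('D_(delta_mx 0 i) f)
  else True.

Definition Cinf U f : Prop := forall k, Ck k U f.

Lemma CkW k U f : Ck k.+1 U f -> Ck k U f.
Proof.
elim: k f => [|k IHk] f; first by case.
case=> cf df; split=> // i; have [dfi Hi] := df i; split=> //.
exact: IHk.
Qed.

Lemma open_near_eq U f g x : open U -> U x -> (forall y, U y -> f y = g y) ->
  {near x, f =1 g}.
Proof. by move=> oU Ux fg; near do apply: fg; exact: open_nbhs_nbhs.
Unshelve. all: by end_near. Qed.

Lemma near_eq_continuous f g x : {near x, f =1 g} ->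
  {for x, continuous f} -> {for x, continuous g}.
Proof.
move=> fg cf; have -> : {for x, continuous g} = (g @ x --> f x).
  by rewrite (nbhs_singleton fg).
by apply: cvg_trans cf => /= P; exact: (near_eq_cvg fg).
Qed.

Lemma eq_on_Ck k U f g : open U -> (forall x, U x -> f x = g x) ->
  Ck k U f -> Ck k U g.
Proof.
move=> oU; elim: k f g => [|k IHk] f g fg [cf df].
  by split=> // x Ux; exact: near_eq_continuous (open_near_eq oU Ux fg) (cf _ Ux).
split=> [x Ux|i].
  exact: near_eq_continuous (open_near_eq oU Ux fg) (cf _ Ux).
have [dfi Hi] := df i; split=> [x Ux|].
  exact: (near_eq_derivable (open_near_eq oU Ux fg) (dfi _ Ux)).
apply: IHk Hi => x Ux; exact: (near_eq_derive _ (open_near_eq oU Ux fg)).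
Qed.

Lemma Ck_cst k U (a : R) : Ck k U (cst a).
Proof.
elim: k a => [|k IHk] a; first by split=> // x _; exact: cst_continuous.
split=> [x _|i]; first exact: cst_continuous.
split=> [x _|]; first exact: derivable_cst.
rewrite (_ : 'D_(delta_mx 0 i) (cst a) = cst 0) //.
by apply/funext => x; rewrite derive_cst.
Qed.

Lemma CkD k U f g : open U -> Ck k U f -> Ck k U g -> Ck k U (f + g).
Proof.
move=> oU; elim: k f g => [|k IHk] f g [cf df] [cg dg].
  by split=> // x Ux; exact: (continuousD (cf _ Ux) (cg _ Ux)).
split=> [x Ux|i]; first exact: (continuousD (cf _ Ux) (cg _ Ux)).
have [dfi Hf] := df i; have [dgi Hg] := dg i; split=> [x Ux|].
  by apply: derivableD; [exact: dfi|exact: dgi].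
apply: eq_on_Ck (IHk _ _ Hf Hg) => // x Ux /=.
by rewrite deriveD //; [exact: dfi|exact: dgi].
Qed.

Lemma CkM k U f g : open U -> Ck k U f -> Ck k U g -> Ck k U (f * g).
Proof.
move=> oU; elim: k f g => [|k IHk] f g Hf Hg;
  have [cf df] := Hf; have [cg dg] := Hg.
  by split=> // x Ux; exact: (continuousM (cf _ Ux) (cg _ Ux)).
split=> [x Ux|i]; first exact: (continuousM (cf _ Ux) (cg _ Ux)).
have [dfi Hfi] := df i; have [dgi Hgi] := dg i; split=> [x Ux|].
  by apply: derivableM; [exact: dfi|exact: dgi].
have := CkD oU (IHk _ _ (CkW Hf) Hgi) (IHk _ _ (CkW Hg) Hfi).
apply: eq_on_Ck => // x Ux /=.
by rewrite deriveM //; [exact: dfi|exact: dgi].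
Qed.

End Smoothness.

(** * Manifolds *)

(* [chart_map] and [chart_inv] are only relevant on [chart_dom] and on its
   image, respectively. *)
Record chart (R : realType) (m : nat) (T : topologicalType) := Chart {
  chart_dom : set T ;
  chart_map : T -> 'rV[R]_m ;
  chart_inv : 'rV[R]_m -> T ;
  chart_open : open chart_dom ;
  chart_map_open : open (chart_map @` chart_dom) ;
  chart_mapK : {in chart_dom, cancel chart_map chart_inv} ;
  chart_map_continuous : forall p, chart_dom p -> {for p, continuous chart_map} ;
  chart_inv_continuous : forall x, (chart_map @` chart_dom) x ->
    {for x, continuous chart_inv} }.

Record manifold (R : realType) (m : nat) := Manifold {
  manifold_sort :> topologicalType ;
  atlas : set (chart R m manifold_sort) ;
  manifold_nonempty : [set: manifold_sort] !=set0 ;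
  manifold_hausdorff : hausdorff_space manifold_sort ;
  manifold_second_countable : @second_countable manifold_sort ;
  atlas_cover : forall p : manifold_sort, exists2 c, atlas c & chart_dom c p ;
  atlas_compatible : forall c c', atlas c -> atlas c' -> forall i,
    Cinf (chart_map c @` (chart_dom c `&` chart_dom c'))
         (fun x => chart_map c' (chart_inv c x) 0 i) }.

Section SmoothFunctions.
Variables (R : realType) (m : nat) (M : manifold R m).

Definition is_smooth (f : M -> R) : Prop := forall c, atlas c ->
  Cinf (chart_map c @` chart_dom c) (f \o chart_inv c).

Definition smooth_pred : {pred M -> R} := [pred f | `[< is_smooth f >]].

Lemma smoothP f : reflect (is_smooth f) (f \in smooth_pred).
Proof. by rewrite inE; exact: asboolP. Qed.

Lemma is_smooth_cst (a : R) : is_smooth (cst a).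
Proof. by move=> c _ k; exact: Ck_cst. Qed.

Lemma is_smoothM (f g : M -> R) :
  is_smooth f -> is_smooth g -> is_smooth (f * g).
Proof.
move=> sf sg c cA k.
exact: (CkM (@chart_map_open _ _ _ c) (sf c cA k) (sg c cA k)).
Qed.

Lemma smooth_subring : subring_closed smooth_pred.
Proof.
split=> [|f g /smoothP sf /smoothP sg|f g /smoothP sf /smoothP sg];
  apply/smoothP.
- exact: is_smooth_cst.
- have sNg : is_smooth (- g).
    by rewrite -mulN1r; apply: is_smoothM sg; exact: (is_smooth_cst (- 1)).
  move=> c cA k.
  exact: (CkD (@chart_map_open _ _ _ c) (sf c cA k) (sNg c cA k)).
- exact: is_smoothM.
Qed.

Lemma smooth_scale : GRing.scaler_closed smooth_pred.
Proof.
move=> a f /smoothP sf; apply/smoothP.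
exact: is_smoothM (@is_smooth_cst a) sf.
Qed.

HB.instance Definition _ :=
  GRing.isSubringClosed.Build (M -> R) smooth_pred smooth_subring.
HB.instance Definition _ :=
  GRing.isScaleClosed.Build R (M -> R) smooth_pred smooth_scale.

(* The ring of smooth real-valued functions on [M]. *)
Record smooth_fun := SmoothFun {
  smooth_val :> M -> R ; smooth_valP : smooth_val \in smooth_pred }.

HB.instance Definition _ := [isSub for smooth_val].
HB.instance Definition _ := [Choice of smooth_fun by <:].
HB.instance Definition _ :=
  GRing.SubChoice_isSubComPzRing.Build _ _ smooth_fun
    (GRing.subringClosedP smooth_pred).
HB.instance Definition _ := [SubZmodule_isSubLmodule of smooth_fun by <:].

Lemma smooth_funP (f g : smooth_fun) : f =1 g -> f = g.
Proof. by move=> fg; apply/val_inj/funext. Qed.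

End SmoothFunctions.

Notation "'C^oo' M" := (smooth_fun M) (at level 10, M at level 9).

Section VectorFields.
Variables (R : realType) (m : nat) (M : manifold R m).

(* Vector fields are the derivations of the R-algebra of smooth functions. *)
Definition is_derivation (X : C^oo M -> C^oo M) : Prop :=
  (forall (a : R) f g, X (a *: f + g) = a *: X f + X g) /\
  (forall f g, X (f * g) = f * X g + g * X f).

Definition derivation_pred : {pred C^oo M -> (C^oo M)^o} :=
  [pred X | `[< is_derivation X >]].

Lemma derivationP X : reflect (is_derivation X) (X \in derivation_pred).
Proof. by rewrite inE; exact: asboolP. Qed.

Lemma scale_mulC (a : R) (f g : C^oo M) : a *: (f * g) = f * (a *: g).
Proof. by apply: smooth_funP => p; exact: mulrCA. Qed.

Lemma derivation_submod : submod_closed derivation_pred.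
Proof.
split=> [|h X Y /derivationP[XD XM] /derivationP[YD YM]]; apply/derivationP.
  by split=> [a f g|f g]; [rewrite scaler0 addr0|rewrite !mulr0 addr0].
split=> [a f g|f g].
- change (h * X (a *: f + g) + Y (a *: f + g) =
    a *: (h * X f + Y f) + (h * X g + Y g)).
  by rewrite XD YD mulrDr scalerDr scale_mulC addrACA.
- change (h * X (f * g) + Y (f * g) =
    f * (h * X g + Y g) + g * (h * X f + Y f)).
  by rewrite XM YM !mulrDr addrACA !(mulrCA h).
Qed.

HB.instance Definition _ := GRing.isSubmodClosed.Build (C^oo M)
  (C^oo M -> (C^oo M)^o) derivation_pred derivation_submod.

Record vfield := VField {
  vfield_val :> C^oo M -> (C^oo M)^o ;
  vfield_valP : vfield_val \in derivation_pred }.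

HB.instance Definition _ := [isSub for vfield_val].
HB.instance Definition _ := [Choice of vfield by <:].
HB.instance Definition _ := [SubChoice_isSubLmodule of vfield by <:].

Implicit Types (X Y Z : vfield) (f : C^oo M) (p : M).

Lemma lie_subproof X Y :
  (fun f => X (Y f) - Y (X f)) \in derivation_pred.
Proof.
have /derivationP[XD XM] := vfield_valP X.
have /derivationP[YD YM] := vfield_valP Y.
have XA f g : X (f + g) = X f + X g by have := XD 1 f g; rewrite !scale1r.
have YA f g : Y (f + g) = Y f + Y g by have := YD 1 f g; rewrite !scale1r.
apply/derivationP; split=> [a f g|f g].
  rewrite YD XD XD YD scalerBr opprD addrACA; congr (_ + _).
rewrite XM YM XA YA !XM !YM.
set A := X f; set B := Y g; set A' := Y f; set B' := X g.
ring.
Qed.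

Definition lie X Y : vfield := VField (lie_subproof X Y).
End VectorFields.

(** * Tensors *)

Section Tensors.
Variables (R : realType) (m : nat) (M : manifold R m).
Local Notation vf := (vfield M).
Implicit Types (X Y Z W : vf) (p : M).

(* Tensor fields are the multilinear maps over the ring of smooth functions. *)
Definition one_form := {linear vf -> (C^oo M)^o}.
Definition endo_field := {linear vf -> vf}.

(* Exterior derivatives with the normalization 1/(k+1) on k-forms. *)
Definition ext_d1 (w : vf -> C^oo M) X Y : C^oo M :=
  2^-1 *: (X (w Y) - Y (w X) - w (lie X Y)).

Definition ext_d2 (w : vf -> vf -> C^oo M) X Y Z : C^oo M :=
  3^-1 *: (X (w Y Z) + Y (w Z X) + Z (w X Y)
           - w (lie X Y) Z - w (lie Y Z) X - w (lie Z X) Y).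

Definition kform (k : nat) := ('I_k -> vf) -> C^oo M.

Definition form1 (w : vf -> C^oo M) : kform 1 := fun V => w (V ord0).
Definition form2 (w : vf -> vf -> C^oo M) : kform 2 :=
  fun V => w (V ord0) (V ord_max).

(* The factor 1/(k+l)! goes with the normalization of [ext_d1], [ext_d2]. *)
Definition wedge k l (a : kform k) (b : kform l) : kform (k + l)%N := fun V =>
  ((k + l)`!%N%:R : R)^-1 *:
    \sum_(s : 'S_(k + l)%N) (-1) ^+ odd_perm s *
      (a (fun i => V (s (lshift l i))) * b (fun j => V (s (rshift k j)))).

Fixpoint wedge_exp (a : kform 2) (q : nat) : kform (q * 2)%N :=
  if q is q'.+1 then wedge a (@wedge_exp a q') else fun _ => 1.
Arguments wedge_exp : clear implicits.

Definition form_vanishes k (a : kform k) : Prop := forall V, a V = 0.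
Definition form_nowhere_zero k (a : kform k) : Prop :=
  forall p, exists V, a V p != 0.

(* [w] has constant rank [r = 2q + 1]. *)
Definition has_rank (w : one_form) (r : nat) : Prop := exists2 q, r = q.*2.+1 &
  form_nowhere_zero (wedge (form1 w) (wedge_exp (form2 (ext_d1 w)) q)) /\
  form_vanishes (wedge_exp (form2 (ext_d1 w)) q.+1).

(* The last axiom says that if [g X X] vanishes at [p], then so does [X]. *)
Record metric := Metric {
  metric_val :> vf -> vf -> C^oo M ;
  metric_linear : forall (f : C^oo M) X Y Z,
    metric_val (f *: X + Y) Z = f * metric_val X Z + metric_val Y Z ;
  metric_sym : forall X Y, metric_val X Y = metric_val Y X ;
  metric_ge0 : forall X p, 0 <= metric_val X X p ;
  metric_eq0 : forall X p, metric_val X X p = 0 -> forall f, X f p = 0 }.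

Record levi_civita (g : metric) := LeviCivita {
  nabla :> vf -> vf -> vf ;
  nabla_linearl : forall (f : C^oo M) X Y Z,
    nabla (f *: X + Y) Z = f *: nabla X Z + nabla Y Z ;
  nabla_additive : forall X Y Z, nabla X (Y + Z) = nabla X Y + nabla X Z ;
  nabla_leibniz : forall X (f : C^oo M) Y,
    nabla X (f *: Y) = (X f : C^oo M) *: Y + f *: nabla X Y ;
  nabla_torsion_free : forall X Y, nabla X Y - nabla Y X = lie X Y ;
  nabla_metric : forall X Y Z,
    X (g Y Z) = g (nabla X Y) Z + g Y (nabla X Z) }.

Section Curvature.
Variables (g : metric) (D : levi_civita g).

Definition curvature X Y Z : vf :=
  D X (D Y Z) - D Y (D X Z) - D (lie X Y) Z.

Definition orthonormal_at p (E : 'I_m -> vf) : Prop :=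
  forall i j, g (E i) (E j) p = (i == j)%:R.

(* Some vector fields that are orthonormal at [p]: the traces below do not
   depend on the choice. *)
Definition frame_at p : 'I_m -> vf :=
  xget (fun _ => 0) [set E | orthonormal_at p E].

Definition ricci X Y p : R :=
  \sum_(i < m) g (curvature (frame_at p i) X Y) (frame_at p i) p.

Definition scalar_curvature p : R :=
  \sum_(i < m) ricci (frame_at p i) (frame_at p i) p.

Definition einstein : Prop := exists a : C^oo M,
  forall X Y p, ricci X Y p = a p * g X Y p.

Definition ricci_flat : Prop := forall X Y p, ricci X Y p = 0.
End Curvature.

(** * Almost contact metric structures *)

Record almost_contact (g : metric) := AlmostContact {
  phi : endo_field ;
  xi : vf ;
  eta : one_form ;
  phi2 : forall X, phi (phi X) = - X + (eta X : C^oo M) *: xi ;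
  eta_xi : eta xi = 1 ;
  metric_phi : forall X Y, g (phi X) (phi Y) = g X Y - eta X * eta Y }.

Section AlmostContact.
Variables (g : metric) (S : almost_contact g).

Definition fundamental_form X Y : C^oo M := g X (phi S Y).

Definition nijenhuis (h : endo_field) X Y : vf :=
  h (h (lie X Y)) + lie (h X) (h Y) - h (lie (h X) Y) - h (lie X (h Y)).

Definition normal : Prop := forall X Y,
  nijenhuis (phi S) X Y + (ext_d1 (eta S) X Y *+ 2) *: xi S = 0.

Definition quasi_sasakian : Prop :=
  normal /\ (forall X Y Z, ext_d2 fundamental_form X Y Z = 0).

Definition cosymplectic : Prop :=
  [/\ normal, forall X Y Z, ext_d2 fundamental_form X Y Z = 0
    & forall X Y, ext_d1 (eta S) X Y = 0].

Definition alpha_sasakian (a : R) : Prop :=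
  [/\ normal, a != 0
    & forall X Y, ext_d1 (eta S) X Y = a *: fundamental_form X Y].
End AlmostContact.
End Tensors.

(** * Almost 3-contact metric manifolds *)

(* The indices 1, 2, 3 are the elements 0, 1, 2 of ['I_3]; an even permutation
   (alpha, beta, gamma) is (s 0, s 1, s 2) with [s : 'S_3] even. *)
Record almost_3contact (R : realType) (n : nat) (M : manifold R (4 * n + 3)%N)
    (g : metric M) := Almost3Contact {
  ac :> 'I_3 -> almost_contact g ;
  ac_compat : forall s : 'S_3, ~~ odd_perm s ->
    let a := s 0 in let b := s 1 in let c := s 2 in
    [/\ forall X, phi (ac c) X =
          phi (ac a) (phi (ac b) X) - (eta (ac b) X : C^oo M) *: xi (ac a),
        forall X, phi (ac c) X =
          - phi (ac b) (phi (ac a) X) + (eta (ac a) X : C^oo M) *: xi (ac b),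
        xi (ac c) = phi (ac a) (xi (ac b)) /\
          xi (ac c) = - phi (ac b) (xi (ac a))
      & forall X, eta (ac c) X = eta (ac a) (phi (ac b) X) /\
          eta (ac c) X = - eta (ac b) (phi (ac a) X)] }.

Section ThreeStructures.
Variables (R : realType) (n : nat) (M : manifold R (4 * n + 3)%N) (g : metric M).
Variable S : almost_3contact g.

(* Each of the three structures is required to have constant rank. *)
Definition three_quasi_sasakian : Prop :=
  forall d, quasi_sasakian (S d) /\ exists r, has_rank (eta (S d)) r.

Definition three_cosymplectic : Prop := forall d, cosymplectic (S d).

Definition three_alpha_sasakian : Prop :=
  forall d, exists a : R, alpha_sasakian (S d) a.

Definition rank3qs (r : nat) : Prop := forall d, has_rank (eta (S d)) r.

Definition eta_einstein (D : levi_civita g) : Prop := exists a b : C^oo M,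
  forall X Y p, ricci D X Y p =
    a p * g X Y p + b p * \sum_(d < 3) eta (S d) X p * eta (S d) Y p.
End ThreeStructures.

(* Main.v *)
(* Each [phi_d nabla xi_d] is a symmetric operator commuting with [phi_d], and
   differentiating [phi_c = phi_a phi_b - eta_b (x) xi_a] shows that the three
   operators differ only on the span of the [xi]: adding [h eta_d (x) xi_d] for a
   common function [h] makes them equal to one operator [A], with
   [nabla_X xi_d = - phi_d (A X)] and [A xi_d = h xi_d]. Closedness of the three
   fundamental forms and the Bianchi identity give [nabla A = 0], [A^2 = h A] and
   [h] constant. Subtracting from the curvature the Gauss-type term
   [g(A Y, Z) A X - g(A X, Z) A Y] leaves a tensor with the symmetries of a
   hyper-Kahler curvature tensor, hence Ricci-flat, so that
   [Ric(X, Y) = (tr A - h) g(A X, Y)]. If [h = 0] then [A = 0]: this is the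
   cosymplectic case. Otherwise [A / h] is a projection containing the [xi_d] in
   its image, [tr A - h <> 0], and the eta-Einstein condition forces [A] to be
   [h] or [0] on the orthogonal complement of the [xi_d] at each point; the
   former everywhere is the alpha-Sasakian case, the latter at one point means
   that [d eta_d] is decomposable there, i.e. rank 3. *)

From HB Require Import structures.
Require Import Defs.
From mathcomp Require Import all_boot all_order all_algebra.
From mathcomp Require Import perm ring lra.
From mathcomp Require Import all_classical reals topology normedtype derive.
From mathcomp Require Import realfun landau ereal.
From mathcomp Require Import sequences exp measure lebesgue_measure lebesgue_integral ftc.

Set Implicit Arguments.
Unset Strict Implicit.
Unset Printing Implicit Defensive.

Import Order.TTheory GRing.Theory Num.Theory.
Import numFieldNormedType.Exports.

Local Open Scope classical_set_scope.
Local Open Scope ring_scope.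

(** * Calculus on [R^m] *)

(** Vector fields are global derivations and tensors are maps linear over [C^oo M], so no tangent
    space is available at the outset. Traces, and the fact that a [C^oo M]-linear map is determined
    pointwise, need local frames; these require that a derivation be a combination of coordinate
    derivatives near each point. That is what the bump functions and Hadamard's lemma are for. The
    geometry takes from this analysis only the frames and the constancy of functions killed by every
    vector field.

    The remainder is linear algebra: a vector field is tested by pairing it with another one at a
    point, and closedness, normality and the Bianchi identity become linear relations between real
    numbers.

    Two symmetry arguments carry the geometry. The difference of two of the operators
    [phi_d nabla xi_d] is expressed through the third one evaluated on the [xi]; since that
    difference is symmetric, the [xi] must be eigenvectors. And the Ricci form of the hyper-Kahler
    part is unchanged when the frame is rotated by another [phi], which anticommutes with the first
    up to terms in the [xi], so it equals its own opposite. *)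

Section Calculus.
Variables (R : realType) (m : nat).
Implicit Types (U : set 'rV[R]_m) (f g : 'rV[R]_m -> R) (x y z : 'rV[R]_m).
Local Notation e i := (delta_mx 0 i : 'rV[R]_m).

Lemma is_derive_line f z v t : derivable f (t *: v + z) v ->
  is_derive t 1 (fun s : R => f (s *: v + z)) ('D_v f (t *: v + z)).
Proof.
move=> df; have E : (fun h : R => h^-1 *: (f ((h *: 1 + t) *: v + z) - f (t *: v + z)))
   = (fun h : R => h^-1 *: (f (h *: v + (t *: v + z)) - f (t *: v + z))).
  by apply/funext => h; rewrite scalerDl addrA; congr (_ *: (f (_ *: _ + _ + _) - _)); rewrite /GRing.scale /= mulr1.
apply: DeriveDef; first by rewrite /derivable /= E.
by rewrite /derive /= E.
Qed.

Lemma norm_MVT (phi dphi : R -> R) (u v C : R) :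
  (forall t, Order.min u v <= t <= Order.max u v ->
     is_derive t 1 phi (dphi t) /\ `|dphi t| <= C) ->
  `|phi v - phi u| <= C * `|v - u|.
Proof.
wlog uv : u v / u <= v.
  move=> H; case: (leP u v) => [uv|/ltW vu] P; first by apply: H => //; case: leP P uv.
  rewrite distrC (distrC v); apply: H => // t; move: P; case: (leP v u) vu => // vu _.
  exact.
rewrite (min_idPl uv) (max_idPr uv) => P.
have [||c] := @MVT_segment R phi dphi u v uv.
- by move=> t; rewrite in_itv /= => /andP[a b]; have [] := P t; rewrite ?(ltW a) ?(ltW b).
- apply: derivable_within_continuous => t; rewrite in_itv /= => tuv.
  by have [] := P t tuv; move=> [].
rewrite in_itv /= => cuv ->; rewrite normrM ler_wpM2r//.
by have [] := P c cuv.
Qed.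

Definition interp x y (k : nat) : 'rV[R]_m := \row_i (if (i < k)%N then y 0 i else x 0 i).

Lemma coord_norm_le (v : 'rV[R]_m) i : `|v 0 i| <= `|v|.
Proof. rewrite [X in _ <= X]/Num.norm/= mx_normrE; exact: (le_bigmax _ (fun k => `|v k.1 k.2|) (0, i)). Qed.

Lemma norm_coord_le (v : 'rV[R]_m) C : 0 <= C -> (forall i, `|v 0 i| <= C) -> `|v| <= C.
Proof.
move=> C0 H; rewrite [X in X <= _]/Num.norm/= mx_normrE; apply: bigmax_le => // -[i j] _ /=.
by rewrite ord1.
Qed.

Lemma interpS x y (k : 'I_m) : interp x y k.+1 = (y 0 k - x 0 k) *: e k + interp x y k.
Proof.
apply/rowP => i; rewrite !mxE /= ltnS leq_eqVlt.
have [->|ik] := eqVneq i k; first by rewrite eqxx ltnn /= mulr1 subrK.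
by rewrite -val_eqE /= in ik; rewrite (negbTE ik) mulr0 add0r.
Qed.

(* Telescoping along the coordinate directions, so that only partial
   derivatives are involved. *)
Lemma partials_lipschitz f x (r C : R) : 0 <= C ->
  (forall y, `|y - x| < r -> forall i, derivable f y (e i) /\ `|'D_(e i) f y| <= C) ->
  forall y, `|y - x| < r -> `|f y - f x| <= m%:R * C * `|y - x|.
Proof.
move=> C0 H y yr.
have step (k : nat) : (k <= m)%N -> `|f (interp x y k) - f x| <= k%:R * C * `|y - x|.
  elim: k => [|k IHk] km.
    by rewrite (_ : interp x y 0 = x) ?subrr ?normr0 ?mul0r//; apply/rowP => i; rewrite mxE.
  have := IHk (ltnW km).
  pose k' := Ordinal km; set d := y 0 k' - x 0 k'.
  have -> : interp x y k.+1 = d *: e k' + interp x y k by exact: (interpS x y k').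
  have -> : f (interp x y k) = f (0 *: e k' + interp x y k) by rewrite scale0r add0r.
  have : `|f (d *: e k' + interp x y k) - f (0 *: e k' + interp x y k)| <= C * `|d - 0|.
    apply: (@norm_MVT (fun s => f (s *: e k' + interp x y k))
      (fun s => 'D_(e k') f (s *: e k' + interp x y k))) => t td.
    have tr : `|t *: e k' + interp x y k - x| < r.
      apply: le_lt_trans yr; apply: norm_coord_le => // i; rewrite !mxE /=.
      have [->|ik] := eqVneq i k'.
        rewrite /= mulr1 ltnn addrK; have := coord_norm_le (y - x) k'; rewrite !mxE -/d.
        apply: le_trans; move: td; case: (leP 0 d) => d0 /andP[t1 t2].
          by rewrite !ger0_norm.
        by rewrite !ler0_norm ?lerN2// ltW.
      rewrite mulr0 add0r; case: ifP => _; last by rewrite subrr normr0.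
      by have := coord_norm_le (y - x) i; rewrite !mxE.
    by have [dd bd] := H _ tr k'; split; [apply: is_derive_line dd|apply: bd].
  have dle : `|d| <= `|y - x| by have := coord_norm_le (y - x) k'; rewrite !mxE.
  rewrite subr0 -natr1 => H1 H2.
  have -> : f (d *: e k' + interp x y k) - f x =
    (f (d *: e k' + interp x y k) - f (0 *: e k' + interp x y k)) + (f (0 *: e k' + interp x y k) - f x).
    by rewrite addrA subrK.
  apply: le_trans (ler_normD _ _) _; rewrite mulrDl mul1r mulrDl addrC; apply: lerD => //.
  by apply: le_trans H1 _; apply: ler_wpM2l.
have := step m (leqnn m); rewrite (_ : interp x y m = y)//.
by apply/rowP => i; rewrite mxE ltn_ord.
Qed.

End Calculus.

(** A $C^1$ function is brought to this case by subtracting its candidate differential. *)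
Lemma differentiable0 (R : realType) (V W : normedModType R) (g : V -> W) (x : V) :
  (forall eps, 0 < eps ->
    \forall y \near 0, `|g (y + x) - g x| <= eps * `|y|) -> differentiable g x.
Proof.
move=> H.
have gx : g \o shift x = cst (g x) + (\0 : {linear V -> W}) +o_ 0 id.
  by apply/eqaddoP => eps eps0; apply: filterS (H _ eps0) => y; rewrite !fctE addr0.
have E : 'd g x = (\0 : {linear V -> W}) :> (V -> W).
  by apply: (@diff_unique _ _ _ g (\0 : {linear V -> W})) => //; exact: cst_continuous.
by apply/diff_locallyP; rewrite E; split => //; exact: cst_continuous.
Qed.

Section Differentiability.
Variables (R : realType) (m : nat).
Implicit Types (f g : 'rV[R]_m -> R) (x y z v : 'rV[R]_m).
Local Notation e i := (delta_mx 0 i : 'rV[R]_m).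

Definition lin_form (c : 'I_m -> R) (y : 'rV[R]_m) : R := \sum_i y 0 i * c i.

Lemma lin_form_is_linear c : linear (lin_form c : 'rV[R]_m -> R).
Proof.
move=> a x y; rewrite /lin_form scaler_sumr -big_split /=; apply: eq_bigr => i _.
by rewrite !mxE mulrDl -mulrA.
Qed.

Lemma lin_form_diff c x : differentiable (lin_form c : 'rV[R]_m -> R) x.
Proof.
rewrite (_ : lin_form c = \sum_i (fun y : 'rV[R]_m => y 0 i * c i)); last first.
  by apply/funext => y; rewrite fct_sumE.
apply: differentiable_sum => i; apply: differentiableM => //; exact: differentiable_coord.
Qed.

Lemma derive_lin_form c x i :
  is_derive x (e i) (lin_form c : 'rV[R]_m -> R) (c i).
Proof.
apply: DeriveDef; first by apply: diff_derivable; exact: lin_form_diff.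
rewrite /derive (_ : (fun h : R => _) = fun h : R => h^-1 *: (h *: c i)); last first.
  apply/funext => h; rewrite /= (lin_form_is_linear c h) addrK; congr (_ *: (_ *: _)).
  rewrite /lin_form (bigD1 i) //= big1 ?addr0 => [|j ji]; rewrite mxE !eqxx ?mul1r//=.
  by rewrite (negbTE ji) mul0r.
apply: cvg_lim => //; apply: (@cvg_trans _ (cst (c i) @ (0 : R)^')); last exact: cvg_cst.
apply: near_eq_cvg; near=> h; rewrite scalerA mulVf ?scale1r//.
by near: h; exact: nbhs_dnbhs_neq.
Unshelve. all: by end_near. Qed.

(** After subtraction of the linear form built from the partial derivatives at [x], the partials of
    the remainder are small near [x]; [partials_lipschitz] then makes the remainder Lipschitz at [x]
    with an arbitrarily small constant. *)
Lemma C1_differentiable f x :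
  (\forall y \near x, forall i, derivable f y (e i)) ->
  (forall i, {for x, continuous ('D_(e i) f)}) -> differentiable (f : _ -> R) x.
Proof.
move=> df cf; pose c i := 'D_(e i) f x.
pose g := (f : 'rV[R]_m -> R) - (lin_form c : 'rV[R]_m -> R).
rewrite (_ : f = g + lin_form c); last by rewrite /g subrK.
apply: differentiableD; last exact: lin_form_diff.
apply: differentiable0 => eps eps0.
(* [partials_lipschitz] costs a factor [m]; dividing by [m + 1] absorbs it and also covers
   [m = 0]. *)
pose C := eps / (m%:R + 1).
  have C0 : 0 < C by rewrite divr_gt0// ltr_wpDl.
  have : \forall y \near x, forall i, derivable f y (e i) /\ `|'D_(e i) f y - c i| <= C.
    near=> y => i; split; first by move: i; near: y.
    rewrite distrC; move: i; near: y; apply: filter_forall => i.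
    by have /cvgrPdist_le := cf i; apply.
  move=> /nbhs_ballP[r /= r0 Hr].
  have H y : `|y - x| < r -> forall i, derivable g y (e i) /\ `|'D_(e i) g y| <= C.
    rewrite distrC => yr i; have [|d1 d2] := Hr y _ i; first by rewrite -ball_normE.
    have [dl vl] := derive_lin_form c y i.
    by split; [exact: derivableB|rewrite (deriveB d1 dl) vl].
  have := partials_lipschitz (ltW C0) H => {}H.
  apply/nbhs_ballP; exists r => //= y.
rewrite -ball_normE /= sub0r normrN => yr.
have := H (y + x); rewrite addrK => /(_ yr) /le_trans; apply.
rewrite ler_wpM2r// /C mulrCA ler_piMr ?(ltW eps0)// ler_pdivrMr ?ltr_wpDl//.
by rewrite mul1r lerDl.
Unshelve. all: by end_near. Qed.

Lemma derive_diffE f x v : differentiable (f : _ -> R) x ->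
  'D_v f x = \sum_i v 0 i * 'D_(e i) f x.
Proof.
move=> df; rewrite deriveE // {1}[v]row_sum_delta linear_sum; apply: eq_bigr => i _.
by rewrite linearZ deriveE.
Qed.

Lemma is_derive_curve (gam : R -> 'rV[R]_m) (t : R) (dgam : 'I_m -> R) f :
  differentiable (f : _ -> R) (gam t) ->
  (forall i, is_derive t 1 (fun s => gam s 0 i) (dgam i)) ->
  is_derive t 1 (f \o gam : R -> R) (\sum_i dgam i * 'D_(e i) f (gam t)).
Proof.
move=> df dg.
have gd : derivable gam t 1.
  by apply/derivable_mxP => i j; rewrite ord1; case: (dg j).
have gdiff : differentiable gam t by apply/derivable1_diffP.
have fgd := differentiable_comp gdiff df.
apply: DeriveDef; first exact/derivable1_diffP.
rewrite deriveE // diff_comp //= -[in LHS]deriveE // -[X in 'D_X _ _]deriveE // derive_diffE // derive_mx //.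
by apply: eq_bigr => i _; rewrite mxE; have /@derive_val -> := dg i.
Qed.

Lemma derivable_lineP f x v :
  derivable f x v <-> derivable (fun s : R => f (s *: v + x)) 0 1.
Proof.
rewrite /derivable (_ : (fun h : R => h^-1 *: (f (h *: v + x) - f x)) = (fun h : R => h^-1 *: (((fun s : R => f (s *: v + x)) \o shift 0) (h *: 1) - f (0 *: v + x)))) //.
by apply/funext => h /=; rewrite scale0r add0r addr0 [h *: 1]mulr1.
Qed.

Lemma derive_lineE f x v :
  'D_v f x = 'D_1 (fun s : R => f (s *: v + x)) 0.
Proof.
rewrite /derive (_ : (fun h : R => h^-1 *: ((f \o shift x) (h *: v) - f x)) = (fun h : R => h^-1 *: (((fun s : R => f (s *: v + x)) \o shift 0) (h *: 1) - f (0 *: v + x)))) //.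
by apply/funext => h /=; rewrite scale0r add0r addr0 [h *: 1]mulr1.
Qed.
End Differentiability.

Section SmoothCalculus.
Variables (R : realType) (m : nat).
Implicit Types (U : set 'rV[R]_m) (f g : 'rV[R]_m -> R) (x y z v : 'rV[R]_m).
Local Notation e i := (delta_mx 0 i : 'rV[R]_m).

Lemma Ck_continuous k U f x : Ck k U f -> U x -> {for x, continuous f}.
Proof. by case: k => [|k] [cf _]; exact: cf. Qed.

Lemma CkS_derivable k U f x i : Ck k.+1 U f -> U x -> derivable f x (e i).
Proof. by move=> [_ df]; have [] := df i => + _; exact. Qed.

Lemma CkS_derive k U f i : Ck k.+1 U f -> Ck k U ('D_(e i) f).
Proof. by move=> [_ df]; have [] := df i. Qed.

Lemma CinfM U f g : open U -> Cinf U f -> Cinf U g -> Cinf U (f * g).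
Proof. by move=> oU cf cg k; exact: CkM. Qed.

Lemma Cinf_cst U (a : R) : Cinf U (cst a).
Proof. by move=> k; exact: Ck_cst. Qed.

Lemma Cinf_derive U f i : Cinf U f -> Cinf U ('D_(e i) f).
Proof. by move=> cf k; exact: CkS_derive (cf k.+1). Qed.

Lemma Ck_sum k U (I : Type) (r : seq I) (F : I -> 'rV[R]_m -> R) : open U ->
  (forall i, Ck k U (F i)) -> Ck k U (fun x => \sum_(i <- r) F i x).
Proof.
move=> oU H; elim: r => [|i r IHr].
  rewrite (_ : (fun _ => _) = cst 0); first exact: Ck_cst.
  by apply/funext => x; rewrite big_nil.
rewrite (_ : (fun _ => _) = F i + (fun x => \sum_(j <- r) F j x)); first exact: CkD.
by apply/funext => x; rewrite big_cons.
Qed.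

Lemma Ck_subset k U V f : V `<=` U -> Ck k U f -> Ck k V f.
Proof.
move=> VU; elim: k f => [|k IHk] f [cf df]; split => //.
- by move=> x Vx; apply/cf/VU.
- by move=> x Vx; apply/cf/VU.
- move=> i; have [d1 d2] := df i; split; last exact: IHk.
  by move=> x Vx; apply/d1/VU.
Qed.

(** [Ck] is a condition at each point of the set on derivatives of the total function, so pieces
    glue without any overlap condition. *)
Lemma Ck_setU k U V f : Ck k U f -> Ck k V f -> Ck k (U `|` V) f.
Proof.
elim: k f => [|k IHk] f [cU dU] [cV dV]; split => //.
- by move=> x [/cU|/cV].
- by move=> x [/cU|/cV].
- move=> i; have [d1 d2] := dU i; have [d3 d4] := dV i; split; last exact: IHk.
  by move=> x [/d1|/d3].
Qed.

Lemma Ck_differentiable k U f x : open U -> Ck k.+1 U f -> U x ->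
  differentiable (f : _ -> R) x.
Proof.
move=> oU cf Ux; apply: C1_differentiable.
  have : \forall y \near x, U y by exact: open_nbhs_nbhs.
  by apply: filterS => y Uy i; exact: CkS_derivable cf Uy.
by move=> i; exact: Ck_continuous (CkS_derive i cf) Ux.
Qed.

Lemma derive_coord x i j : is_derive x (e i) (fun y => y 0 j) ((i == j)%:R : R).
Proof.
have -> : (fun y : 'rV[R]_m => y 0 j) = lin_form (fun i => (i == j)%:R).
  apply/funext => y; rewrite /lin_form (bigD1 j) //= eqxx mulr1 big1 ?addr0// => k kj.
  by rewrite (negbTE kj) mulr0.
exact: derive_lin_form.
Qed.

Lemma Cinf_coord U i : open U -> Cinf U (fun x => x 0 i).
Proof.
move=> oU [|k]; split => //.
- by move=> x _; exact: coord_continuous.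
- by move=> x _; exact: coord_continuous.
move=> j; split; first by move=> x _; have [] := derive_coord x j i.
apply: eq_on_Ck (Ck_cst k U ((j == i)%:R)) => // x Ux.
by have /@derive_val -> := derive_coord x j i.
Qed.

Lemma is_derive_comp1 (phi : R -> R) f x i (dphi : R) : derivable f x (e i) ->
  is_derive (f x) 1 phi dphi ->
  is_derive x (e i) (phi \o f) (dphi * 'D_(e i) f x).
Proof.
move=> df dp.
have d0 : is_derive (0 : R) 1 (fun s : R => f (s *: e i + x)) ('D_(e i) f x).
  by apply: DeriveDef; [exact/derivable_lineP|rewrite -derive_lineE].
have dp' : is_derive ((fun s : R => f (s *: e i + x)) 0) 1 phi dphi.
  by rewrite scale0r add0r.
have [d1 d2] := is_derive1_comp dp' d0.
apply: DeriveDef; first exact/derivable_lineP.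
by rewrite derive_lineE.
Qed.
End SmoothCalculus.

Lemma rV_continuous (T : topologicalType) (R : realType) n (tau : T -> 'rV[R]_n) x :
  (forall j, {for x, continuous (fun y => tau y 0 j)}) -> {for x, continuous tau}.
Proof.
move=> H; apply/cvgrPdist_le => eps eps0; near=> y.
apply: norm_coord_le; first exact: ltW.
move=> i; rewrite !mxE; move: i; near: y; apply: filter_forall => i.
by have /cvgrPdist_le := H i; apply.
Unshelve. all: by end_near. Qed.

Lemma is_derive_comp (R : realType) m n (f : 'rV[R]_n -> R) (tau : 'rV[R]_m -> 'rV[R]_n) x i :
  differentiable f (tau x) ->
  (forall j, derivable (fun y => tau y 0 j) x (delta_mx 0 i)) ->
  is_derive x (delta_mx 0 i) (f \o tau)
    (\sum_j 'D_(delta_mx 0 i) (fun y => tau y 0 j) x * 'D_(delta_mx 0 j) f (tau x)).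
Proof.
move=> df dt.
have [d1 d2] : is_derive (0 : R) 1 (f \o (fun s : R => tau (s *: delta_mx 0 i + x)))
    (\sum_j 'D_(delta_mx 0 i) (fun y => tau y 0 j) x * 'D_(delta_mx 0 j) f (tau x)).
  have := @is_derive_curve R n (fun s : R => tau (s *: delta_mx 0 i + x)) 0
    (fun j => 'D_(delta_mx 0 i) (fun y => tau y 0 j) x) f.
  rewrite scale0r add0r; apply => // j.
  apply: DeriveDef; first by move/derivable_lineP : (dt j).
  by rewrite [RHS]derive_lineE.
apply: DeriveDef; first exact/derivable_lineP.
by rewrite derive_lineE.
Qed.

(** By the chain rule a partial derivative of [f \o tau] is a sum of products of partials of [tau]
    with functions ['D_j f \o tau], to which the induction hypothesis applies. This transports
    smoothness through a change of charts. *)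
Lemma Ck_comp (R : realType) m n k (U : set 'rV[R]_m) (W : set 'rV[R]_n)
  (f : 'rV[R]_n -> R) (tau : 'rV[R]_m -> 'rV[R]_n) :
  open U -> open W -> (forall x, U x -> W (tau x)) ->
  Ck k W f -> (forall j, Ck k U (fun x => tau x 0 j)) -> Ck k U (f \o tau).
Proof.
move=> oU oW UW; elim: k f => [|k IHk] f cf ct; have tauc : forall x, U x ->
    {for x, continuous (f \o tau)} by
  move=> x Ux; apply: continuous_comp; [
    apply: rV_continuous => j; exact: Ck_continuous (ct j) Ux
  | exact: Ck_continuous cf (UW _ Ux)].
- by split.
have H x i : U x -> is_derive x (delta_mx 0 i) (f \o tau)
    (\sum_j 'D_(delta_mx 0 i) (fun y => tau y 0 j) x * 'D_(delta_mx 0 j) f (tau x)).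
  move=> Ux; apply: is_derive_comp => [|j]; first exact: Ck_differentiable cf (UW _ Ux).
  exact: CkS_derivable (ct j) Ux.
split => // i; split; first by move=> x /(H x i)[].
apply: eq_on_Ck (_ : Ck k U (fun x => \sum_j ('D_(delta_mx 0 i) (fun y => tau y 0 j) *
     ('D_(delta_mx 0 j) f \o tau)) x)) => //.
  by move=> x Ux; have [_ ->] := H x i Ux.
apply: Ck_sum => // j; apply: CkM => //; first exact: CkS_derive (ct j).
apply: IHk; first exact: CkS_derive.
by move=> l; apply: CkW.
Qed.

(** * Bump functions and Hadamard's lemma *)

Section Bump.
Variable R : realType.

(** The functions $t^{-k}e^{-1/t}$ extended by zero. The powers of $1/t$ close the family under
    differentiation; only [flat 0] enters the bump function. *)
Definition flat (k : nat) (t : R) : R := if 0 < t then t^-1 ^+ k * expR (- t^-1) else 0.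

(** With $u = 1/t$ this is $u^{k+1} \le (k+1)!\,e^u$, one term of the exponential series. It yields
    the derivative at 0. *)
Lemma flat_le k (t : R) : `|flat k t| <= (k.+1)`!%:R * `|t|.
Proof.
rewrite /flat; case: ifP => t0; last by rewrite normr0 mulr_ge0// ler0n.
rewrite (gtr0_norm t0) ger0_norm; last first.
  by rewrite mulr_ge0 ?expR_ge0 ?exprn_ge0 ?invr_ge0 ?ltW.
have u0 : 0 < t^-1 by rewrite invr_gt0.
have := expR_ge1Dxn k (ltW u0); move=> H.
have {}H : t^-1 ^+ k.+1 / (k.+1)`!%:R <= expR t^-1.
  by apply: le_trans H; rewrite lerDr.
have f0 : 0 < (k.+1)`!%:R :> R by rewrite ltr0n fact_gt0.
rewrite expRN ler_pdivrMr ?expR_gt0//.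
rewrite ler_pdivrMr // exprSr in H.
rewrite -(ler_pM2r u0); apply: le_trans H _.
suff -> : (k.+1)`!%:R * t * expR t^-1 / t = expR t^-1 * (k.+1)`!%:R by [].
by field; rewrite gt_eqF.
Qed.

Lemma flat_div k (t : R) : t != 0 -> t^-1 * flat k t = flat k.+1 t.
Proof. by rewrite /flat; case: ifP => _ _; rewrite ?mulr0// mulrA exprS. Qed.

Lemma is_derive_flat k (t : R) :
  is_derive t 1 (flat k) (- k%:R * flat k.+1 t + flat k.+2 t).
Proof.
have [t0|t0|->] := ltgtP t 0.
- have E : \forall y \near t, cst 0 y = flat k y.
    have : \forall y \near t, y < 0 by exact: (lt_nbhsl t0).
    by apply: filterS => y y0; rewrite /flat ltNge (ltW y0).
  have [d1 d2] := is_derive_cst (0 : R) t 1.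
  apply: DeriveDef; first exact: near_eq_derivable E d1.
  rewrite -(near_eq_derive _ E) ?oner_eq0// d2.
  by rewrite /flat !ltNge !(ltW t0) /= mulr0 addr0.
- have E : \forall y \near t, (fun y => y^-1 ^+ k * expR (- y^-1)) y = flat k y.
    have : \forall y \near t, 0 < y by exact: (lt_nbhsr t0).
    by apply: filterS => y y0; rewrite /flat y0.
  have tn0 : t != 0 by rewrite gt_eqF.
  have dV : is_derive t 1 (fun y : R => y^-1) (- t ^- 2).
    by apply: is_derive_eq (is_deriveV tn0 (is_derive_id t 1)) _; rewrite /GRing.scale /= mulr1.
  have dN : is_derive t 1 (fun y : R => - y^-1) (t ^- 2).
    by apply: is_derive_eq (is_deriveN dV) _; rewrite opprK.
  have dE : is_derive t 1 (expR \o (fun y : R => - y^-1)) (t ^- 2 * expR (- t^-1)).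
    by apply: is_derive_eq (is_derive1_comp (is_derive_expR _) dN) _; rewrite mulrC.
  have dX : is_derive t 1 (fun y : R => y^-1 ^+ k) (- k%:R * t^-1 ^+ k.+1).
    rewrite (_ : (fun y : R => y^-1 ^+ k) = (fun y : R => y^-1) ^+ k); last first.
      by apply/funext => y; elim: k {E} => [|k IHk]; rewrite ?expr0 // !exprS IHk.
    apply: is_derive_eq (is_deriveX k dV) _.
    rewrite /GRing.scale /=.
    case: k {E} => [|k]; first by rewrite !mulr0n oppr0 !mul0r.
    rewrite /= !exprS; move: (t^-1 ^+ k) (k.+1%:R : R) => z w.
    by field.
  have [d1 d2] := is_deriveM dX dE.
  apply: DeriveDef; first exact: near_eq_derivable E d1.
  rewrite -(near_eq_derive _ E) ?oner_eq0// d2 /flat t0.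
  rewrite /GRing.scale /= !exprS; move: (t^-1 ^+ k) (expR _) => z w.
  by field.
(* At 0 the difference quotient of [flat k] is [flat k.+1] by [flat_div], and [flat_le] sends it to
   0. *)
have H : h^-1 *: ((flat k \o shift 0) (h *: 1) - flat k 0) @[h --> (0 : R)^'] --> (0 : R).
  have fl0 : flat k 0 = 0 by rewrite /flat ltxx.
  apply/cvgrPdist_le => eps eps0; near=> h.
  have h0 : h != 0 by near: h; exact: nbhs_dnbhs_neq.
  rewrite /= fl0 addr0 subr0 sub0r normrN [h *: 1]mulr1 [_ *: _]flat_div //.
  apply: le_trans (flat_le _ _) _.
  rewrite mulrC -ler_pdivlMr ?ltr0n ?fact_gt0//.
  near: h; apply: dnbhs0_le; by rewrite divr_gt0 ?ltr0n ?fact_gt0.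
have -> : - k%:R * flat k.+1 0 + flat k.+2 0 = 0 by rewrite /flat ltxx mulr0 addr0.
apply: DeriveDef; first by apply/cvg_ex; exists 0.
exact: cvg_lim H.
Unshelve. all: by end_near. Qed.

Lemma Ck_flat m (s : 'rV[R]_m -> R) : Cinf setT s ->
  forall n k, Ck n setT (flat k \o s).
Proof.
move=> cs; elim=> [|n IHn] k.
  split => // x _; apply: continuous_comp; first exact: Ck_continuous (cs 0%N) I.
  apply: differentiable_continuous; apply/derivable1_diffP.
  by have [] := is_derive_flat k (s x).
split.
  move=> x _; apply: continuous_comp; first exact: Ck_continuous (cs 0%N) I.
  apply: differentiable_continuous; apply/derivable1_diffP.
  by have [] := is_derive_flat k (s x).
move=> i.
have H x : is_derive x (delta_mx 0 i) (flat k \o s)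
   ((- k%:R * flat k.+1 (s x) + flat k.+2 (s x)) * 'D_(delta_mx 0 i) s x).
  apply: is_derive_comp1; last exact: is_derive_flat.
  exact: CkS_derivable (cs 1%N) I.
split; first by move=> x _; case: (H x).
apply: (@eq_on_Ck _ _ _ _ ((cst (- k%:R) * (flat k.+1 \o s) + (flat k.+2 \o s)) * 'D_(delta_mx 0 i) s)).
- exact: openT.
- by move=> x _; have [_ ->] := H x.
apply: CkM; [exact: openT| |exact: Cinf_derive].
apply: CkD => //; first exact: openT.
by apply: CkM => //; [exact: openT|exact: Ck_cst].
Qed.

Variable m : nat.
Implicit Types a x : 'rV[R]_m.

(** The Euclidean square is used since it is polynomial, while the norm of ['rV[R]_m] is the sup
    norm; a Euclidean ball lies in the sup ball of the same radius, whence [bump_support]. The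
    denominator normalizes the value at [a] to 1. *)
Definition smooth_bump a (r : R) x : R :=
  flat 0 (r ^+ 2 - \sum_i (x 0 i - a 0 i) ^+ 2) / flat 0 (r ^+ 2).

Lemma Cinf_bump a r : Cinf setT (smooth_bump a r).
Proof.
have oT : open [set: 'rV[R]_m] by exact: openT.
pose s x : R := r ^+ 2 + \sum_i - ((x 0 i - a 0 i) ^+ 2).
have cs : Cinf setT s.
  move=> k; apply: (CkD (g := fun x => \sum_i - ((x 0 i - a 0 i) ^+ 2)) oT (Ck_cst k _ (r ^+ 2))).
  apply: Ck_sum => // i.
  have ci : Ck k setT ((fun x : 'rV[R]_m => x 0 i) + cst (- a 0 i)).
    by apply: CkD => //; [exact: Cinf_coord|exact: Ck_cst].
  have := CkM oT (Ck_cst k setT (-1)) (CkM oT ci ci).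
  by apply: eq_on_Ck => // x _; rewrite !fctE expr2 mulN1r.
move=> k; have := CkM oT (Ck_flat cs k 0) (Ck_cst k setT (flat 0 (r ^+ 2))^-1).
by apply: eq_on_Ck => // x _; rewrite !fctE /smooth_bump /s sumrN.
Qed.

Lemma bump_center a r : 0 < r -> smooth_bump a r a = 1.
Proof.
move=> r0; rewrite /smooth_bump big1 => [|i _]; last by rewrite subrr expr0n.
rewrite subr0 mulfV // /flat exprn_gt0//.
by rewrite mulf_neq0 ?expf_neq0 ?invr_eq0 ?gt_eqF ?expR_gt0 ?exprn_gt0.
Qed.

Lemma bump_support a r x : 0 < r -> smooth_bump a r x != 0 -> `|x - a| <= r.
Proof.
move=> r0; rewrite /smooth_bump /flat; case: ifP => [H _|]; last by rewrite mul0r eqxx.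
apply: norm_coord_le; first exact: ltW.
move=> i; rewrite !mxE -(ler_pXn2r (n := 2)) ?nnegrE ?(ltW r0)// real_normK ?num_real//.
apply: ltW; rewrite subr_gt0 in H; apply: le_lt_trans H.
by rewrite (bigD1 i) //= lerDl; apply: sumr_ge0 => j _; rewrite sqr_ge0.
Qed.
End Bump.

Lemma locally_lipschitz_continuous (R : realType) (V : normedModType R) (g : V -> R)
  (x : V) (C : R) : 0 <= C ->
  (forall y, `|y - x| < 1 -> `|g y - g x| <= C * `|y - x|) -> {for x, continuous g}.
Proof.
move=> C0 H; apply/cvgrPdist_le => eps eps0; near=> y.
have yx : `|x - y| <= eps / (C + 1).
  near: y; apply: cvgr_dist_le; first exact: cvg_id.
  by rewrite divr_gt0// ltr_wpDl.
rewrite distrC; apply: le_trans (H _ _) _.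
  by rewrite distrC; near: y; apply: cvgr_dist_lt; [exact: cvg_id|exact: ltr01].
rewrite distrC; apply: le_trans (ler_wpM2l C0 yx) _.
by rewrite mulrCA ler_piMr ?(ltW eps0)// ler_pdivrMr ?ltr_wpDl// mul1r lerDl.
Unshelve. all: by end_near. Qed.

Section Hadamard.
Variables (R : realType) (m : nat).
Implicit Types (F : 'rV[R]_m -> R) (a x y z : 'rV[R]_m).
Local Notation e i := (delta_mx 0 i : 'rV[R]_m).
Local Notation mu := (@lebesgue_measure R).

Lemma closed_ball_compact (a : 'rV[R]_m) r : compact [set x | `|x - a| <= r].
Proof.
apply: bounded_closed_compact.
  exists (r + `|a|); split; first exact: num_real.
  move=> C Cr y /= yr; apply: ltW; apply: le_lt_trans Cr.
  by rewrite -[y](subrK a); apply: le_trans (ler_normD _ _) _; rewrite lerD2r.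
rewrite (_ : mkset _ = (fun y => `|y - a|) @^-1` [set t | t <= r]) //.
apply: closed_comp; last exact: closed_le.
move=> y _; apply: continuous_comp; last exact: norm_continuous.
by apply: continuousB; [exact: cvg_id|exact: cst_continuous].
Qed.

Lemma closed_ball_closed (a : 'rV[R]_m) r : closed [set x | `|x - a| <= r].
Proof. by apply: compact_closed; [exact: norm_hausdorff|exact: closed_ball_compact]. Qed.

Lemma continuous_locally_bounded F x r : continuous F ->
  exists2 C, 0 <= C & forall y, `|y - x| <= r -> `|F y| <= C.
Proof.
move=> cF; have [r0|r0] := ltP r 0.
  by exists 0 => // y yr; have := le_lt_trans yr r0; rewrite normr_lt0.
pose A := [set y : 'rV[R]_m | `|y - x| <= r].
have cA : compact A by exact: closed_ball_compact.
have A0 : A !=set0 by exists x; rewrite /A /= subrr normr0.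
have [|c Ac Hc] := @EVT_max_rV R m (fun y => `|F y|) A A0 cA.
  by apply: continuous_subspaceT => y; apply: continuous_comp; [exact: cF|exact: norm_continuous].
exists `|F c| => // y yr; apply: Hc; rewrite inE; exact: yr.
Qed.

Lemma Rintegral01_cst (c : R) : \int[mu]_(t in `[0, 1]%classic) (cst c t) = c.
Proof.
rewrite Rintegral_cst//= lebesgue_measure_itv /= lte_fin ltr01 /=.
by rewrite oppr0 addr0 mulr1.
Qed.

Definition segment_pt a x (t : R) : 'rV[R]_m := a + t *: (x - a).

Lemma continuous_sumr (r : seq 'I_m) (f : 'I_m -> R -> R) :
  (forall i, continuous (f i)) -> continuous (fun t => \sum_(i <- r) f i t).
Proof.
move=> cf; elim: r => [|i r IHr] t.
  by under eq_fun do rewrite big_nil; exact: cvg_cst.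
under eq_fun do rewrite big_cons.
by apply: cvgD; [exact: cf|exact: IHr].
Qed.

(* The weight [t ^+ j] makes this family stable under partial derivatives. *)
Definition mean (j : nat) F a x : R :=
  \int[mu]_(t in `[0, 1]%classic) (t ^+ j * F (segment_pt a x t)).

Lemma segment_pt_near a x t : 0 <= t <= 1 -> `|segment_pt a x t - a| <= `|x - a|.
Proof.
move=> /andP[t0 t1]; rewrite /segment_pt addrC addKr normrZ ger0_norm//.
by rewrite ler_piMl.
Qed.

Lemma segment_pt_continuous a x : continuous (segment_pt a x).
Proof.
move=> t; apply: cvgD; first exact: cvg_cst.
exact: scalel_continuous.
Qed.

Lemma comp_segment_pt_continuous F a x : continuous F -> continuous (F \o segment_pt a x).
Proof.
by move=> cF t; apply: continuous_comp; [exact: segment_pt_continuous|exact: cF].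
Qed.

Lemma mean_integrand_continuous j F a x : continuous F ->
  continuous (fun t : R => t ^+ j * F (segment_pt a x t)).
Proof.
move=> cF t; apply: cvgM; first exact: exprn_continuous.
by apply: continuous_comp; [exact: segment_pt_continuous|exact: cF].
Qed.

Lemma mean_integrable j F a x : continuous F ->
  mu.-integrable `[0, 1]%classic (EFin \o (fun t : R => t ^+ j * F (segment_pt a x t))).
Proof.
move=> cF; apply: continuous_compact_integrable; first exact: segment_compact.
by apply: continuous_subspaceT; exact: mean_integrand_continuous.
Qed.

Lemma mean_le j F a x C : continuous F -> 0 <= C ->
  (forall y, `|y - a| <= `|x - a| -> `|F y| <= C) -> `|mean j F a x| <= C.
Proof.
move=> cF C0 H; have I := mean_integrable j a x cF.
apply: le_trans (le_normr_Rintegral _ I) _ => //.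
have -> : C = \int[mu]_(t in `[0, 1]%classic) (cst C t).
  by rewrite Rintegral01_cst.
apply: le_Rintegral => //.
- apply: (integrable_norm I).
- apply: continuous_compact_integrable; first exact: segment_compact.
  apply: continuous_subspaceT; exact: cst_continuous.
move=> t; rewrite /= in_itv /= => t01; rewrite normrM.
have /andP[t0 t1] := t01.
rewrite -[X in _ <= X]mul1r; apply: ler_pM => //; last by apply: H; exact: segment_pt_near.
by rewrite ger0_norm ?exprn_ge0// exprn_ile1.
Qed.

(** Differentiation under the integral sign; the inner derivative of [segment_pt] contributes the
    additional factor [t]. *)
Lemma is_derive_mean j F a x i : Ck 1 setT F ->
  is_derive x (e i) (mean j F a) (mean j.+1 ('D_(e i) F) a x).
Proof.
move=> cF.
have cont : continuous F by move=> y; exact: Ck_continuous cF I.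
have contd : continuous ('D_(e i) F) by move=> y; exact: Ck_continuous (CkS_derive i cF) I.
have segE (s t : R) : segment_pt a (s *: e i + x) t = (t * s) *: e i + segment_pt a x t.
  by rewrite /segment_pt -addrA scalerDr scalerA addrCA.
pose f (s t : R) := t ^+ j * F (segment_pt a (s *: e i + x) t).
pose df (s t : R) := t ^+ j.+1 * 'D_(e i) F (segment_pt a (s *: e i + x) t).
have H (s t : R) : is_derive s 1 (f ^~ t) (df s t).
  have d1 : is_derive s 1 ( *%R t) t.
    by apply: is_derive_eq (is_deriveZ t (is_derive_id s 1)) _; rewrite /GRing.scale /= mulr1.
  have d2 : is_derive (t * s) 1 (fun u : R => F (u *: e i + segment_pt a x t))
     ('D_(e i) F ((t * s) *: e i + segment_pt a x t)).
    by apply: is_derive_line; exact: CkS_derivable cF I.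
  have := is_deriveZ (t ^+ j) (is_derive1_comp d2 d1).
  rewrite (_ : (t ^+ j) \*: (_ \o _) = f ^~ t); last first.
    by apply/funext => u; rewrite /f segE.
  by move=> dd; apply: is_derive_eq dd _; rewrite /df segE exprSr /GRing.scale /= mulrAC mulrA.
have d1E s t : partial1of2 f s t = df s t.
  by rewrite partial1of2E; have [_ ->] := H s t.
(* The parameter [s] runs over $(-1,1)$ and displaces [x] by at most 1, so this ball contains all
   the segments met and [C] dominates the integrands. *)
have [C C0 HC] := @continuous_locally_bounded ('D_(e i) F) a (`|x - a| + 1) contd.
have cvg0 : h^-1 *: (mean j F a (h *: e i + x) - mean j F a x) @[h --> 0^'] -->
    mean j.+1 ('D_(e i) F) a x.
  have := @cvg_differentiation_under_integral R _ _ mu f `[0, 1]%classic _ 0 (-1) 1 _ _ _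
    (cst C) _ _ _.
  have -> : (\int[mu]_(y in `[0, 1]) partial1of2 f 0 y) = mean j.+1 ('D_(e i) F) a x.
    by apply: eq_Rintegral => t _; rewrite d1E /df scale0r add0r.
  have -> : (fun h : R => h^-1 *: (\int[mu]_(y in `[0, 1]) f (h + 0) y - \int[mu]_(y in `[0, 1]) f 0 y))
     = (fun h => h^-1 *: (mean j F a (h *: e i + x) - mean j F a x)).
    apply/funext => h; rewrite addr0; congr (_ *: (_ - _)).
    by apply: eq_Rintegral => t _; rewrite /f scale0r add0r.
  apply => //.
  - by rewrite /= in_itv /= ltrN10 ltr01.
  - by move=> s _; exact: mean_integrable.
  - apply: continuous_compact_integrable; first exact: segment_compact.
    apply: continuous_subspaceT; exact: cst_continuous.
  move=> s t; rewrite /= !in_itv /= => s1 t01; rewrite d1E /df normrM.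
  have /andP[t0 t1] := t01.
  rewrite -[X in _ <= X]mul1r; apply: ler_pM => //.
    by rewrite ger0_norm ?exprn_ge0// exprn_ile1.
  apply: HC; apply: le_trans (segment_pt_near _ _ t01) _.
  rewrite -addrA addrC; apply: le_trans (ler_normD _ _) _; rewrite lerD2l.
  apply: norm_coord_le => // k; rewrite !mxE normrM; apply: mulr_ile1 => //.
    by rewrite ler_norml; have /andP[/ltW -> /ltW ->] := s1.
  by case: (_ && _); rewrite ?normr1 ?normr0.
apply: DeriveDef; first by apply/cvg_ex; exists (mean j.+1 ('D_(e i) F) a x).
exact: cvg_lim cvg0.
Qed.

(** The partial derivatives are means again, hence bounded within distance 1 of [x], and
    [partials_lipschitz] applies. *)
Lemma mean_continuous j F a : Cinf setT F -> continuous (mean j F a).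
Proof.
move=> cF; suff cx (x : 'rV[R]_m) : {for x, continuous (mean j F a)} by [].
have cdF i : continuous ('D_(e i) F).
  by move=> y; exact: Ck_continuous (CkS_derive i (cF 1%N)) I.
have /choice[C HC] : forall i, exists C, 0 <= C /\
    forall y, `|y - a| <= `|x - a| + 1 -> `|'D_(e i) F y| <= C.
  move=> i; have [C C0 HC] := @continuous_locally_bounded _ a (`|x - a| + 1) (cdF i).
  by exists C.
have S0 : 0 <= \sum_i C i by apply: sumr_ge0 => i _; case: (HC i).
have K0 : 0 <= m%:R * \sum_i C i by rewrite mulr_ge0.
have H : forall y, `|y - x| < 1 -> forall i, derivable (mean j F a) y (e i) /\
    `|'D_(e i) (mean j F a) y| <= \sum_i C i.
  move=> y yx i; have [d1 ->] := is_derive_mean j a y i (cF 1%N); split => //.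
  apply: mean_le; [exact: cdF|exact: S0|move=> z zy]; apply: (le_trans (y := C i)); last first.
    by rewrite (bigD1 i) //= lerDl; apply: sumr_ge0 => k _; case: (HC k).
  have [_] := HC i; apply; apply: le_trans zy _.
  rewrite -[y](subrK x) -addrA addrC; apply: le_trans (ler_normD _ _) _.
  by rewrite lerD2l ltW.
have L := partials_lipschitz S0 H.
exact: locally_lipschitz_continuous K0 L.
Qed.

Lemma Cinf_mean j F a : Cinf setT F -> Cinf setT (mean j F a).
Proof.
move=> cF n; elim: n j F cF => [|n IHn] j F cF.
  by split => // x _; exact: mean_continuous.
split=> [x _|i]; first exact: mean_continuous.
have H x := is_derive_mean j a x i (cF 1%N).
split=> [x _|]; first by case: (H x).
have -> : 'D_(e i) (mean j F a) = mean j.+1 ('D_(e i) F) a.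
  by apply/funext => x; case: (H x).
by apply: IHn; exact: Cinf_derive.
Qed.

Lemma mean0_base F a : mean 0 F a a = F a.
Proof.
rewrite -[RHS]Rintegral01_cst; apply: eq_Rintegral => t _.
by rewrite expr0 mul1r /segment_pt subrr scaler0 addr0.
Qed.

(** The fundamental theorem of calculus along the segment from [a] to [x]. The coefficients are
    smooth by [Cinf_mean] and equal the partial derivatives at [a] by [mean0_base]. *)
Lemma hadamard F a x : Cinf setT F ->
  F x = F a + \sum_i (x 0 i - a 0 i) * mean 0 ('D_(e i) F) a x.
Proof.
move=> cF; have cF0 y : {for y, continuous F} by exact: Ck_continuous (cF 0%N) I.
have cD i : continuous ('D_(e i) F).
  by move=> y; exact: Ck_continuous (CkS_derive i (cF 1%N)) I.
pose phi t := F (segment_pt a x t).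
pose dphi t := \sum_i (x 0 i - a 0 i) * 'D_(e i) F (segment_pt a x t).
have dP (t : R) : is_derive t 1 phi (dphi t).
  apply: (is_derive_curve (gam := segment_pt a x) (dgam := fun i => x 0 i - a 0 i)).
    by apply: Ck_differentiable (cF 1%N) I; exact: openT.
  move=> i; rewrite (_ : (fun s => _) = (fun s : R => a 0 i + s * (x 0 i - a 0 i))); last first.
    by apply/funext => s; rewrite !mxE.
  have := is_deriveD (is_derive_cst (a 0 i) t 1) (is_deriveZ (x 0 i - a 0 i) (is_derive_id t 1)).
  rewrite (_ : _ + _ = (fun s : R => a 0 i + s * (x 0 i - a 0 i))); last first.
    by apply/funext => s; rewrite !fctE /= mulrC.
  by move=> H; apply: is_derive_eq H _; rewrite add0r /GRing.scale /= mulr1.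
have cphi : continuous phi.
  by move=> t; apply: continuous_comp; [exact: segment_pt_continuous|exact: cF0].
have cdphi : continuous dphi.
  apply: continuous_sumr => i t.
  apply: cvgM; first exact: cvg_cst.
  exact: (comp_segment_pt_continuous (cD i)).
have FTC : (\int[mu]_(t in `[0%R, 1%R]) (dphi t)%:E = (phi 1%R)%:E - (phi 0%R)%:E)%E.
  apply: continuous_FTC2 => //.
  - exact: continuous_subspaceT.
  - split.
    + by move=> t _; case: (dP t).
    + by apply: cvg_at_right_filter; exact: cphi.
    + by apply: cvg_at_left_filter; exact: cphi.
  - by move=> t _; rewrite derive1E; case: (dP t).
have -> : \sum_i (x 0 i - a 0 i) * mean 0 ('D_(e i) F) a x =
    \int[mu]_(t in `[0, 1]%classic) dphi t.
  rewrite /dphi.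
  have Int (r : seq 'I_m) : mu.-integrable `[0, 1]%classic (EFin \o (fun t =>
     \sum_(i <- r) (x 0 i - a 0 i) * 'D_(e i) F (segment_pt a x t))).
    apply: continuous_compact_integrable; first exact: segment_compact.
    apply: continuous_subspaceT; apply: continuous_sumr => i t.
    apply: cvgM; first exact: cvg_cst.
    exact: (comp_segment_pt_continuous (cD i)).
  elim: (index_enum _) => [|i r IHr].
    rewrite big_nil -[LHS]Rintegral01_cst; apply: eq_Rintegral => t _.
    by rewrite big_nil.
  rewrite big_cons IHr.
  rewrite [RHS](@eq_Rintegral _ _ _ mu _ (fun t => (x 0 i - a 0 i) * (t ^+ 0 * 'D_(e i) F (segment_pt a x t))
     + \sum_(i <- r) (x 0 i - a 0 i) * 'D_(e i) F (segment_pt a x t))); last first.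
    by move=> t _; rewrite big_cons expr0 mul1r.
  have I1 := mean_integrable 0 a x (cD i).
  rewrite RintegralD //; first by rewrite RintegralZl.
  by have := integrableZl _ (x 0 i - a 0 i) I1; apply.
rewrite /Rintegral FTC -EFinB /= /phi /segment_pt scale1r scale0r addr0.
by rewrite [a + (x - a)]addrC subrK addrC subrK.
Qed.
End Hadamard.

(** * Local frames *)

Section Charts.
Variables (R : realType) (m : nat) (M : manifold R m).
Implicit Types (c : chart R m M) (f : C^oo M) (X : vfield M) (p q : M).
Local Notation e i := (delta_mx 0 i : 'rV[R]_m).
Local Notation img c := (chart_map c @` chart_dom c).

Lemma chart_invK c q : chart_dom c q -> chart_inv c (chart_map c q) = q.
Proof. by move=> cq; apply: chart_mapK; rewrite inE. Qed.

Lemma chart_image_open c (V : set M) : open V -> V `<=` chart_dom c ->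
  open (chart_map c @` V).
Proof.
move=> oV Vc; rewrite openE => _ [q Vq <-].
have imgq : img c (chart_map c q) by exists q => //; exact: Vc.
have n1 := open_nbhs_nbhs (conj (@chart_map_open _ _ _ c) imgq).
have n2 : \forall y \near chart_map c q, V (chart_inv c y).
  apply: (chart_inv_continuous imgq).
  by rewrite chart_invK; [exact: open_nbhs_nbhs|exact: Vc].
apply: filterS2 n1 n2 => y [q' cq' <-]; by rewrite chart_invK// => Vq'; exists q'.
Qed.

Definition ext_chart c (w : 'rV[R]_m -> R) (q : M) : R :=
  if q \in chart_dom c then w (chart_map c q) else 0.

Lemma ext_chart_in c w q : chart_dom c q -> ext_chart c w q = w (chart_map c q).
Proof. by move=> cq; rewrite /ext_chart mem_set. Qed.

(** The image of [K] in [M] is compact, hence closed because [M] is Hausdorff. In another chart the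
    points split into two open sets: the overlap with [c], where the transition map is smooth, and
    the complement of that image, where the extension is zero. *)
Lemma ext_chart_smooth c w (K : set 'rV[R]_m) : atlas c -> compact K ->
  K `<=` img c -> (forall x, img c x -> w x != 0 -> K x) -> Cinf (img c) w ->
  is_smooth (ext_chart c w).
Proof.
move=> cA cK Kc wK wC c' cA' k.
have clK : closed (chart_inv c @` K).
  apply: compact_closed; first exact: manifold_hausdorff.
  apply: continuous_compact => //; apply: continuous_in_subspaceT => x.
  by rewrite inE => /Kc; exact: chart_inv_continuous.
pose U1 := chart_map c' @` (chart_dom c' `&` chart_dom c).
pose V2 := chart_dom c' `&` ~` (chart_inv c @` K).
pose U2 := chart_map c' @` V2.
have o1 : open U1.
  by apply: chart_image_open; [apply: openI; exact: chart_open|move=> ? []].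
have o2 : open U2.
  apply: chart_image_open; last by move=> ? [].
  by apply: openI; [exact: chart_open|exact: closed_openC].
apply: (@Ck_subset _ _ _ (U1 `|` U2)).
  move=> _ [q cq <-]; have [Kq|nKq] := pselect ((chart_inv c @` K) q).
    left; exists q => //; split => //; case: Kq => x /Kc[q' cq' <-] <-.
    by rewrite chart_invK.
  by right; exists q.
apply: Ck_setU.
  apply: (@eq_on_Ck _ _ _ _ (w \o (chart_map c \o chart_inv c'))) => //.
    by move=> _ [q [cq' cq] <-] /=; rewrite chart_invK// ext_chart_in.
  apply: (@Ck_comp _ _ _ _ _ (img c)) => //; first exact: chart_map_open.
    by move=> _ [q [cq' cq] <-] /=; rewrite chart_invK//; exists q.
  by move=> j; exact: (atlas_compatible cA' cA).
apply: (eq_on_Ck o2 _ (Ck_cst k U2 0)) => _ [q [cq' nK] <-] /=.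
rewrite chart_invK// /ext_chart; case: ifPn => //; rewrite inE => cq.
apply/esym/eqP; apply: contra_notT nK => wq; exists (chart_map c q); last exact: chart_invK.
by apply: wK wq; exists q.
Qed.

Lemma zero_ext_smooth (O K : set 'rV[R]_m) w : open O -> closed K -> K `<=` O ->
  (forall x, O x -> w x != 0 -> K x) -> Cinf O w ->
  Cinf setT (fun x => if x \in O then w x else 0).
Proof.
move=> oO clK KO wK wC k; apply: (@Ck_subset _ _ _ (O `|` ~` K)).
  by move=> x _; have [|] := pselect (K x); [move=> /KO; left|right].
apply: Ck_setU; first by apply: eq_on_Ck (wC k) => // x Ox; rewrite mem_set.
apply: eq_on_Ck (Ck_cst k (~` K) 0); first exact: closed_openC.
move=> x nK /=; case: ifPn => //; rewrite inE => Ox.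
by apply/esym/eqP; apply: contra_notT nK; exact: wK.
Qed.

Definition small_radius c p (r : R) :=
  0 < r /\ [set x | `|x - chart_map c p| <= r] `<=` img c.

Lemma small_radius_ex c p : chart_dom c p -> exists r, small_radius c p r.
Proof.
move=> cp; have : nbhs (chart_map c p) (img c).
  by apply: open_nbhs_nbhs; split; [exact: chart_map_open|exists p].
move=> /nbhs_ballP[r /= r0 H]; exists (r / 2); split; first by rewrite divr_gt0.
move=> x /= xr; apply: H; rewrite -ball_normE /= distrC.
by apply: le_lt_trans xr _; rewrite ltr_pdivrMr// ltr_pMr// ltr1n.
Qed.

Section At.
Variables (c : chart R m M) (p : M) (r : R).
Hypotheses (cA : atlas c) (rP : small_radius c p r).

Let beta := smooth_bump (chart_map c p) r.

Lemma ext_bump_smooth (w : 'rV[R]_m -> R) : Cinf (img c) w ->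
  ext_chart c (beta * w) \in smooth_pred (M := M).
Proof.
have [r0 rs] := rP; move=> cw; apply/smoothP.
apply: (@ext_chart_smooth _ _ [set x | `|x - chart_map c p| <= r]) => //.
- exact: closed_ball_compact.
- move=> x _; rewrite fctE mulf_eq0 negb_or => /andP[+ _].
  exact: bump_support.
- apply: CinfM => //; first exact: chart_map_open.
  by move=> k; apply: Ck_subset (@Cinf_bump _ _ (chart_map c p) r k) => ?.
Qed.

Definition ext_bump w (cw : Cinf (img c) w) : C^oo M := SmoothFun (ext_bump_smooth cw).

Lemma ext_bumpE w (cw : Cinf (img c) w) q : chart_dom c q ->
  ext_bump cw q = beta (chart_map c q) * w (chart_map c q).
Proof. exact: ext_chart_in. Qed.

Lemma ext_bump_out w (cw : Cinf (img c) w) q : ~ chart_dom c q -> ext_bump cw q = 0.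
Proof. by move=> cq; rewrite /ext_bump /= /ext_chart memNset. Qed.

Lemma Cinf_local f : Cinf (img c) (f \o chart_inv c).
Proof. by have /smoothP := smooth_valP f; apply. Qed.

Lemma local_derivable f x i : img c x -> derivable (f \o chart_inv c) x (e i).
Proof. exact: CkS_derivable (Cinf_local f 1%N). Qed.

Lemma Cinf_local_derive f i : Cinf (img c) ('D_(e i) (f \o chart_inv c)).
Proof. exact: Cinf_derive (Cinf_local f). Qed.

Lemma coord_field_subproof i :
  (fun f => ext_bump (Cinf_local_derive f i)) \in derivation_pred (M := M).
Proof.
apply/derivationP; split=> [a f g|f g]; apply: smooth_funP => q.
- change (ext_bump (Cinf_local_derive (a *: f + g) i) q =
    a * ext_bump (Cinf_local_derive f i) q + ext_bump (Cinf_local_derive g i) q).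
  have [cq|cq] := pselect (chart_dom c q); last by rewrite !ext_bump_out// mulr0 addr0.
  have iq : img c (chart_map c q) by exists q.
  rewrite !ext_bumpE// (_ : _ \o _ = a *: ((f : M -> R) \o chart_inv c) + ((g : M -> R) \o chart_inv c)) //.
  have df := @local_derivable f _ i iq; have dg := @local_derivable g _ i iq.
  rewrite (deriveD (derivableZ df) dg) (deriveZ a df).
  by rewrite /GRing.scale /= mulrDr mulrCA.
- change (ext_bump (Cinf_local_derive (f * g) i) q =
    f q * ext_bump (Cinf_local_derive g i) q + g q * ext_bump (Cinf_local_derive f i) q).
  have [cq|cq] := pselect (chart_dom c q); last by rewrite !ext_bump_out// !mulr0 addr0.
  have iq : img c (chart_map c q) by exists q.
  rewrite !ext_bumpE// (_ : _ \o _ = ((f : M -> R) \o chart_inv c) * ((g : M -> R) \o chart_inv c)) //.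
  have df := @local_derivable f _ i iq; have dg := @local_derivable g _ i iq.
  by rewrite (deriveM df dg) /= chart_invK// /GRing.scale /=; ring.
Qed.

(** The coordinate field $\partial_i$ times the bump: the bump makes it act on all of [C^oo M], and
    at [p] it is $\partial_i$ itself. *)
Definition coord_field i : vfield M := VField (coord_field_subproof i).

Lemma Cinf_one : Cinf (img c) (cst 1).
Proof. exact: Cinf_cst. Qed.

Lemma Cinf_x i : Cinf (img c) (fun x => x 0 i).
Proof. apply: Cinf_coord; exact: chart_map_open. Qed.

(** [cut] and [cut_coord] replace the constant 1 and the coordinates, which a derivation of [C^oo M]
    cannot be applied to inside a chart. *)
Definition cut : C^oo M := ext_bump Cinf_one.
Definition cut_coord i : C^oo M := ext_bump (Cinf_x i).
End At.
End Charts.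

Section LocalFormula.
Variables (R : realType) (m : nat) (M : manifold R m).
Implicit Types (c : chart R m M) (f : C^oo M) (X : vfield M) (p q : M).
Local Notation e i := (delta_mx 0 i : 'rV[R]_m).
Local Notation img c := (chart_map c @` chart_dom c).

Lemma vfieldM X f g : X (f * g) = f * X g + g * X f.
Proof. by have /derivationP[_ ->] := vfield_valP X. Qed.

Lemma vfieldD X f g : X (f + g) = X f + X g.
Proof. by have /derivationP[+ _] := vfield_valP X => /(_ 1 f g); rewrite !scale1r. Qed.

Lemma vfieldZ X (a : R) f : X (a *: f) = a *: X f.
Proof.
have /derivationP[H _] := vfield_valP X.
have X0 : X 0 = 0 by have /eqP := H 1 0 0; rewrite !scale1r addr0 -subr_eq subrr eq_sym => /eqP.
by have := H a f 0; rewrite X0 !addr0.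
Qed.

Lemma vfield1 X : X 1 = 0.
Proof.
have := vfieldM X 1 1; rewrite !mul1r => /eqP.
by rewrite -subr_eq subrr eq_sym => /eqP.
Qed.

Lemma vfield_sum X (I : Type) (s : seq I) (F : I -> C^oo M) :
  X (\sum_(i <- s) F i) = \sum_(i <- s) X (F i).
Proof.
elim: s => [|i s IHs]; last by rewrite !big_cons vfieldD IHs.
by rewrite !big_nil; have := vfieldZ X 0 0; rewrite !scale0r.
Qed.

Lemma smooth_sumE (I : Type) (s : seq I) (F : I -> C^oo M) p :
  (\sum_(i <- s) F i) p = \sum_(i <- s) F i p.
Proof.
elim: s => [|i s IHs]; first by rewrite !big_nil.
by rewrite !big_cons -IHs.
Qed.

Lemma sum_vfieldE (I : Type) (s : seq I) (F : I -> vfield M) f p :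
  (\sum_(i <- s) F i) f p = \sum_(i <- s) F i f p.
Proof.
elim: s => [|i s IHs]; first by rewrite !big_nil.
by rewrite !big_cons -IHs.
Qed.

Section Formula.
Variables (c : chart R m M) (p : M) (r : R).
Hypotheses (cA : atlas c) (rP : small_radius c p r).
Local Notation B := (cut cA rP).
Local Notation Y := (cut_coord cA rP).

Lemma cut_support q : B q != 0 -> chart_dom c q.
Proof. by move=> /eqP; apply: contra_notP => cq; rewrite ext_bump_out. Qed.

Lemma cut_center : chart_dom c p -> B p = 1.
Proof. by move=> cp; rewrite ext_bumpE// bump_center ?mulr1//; case: rP. Qed.

Lemma cut_coordE i q : Y i q = B q * chart_map c q 0 i.
Proof.
have [cq|cq] := pselect (chart_dom c q); first by rewrite !ext_bumpE// mulr1.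
by rewrite !ext_bump_out// mul0r.
Qed.

(* Hadamard's lemma at [q] writes [f], up to cut-offs, as [f q] plus products
   of functions vanishing at [q] with smooth functions. *)
Lemma cut_formula X f q : B q != 0 ->
  B q * X f q = \sum_i (X (Y i) q - chart_map c q 0 i * X B q) *
                  'D_(e i) (f \o chart_inv c) (chart_map c q).
Proof.
move=> Bq; have cq := cut_support Bq.
(* A second bump, now centred at [q], which need not be [p]: Hadamard's lemma at [q] asks for a
   function on all of $\mathbb R^m$. *)
have [s sP] := small_radius_ex cq; have [s0 sI] := sP.
set a := chart_map c q; pose theta := smooth_bump a s.
pose Th := cut cA sP.
pose Z i : C^oo M := Y i - (a 0 i) *: B.
have ThE q' : chart_dom c q' -> Th q' = theta (chart_map c q').
  by move=> cq'; rewrite ext_bumpE// mulr1.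
have theta1 : theta a = 1 by exact: bump_center.
(* The auxiliary bump leaves the unknown [X Th q]. The identity is used for [f] and for the constant
   1; subtracting [f q] times the second from the first eliminates it. *)
suff key (g : C^oo M) : exists2 dG : 'I_m -> R,
    (forall i, dG i = 'D_(e i) (g \o chart_inv c) a + g q * 'D_(e i) theta a) &
    B q * X g q + B q * g q * X Th q = \sum_i X (Z i) q * dG i.
  have [dF dFE HF] := key f; have [dE dEE HE] := key 1.
  have ZE i : X (Z i) q = X (Y i) q - a 0 i * X B q.
    by rewrite /Z -scaleN1r vfieldD vfieldZ vfieldZ scaleN1r.
  have d1 i : 'D_(e i) ((1 : C^oo M) \o chart_inv c) a = 0.
    by rewrite (_ : _ \o _ = cst 1)// derive_cst.
  have {}HE : B q * X Th q = \sum_i X (Z i) q * 'D_(e i) theta a.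
    move: HE; rewrite vfield1 (_ : (0 : C^oo M) q = 0)// mulr0 add0r.
    rewrite (_ : (1 : C^oo M) q = 1)// mulr1 => ->.
    by apply: eq_bigr => i _; rewrite dEE d1 add0r (_ : (1 : C^oo M) q = 1)// mul1r.
  have -> : B q * X f q = (B q * X f q + B q * f q * X Th q) - f q * (B q * X Th q) by ring.
  rewrite HF HE mulr_sumr -sumrB; apply: eq_bigr => i _.
  by rewrite dFE ZE; ring.
pose G x := if x \in img c then (theta * (g \o chart_inv c)) x else 0.
have oI := @chart_map_open _ _ _ c.
have ctheta : Cinf (img c) theta.
  by move=> k; apply: Ck_subset (@Cinf_bump _ _ a s k) => ?.
have cG : Cinf setT G.
  apply: (@zero_ext_smooth _ _ (img c) [set x | `|x - a| <= s]) => //.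
  - exact: closed_ball_closed.
  - by move=> x _; rewrite fctE mulf_eq0 negb_or => /andP[+ _]; exact: bump_support.
  - by apply: CinfM => //; exact: Cinf_local.
have Ia : img c a by exists q.
have GE q' : chart_dom c q' -> G (chart_map c q') = theta (chart_map c q') * g q'.
  by move=> cq'; rewrite /G mem_set; [rewrite fctE /= chart_invK|exists q'].
have Ga : G a = g q by rewrite GE// -/a theta1 mul1r.
have dG i : 'D_(e i) G a = 'D_(e i) (g \o chart_inv c) a + g q * 'D_(e i) theta a.
  have E : {near a, theta * (g \o chart_inv c) =1 G}.
    by apply: open_near_eq oI Ia _ => x Ix; rewrite /G mem_set.
  rewrite -(near_eq_derive _ E).
  rewrite deriveM /=.
  - by rewrite theta1 chart_invK// scale1r.
  - exact: CkS_derivable (ctheta 1%N) Ia.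
  - exact: CkS_derivable (Cinf_local cA g 1%N) Ia.
exists (fun i => 'D_(e i) G a) => //.
have cH i : Cinf setT (mean 0 ('D_(e i) G) a) by apply/Cinf_mean/Cinf_derive.
have cH' i : Cinf (img c) (mean 0 ('D_(e i) G) a).
  by move=> k; apply: Ck_subset (cH i k) => ?.
pose H i := ext_bump cA sP (cH' i).
(* Hadamard's formula for [G], multiplied by [Th * B] so that it holds on all of [M]. Every [Z i]
   vanishes at [q], so applying [X] leaves only the values of the [H i] there, the partials of
   [G]. *)
have glob : Th * (B * (Th * g)) = g q *: (Th * B) + \sum_i Z i * H i.
  apply: smooth_funP => q'.
  change (Th q' * (B q' * (Th q' * g q')) = g q * (Th q' * B q') + (\sum_i Z i * H i) q').
  rewrite smooth_sumE.
  have [cq'|cq'] := pselect (chart_dom c q'); last first.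
    rewrite [Th q']ext_bump_out// !mul0r mulr0 add0r big1// => i _.
    by change (Z i q' * H i q' = 0); rewrite [H i q']ext_bump_out// mulr0.
  have := hadamard a (chart_map c q') cG.
  rewrite ThE// GE// Ga => ->.
  rewrite mulrDr mulrDr; congr (_ + _); first ring.
  rewrite !mulr_sumr; apply: eq_bigr => i _.
  change (theta (chart_map c q') * (B q' *
    ((chart_map c q' 0 i - a 0 i) * mean 0 ('D_(e i) G) a (chart_map c q'))) =
    (Y i q' - a 0 i * B q') * H i q').
  by rewrite [H i q']ext_bumpE// cut_coordE /theta; ring.
have := congr1 (fun h : C^oo M => X h q) glob.
rewrite /= !vfieldM vfieldD vfieldZ !vfieldM vfield_sum.
have Thq : Th q = 1 by rewrite ThE.
have Zq i : Z i q = 0.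
  by change (Y i q - a 0 i * B q = 0); rewrite cut_coordE; ring.
have Hq i : H i q = 'D_(e i) G a by rewrite ext_bumpE// -/a bump_center// mul1r mean0_base.
have -> : \sum_i X (Z i) q * 'D_(e i) G a = (\sum_i X (Z i * H i)) q.
  rewrite smooth_sumE; apply: eq_bigr => i _; rewrite vfieldM.
  change (X (Z i) q * 'D_(e i) G a = Z i q * X (H i) q + H i q * X (Z i) q).
  by rewrite Zq Hq; ring.
set S := (\sum_i _).
change (Th q * (B q * (Th q * X g q + g q * X Th q) + (Th q * g q) * X B q)
    + (B q * (Th q * g q)) * X Th q = g q * (Th q * X B q + B q * X Th q) + S q ->
  B q * X g q + B q * g q * X Th q = S q).
rewrite Thq; move: (B q) (X g q) (g q) (X Th q) (X B q) (S q) => b x y z w v E.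
by apply: (addrI (y * (1 * w + b * z))); rewrite -E; ring.
Qed.

(** The numerator of the quotient rule for $x_i = Y_i/B$, that is $B^2X(x_i)$ where $B \ne 0$; in
    this form it is global and linear in [X]. *)
Definition frame_coef i (X : vfield M) : (C^oo M)^o := B * X (Y i) - Y i * X B.

Lemma frame_coef_linear i : linear (frame_coef i).
Proof.
move=> f X Z; rewrite /frame_coef.
change (B * (f * X (Y i) + Z (Y i)) - Y i * (f * X B + Z B) =
  f * (B * X (Y i) - Y i * X B) + (B * Z (Y i) - Y i * Z B)).
by ring.
Qed.

Lemma frame_coef0 i X q : (forall f, X f q = 0) -> frame_coef i X q = 0.
Proof.
move=> X0; change (B q * X (Y i) q - Y i q * X B q = 0).
by rewrite !X0 !mulr0 subrr.
Qed.

Lemma coord_field_center j f : chart_dom c p ->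
  coord_field cA rP j f p = 'D_(e j) (f \o chart_inv c) (chart_map c p).
Proof.
move=> cp.
change (ext_bump cA rP (Cinf_local_derive cA f j) p =
  'D_(e j) (f \o chart_inv c) (chart_map c p)).
by rewrite ext_bumpE// bump_center ?mul1r//; case: rP.
Qed.

Lemma frame_coef_coord_field i j : chart_dom c p ->
  frame_coef i (coord_field cA rP j) p = (i == j)%:R.
Proof.
move=> cp; change (B p * coord_field cA rP j (Y i) p - Y i p * coord_field cA rP j B p = (i == j)%:R).
have Ip : img c (chart_map c p) by exists p.
have oI := @chart_map_open _ _ _ c.
set a := chart_map c p.
have dB : derivable (B \o chart_inv c) a (e j) by exact: (@local_derivable _ _ _ _ cA B _ j Ip).
have [dx1 dx2] := derive_coord a j i.
rewrite !coord_field_center// cut_coordE cut_center// !mul1r.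
have -> : 'D_(e j) (Y i \o chart_inv c) a = 'D_(e j) ((B \o chart_inv c) * (fun x : 'rV[R]_m => x 0 i)) a.
  apply: near_eq_derive; apply: open_near_eq oI Ip _ => _ [q cq <-].
  change (Y i (chart_inv c (chart_map c q)) = B (chart_inv c (chart_map c q)) * chart_map c q 0 i).
  by rewrite cut_coordE chart_invK.
have B1 : (B \o chart_inv c) a = 1.
  by change (B (chart_inv c a) = 1); rewrite chart_invK// cut_center.
by rewrite (deriveM dB dx1) dx2 B1 scale1r addrK eq_sym.
Qed.

(** The cube collects $B^2$ from [frame_coef] and $B$ from [coord_field]. *)
Lemma frame_decomposition X :
  B ^+ 3 *: X = \sum_i frame_coef i X *: coord_field cA rP i.
Proof.
apply: val_inj; apply/funext => f; apply: smooth_funP => q.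
change (B q ^+ 3 * X f q = (\sum_i frame_coef i X *: coord_field cA rP i : vfield M) f q).
rewrite sum_vfieldE.
change (B q ^+ 3 * X f q = \sum_i frame_coef i X q * coord_field cA rP i f q).
have FE i : coord_field cA rP i f q = B q * 'D_(e i) (f \o chart_inv c) (chart_map c q).
  change (ext_bump cA rP (Cinf_local_derive cA f i) q =
    B q * 'D_(e i) (f \o chart_inv c) (chart_map c q)).
  have [cq|cq] := pselect (chart_dom c q); last by rewrite !ext_bump_out// mul0r.
  by rewrite !ext_bumpE// mulr1.
have [B0|Bn0] := eqVneq (B q) 0.
  rewrite B0 expr0n mul0r big1// => i _; by rewrite FE B0 mul0r mulr0.
rewrite exprSr -mulrA cut_formula// mulr_sumr; apply: eq_bigr => i _.
rewrite FE; change (B q ^+ 2 * ((X (Y i) q - chart_map c q 0 i * X B q) * 'D_(e i) (f \o chart_inv c) (chart_map c q)) =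
  (B q * X (Y i) q - Y i q * X B q) * (B q * 'D_(e i) (f \o chart_inv c) (chart_map c q))).
by rewrite cut_coordE; ring.
Qed.
End Formula.
(** The decomposition holds only up to the factor [chi], which is enough at [p]: a [C^oo M]-linear
    map applied to both sides loses [chi] there. The last clause says that the coefficients at [p]
    see only the tangent vector of [X] at [p]. *)
Lemma local_frame p : exists chi : C^oo M, exists F : 'I_m -> vfield M,
  exists a : 'I_m -> {linear vfield M -> (C^oo M)^o},
  [/\ chi p = 1, forall X, chi *: X = \sum_i a i X *: F i,
      forall i j, a i (F j) p = (i == j)%:R
    & forall i X, (forall f, X f p = 0) -> a i X p = 0].
Proof.
have [c cA cp] := atlas_cover p; have [r rP] := small_radius_ex cp.
pose L i := GRing.isLinear.Build _ _ _ _ (frame_coef cA rP i) (frame_coef_linear cA rP i).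
pose a i : {linear vfield M -> (C^oo M)^o} := HB.pack (frame_coef cA rP i) (L i).
exists (cut cA rP ^+ 3), (coord_field cA rP), a; split.
- by change (cut cA rP p * (cut cA rP p * cut cA rP p) = 1); rewrite cut_center// !mul1r.
- exact: frame_decomposition.
- by move=> i j; exact: frame_coef_coord_field.
- by move=> i X X0; exact: frame_coef0.
Qed.

(** A partial derivative at any [q] of the chart is the value at [q] of a coordinate field cut off
    around [q], hence zero; then [partials_lipschitz] is applied with constant 0. *)
Lemma killed_locally_constant (h : C^oo M) p : (forall X, X h = 0) ->
  \forall q \near p, h q = h p.
Proof.
move=> X0; have [c cA cp] := atlas_cover p.
have partial0 q j : chart_dom c q -> 'D_(e j) (h \o chart_inv c) (chart_map c q) = 0.
  move=> cq; have [r rP] := small_radius_ex cq.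
  by rewrite -(coord_field_center cA rP j h cq) X0.
have [r [r0 rI]] := small_radius_ex cp.
have H y : `|y - chart_map c p| < r -> forall j, derivable (h \o chart_inv c) y (e j) /\
    `|'D_(e j) (h \o chart_inv c) y| <= 0.
  move=> yr j; have Iy : img c y by apply: rI; exact: ltW.
  split; first exact: (@local_derivable _ _ _ _ cA h _ j Iy).
  by case: Iy => q cq <-; rewrite partial0// normr0.
have {H}H := partials_lipschitz (lexx 0) H.
have n1 : \forall q \near p, chart_dom c q.
  by apply: open_nbhs_nbhs; split => //; exact: chart_open.
have n2 : \forall q \near p, `|chart_map c p - chart_map c q| < r.
  by apply: cvgr_dist_lt => //; exact: chart_map_continuous.
apply: filterS2 n1 n2 => q cq; rewrite distrC => /H.
by rewrite mulr0 mul0r normr_le0 subr_eq0 /= !chart_invK// => /eqP.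
Qed.

Lemma killed_constant (h : C^oo M) : connected [set: M] ->
  (forall X, X h = 0) -> exists a : R, forall p, h p = a.
Proof.
move=> conn X0; have [p0 _] := manifold_nonempty M.
have loc p := killed_locally_constant p X0.
exists (h p0); suff E : [set p | h p = h p0] = setT.
  by move=> p; have : setT p by []; rewrite -E.
apply: conn; first by exists p0.
- exists [set p | h p = h p0]; last by rewrite setTI.
  by rewrite openE => p /= hp; apply: filterS (loc p) => q /= ->.
- exists [set p | h p = h p0]; last by rewrite setTI.
  rewrite -[mkset _]setCK; apply: open_closedC.
  by rewrite openE => p /= hp; apply: filterS (loc p) => q /= ->.
Qed.
End LocalFormula.

(** * Orthonormal frames *)

(** Row by row: as long as there are fewer than [m] rows, some nonzero vector is [G]-orthogonal to
    all of them, and it can be normalized. *)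
Lemma orthonormalization (R : realType) m (G : 'M[R]_m) :
  G^T = G -> (forall v : 'rV_m, v != 0 -> 0 < (v *m G *m v^T) 0 0) ->
  exists C : 'M[R]_m, C *m G *m C^T = 1%:M.
Proof.
move=> Gs Gp; suff H k : (k <= m)%N -> exists C : 'M[R]_(k, m), C *m G *m C^T = 1%:M.
  exact: H.
elim: k => [_|k IHk km]; first by exists 0; rewrite [LHS]flatmx0 [RHS]flatmx0.
have [C CC] := IHk (ltnW km).
have : kermx (G *m C^T) != 0.
  rewrite kermx_eq0 /row_free neq_ltn; apply/orP; left.
  by apply: leq_ltn_trans (rank_leq_col _) _.
case/rowV0Pn => v /sub_kermxP; rewrite mulmxA => vG0 v0.
set s := (v *m G *m v^T) 0 0; have s0 : 0 < s by exact: Gp.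
pose w := (Num.sqrt s)^-1 *: v.
have ww : w *m G *m w^T = 1%:M.
  apply/rowP => i; rewrite !ord1 /w linearZ /= -!scalemxAl -scalemxAr scalerA.
  rewrite [LHS]mxE [RHS]mxE -/s -expr2 exprVn sqr_sqrtr ?ltW//.
  by rewrite mulVf// gt_eqF.
have wC : w *m G *m C^T = 0 by rewrite /w -!scalemxAl vG0 scaler0.
have Cw : C *m G *m w^T = 0.
  by apply: trmx_inj; rewrite trmx0 !trmx_mul trmxK Gs mulmxA wC.
rewrite -addn1; exists (col_mx C w).
by rewrite tr_col_mx mul_col_mx mul_col_row CC Cw wC ww -scalar_mx_block.
Qed.

Section PointwiseFrames.
Variables (R : realType) (m : nat) (M : manifold R m) (g : metric M).
Local Notation vf := (vfield M).
Implicit Types (X Y Z U W : vf) (p : M) (f : C^oo M).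

Lemma gC X Y : g X Y = g Y X.
Proof. exact: Defs.metric_sym. Qed.

Lemma gZl f X Y : g (f *: X) Y = f * g X Y.
Proof.
have g0 : g 0 Y = 0.
  by have /eqP := metric_linear g 1 0 0 Y; rewrite scale1r addr0 mul1r -subr_eq subrr eq_sym => /eqP.
by have := metric_linear g f X 0 Y; rewrite addr0 g0 addr0.
Qed.

Lemma gDl X Y Z : g (X + Y) Z = g X Z + g Y Z.
Proof. by have := metric_linear g 1 X Y Z; rewrite scale1r mul1r. Qed.

Lemma gNl X Y : g (- X) Y = - g X Y.
Proof. by rewrite -scaleN1r gZl mulN1r. Qed.

Lemma g0l Y : g 0 Y = 0.
Proof. by rewrite -(scale0r 0) gZl mul0r. Qed.

Lemma gZr f X Y : g X (f *: Y) = f * g X Y.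
Proof. by rewrite gC gZl gC. Qed.

Lemma gDr X Y Z : g X (Y + Z) = g X Y + g X Z.
Proof. by rewrite gC gDl !(gC X). Qed.

Lemma gNr X Y : g X (- Y) = - g X Y.
Proof. by rewrite gC gNl gC. Qed.

Lemma g0r X : g X 0 = 0.
Proof. by rewrite gC g0l. Qed.

Lemma g_nondeg X : (forall Y, g X Y = 0) -> X = 0.
Proof.
move=> H; apply: val_inj; apply/funext => f; apply: smooth_funP => p.
by apply: (@metric_eq0 _ _ _ g); rewrite H.
Qed.

(** The usual route to an equality of vector fields below: pairing and evaluation at a point reduce
    it to real numbers. *)
Lemma g_inj X Y : (forall Z, g X Z = g Y Z) -> X = Y.
Proof.
by move=> H; apply/eqP; rewrite -subr_eq0; apply/eqP/g_nondeg => Z; rewrite gDl gNl H subrr.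
Qed.

Definition tensorial (L : vf -> C^oo M) := forall f X Y, L (f *: X + Y) = f * L X + L Y.

Lemma tensorial_g Y : tensorial (g ^~ Y).
Proof. by move=> f X Z; rewrite metric_linear. Qed.

Section Tensorial.
Variable L : vf -> C^oo M.
Hypothesis LT : tensorial L.

Lemma tensorialD X Y : L (X + Y) = L X + L Y.
Proof. by have := LT 1 X Y; rewrite scale1r mul1r. Qed.

Lemma tensorial0 : L 0 = 0.
Proof. by have /eqP := tensorialD 0 0; rewrite addr0 -subr_eq subrr eq_sym => /eqP. Qed.

Lemma tensorialZ f X : L (f *: X) = f * L X.
Proof. by have := LT f X 0; rewrite addr0 tensorial0 addr0. Qed.

Lemma tensorial_sum (I : Type) (s : seq I) (f : I -> C^oo M) (F : I -> vf) p :
  L (\sum_(i <- s) f i *: F i) p = \sum_(i <- s) f i p * L (F i) p.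
Proof.
rewrite -[RHS](smooth_sumE s (fun i => f i * L (F i))); congr (smooth_val _ p).
elim: s => [|i s IHs]; first by rewrite !big_nil tensorial0.
by rewrite !big_cons LT IHs.
Qed.
End Tensorial.

Lemma local_frame_matrix p : exists F : 'I_m -> vf,
  exists c : vf -> 'rV[R]_m,
  [/\ forall L, tensorial L -> forall X, L X p = \sum_i c X 0 i * L (F i) p,
      forall i j, c (F i) 0 j = (i == j)%:R,
      forall j, exists2 L, tensorial L & forall X, L X p = c X 0 j
    & forall X, g X X p = 0 -> c X = 0].
Proof.
have [chi [F [a [chi1 dec aF a0]]]] := local_frame p.
exists F, (fun X => \row_i a i X p); split.
- move=> L LT X; have := congr1 (fun Z => L Z p) (dec X); rewrite /= tensorial_sum // tensorialZ//.
  change (chi p * L X p = \sum_i a i X p * L (F i) p -> L X p = \sum_i (\row_i a i X p) 0 i * L (F i) p).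
  by rewrite chi1 mul1r => ->; apply: eq_bigr => i _; rewrite mxE.
- by move=> i j; rewrite mxE aF eq_sym.
- move=> j; exists (a j); last by move=> X; rewrite mxE.
  by move=> f X Y; rewrite linearP.
- move=> X X0; apply/rowP => i; rewrite !mxE; apply: a0.
  exact: metric_eq0 X0.
Qed.

Lemma orthonormal_ex p : exists E, orthonormal_at g p E.
Proof.
have [F [c [cL cF cT c0]]] := local_frame_matrix p.
pose G := \matrix_(i, j) g (F i) (F j) p.
pose comb (v : 'rV[R]_m) : vf := \sum_j (v 0 j *: (1 : C^oo M)) *: F j.
have combL L v : tensorial L -> L (comb v) p = \sum_j v 0 j * L (F j) p.
  move=> LT; rewrite tensorial_sum//; apply: eq_bigr => j _.
  by change (v 0 j * 1 * L (F j) p = v 0 j * L (F j) p); rewrite mulr1.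
have combG v w : g (comb v) (comb w) p = (v *m G *m w^T) 0 0.
  rewrite (combL (g ^~ (comb w)))//; last exact: tensorial_g.
  rewrite -mulmxA mxE; apply: eq_bigr => i _; congr (_ * _).
  rewrite gC (combL (g ^~ (F i)))//; last exact: tensorial_g.
  rewrite mxE; apply: eq_bigr => j _; by rewrite !mxE mulrC gC.
have [||C CC] := @orthonormalization R m G.
- by apply/matrixP => i j; rewrite !mxE gC.
- move=> v v0; rewrite -combG lt_neqAle metric_ge0 andbT.
  apply: contra v0; rewrite eq_sym => /eqP /c0 cv; apply/eqP/rowP => j.
  have [L LT Lc] := cT j; have := Lc (comb v); rewrite cv combL// => H.
  rewrite -[RHS]H (bigD1 j) //= big1 ?addr0 => [|i ij]; rewrite Lc cF.
    by rewrite eqxx mulr1.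
  by rewrite (negbTE ij) mulr0.
exists (fun i => comb (row i C)) => i j; rewrite combG.
transitivity ((C *m G *m C^T) i j); last by rewrite CC mxE.
by rewrite -row_mul !mxE; apply: eq_bigr => k _; rewrite !mxE.
Qed.

Lemma frame_at_orthonormal p : orthonormal_at g p (frame_at g p).
Proof. exact: xgetPex (orthonormal_ex p). Qed.

(** Orthonormality says [C *m (G *m C^T) = 1%:M]. As the matrices are square the factors commute,
    and [(G *m C^T) *m C = 1%:M] is the expansion in the frame. *)
Lemma parseval p E : orthonormal_at g p E -> forall L, tensorial L ->
  forall X, L X p = \sum_i g X (E i) p * L (E i) p.
Proof.
have [F [c [cL cF cT c0]]] := local_frame_matrix p => EE L LT X.
pose G := \matrix_(i, j) g (F i) (F j) p.
pose C := \matrix_(i, j) c (E i) 0 j.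
have gE Y Z : g Y Z p = (c Y *m G *m (c Z)^T) 0 0.
  rewrite (cL (g ^~ Z)); last exact: tensorial_g.
  rewrite -mulmxA mxE; apply: eq_bigr => i _; congr (_ * _).
  rewrite gC (cL (g ^~ (F i))); last exact: tensorial_g.
  by rewrite mxE; apply: eq_bigr => j _; rewrite !mxE mulrC gC.
have rC i : row i C = c (E i) by apply/rowP => j; rewrite !mxE.
have CC : C *m (G *m C^T) = 1%:M.
  apply/matrixP => i j; rewrite mulmxA [RHS]mxE -EE gE -!rC.
  by rewrite -row_mul !mxE; apply: eq_bigr => k _; rewrite !mxE.
have CC' := mulmx1C CC.
pose l := \col_j L (F j) p.
have lE Y : L Y p = (c Y *m l) 0 0.
  by rewrite (cL L LT) mxE; apply: eq_bigr => j _; rewrite mxE.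
have -> : L X p = (c X *m (G *m C^T) *m (C *m l)) 0 0.
  rewrite lE; congr (fun_of_matrix _ 0 0).
  by rewrite -[RHS]mulmxA [(G *m C^T) *m (C *m l)]mulmxA CC' mul1mx.
rewrite mxE; apply: eq_bigr => i _; congr (_ * _).
  rewrite gE -rC mulmxA [LHS]mxE [RHS]mxE; apply: eq_bigr => k _.
  by congr (_ * _); rewrite !mxE.
by rewrite lE -rC !mxE; apply: eq_bigr => k _; rewrite !mxE.
Qed.
End PointwiseFrames.

(** * Quasi-Sasakian structures *)

Section SmoothEval.
Variables (R : realType) (m : nat) (M : manifold R m).
Implicit Types (f h : C^oo M) (p : M) (X : vfield M).

Lemma smoothD f h p : (f + h) p = f p + h p. Proof. by []. Qed.
Lemma smoothN f p : (- f) p = - f p. Proof. by []. Qed.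
Lemma smoothM f h p : (f * h) p = f p * h p. Proof. by []. Qed.
Lemma smoothZ (a : R) f p : (a *: f) p = a * f p. Proof. by []. Qed.
Lemma smooth0 p : (0 : C^oo M) p = 0. Proof. by []. Qed.
Lemma smooth1 p : (1 : C^oo M) p = 1. Proof. by []. Qed.

Lemma vfield0 X : X 0 = 0.
Proof. by have := vfieldZ X 0 0; rewrite !scale0r. Qed.

Lemma vfieldN X f : X (- f) = - X f.
Proof. by rewrite -scaleN1r vfieldZ scaleN1r. Qed.

Lemma ev_at f h p : f = h -> f p = h p.
Proof. by move->. Qed.
End SmoothEval.

Definition smoothE := (smoothD, smoothN, smoothM, smoothZ, smooth0, smooth1).
Definition gE := (gDl, gDr, gNl, gNr, gZl, gZr, g0l, g0r).

Definition phv (R : realType) (m : nat) (M : manifold R m) (g : metric M)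
  (S : almost_contact g) (X : vfield M) : vfield M := phi S X.

Section AlmostContactAlgebra.
Variables (R : realType) (m : nat) (M : manifold R m) (g : metric M).
Variable S : almost_contact g.
Local Notation vf := (vfield M).
Implicit Types (X Y Z W : vf) (f : C^oo M).
Local Notation ph := (phv S).
Local Notation xi := (xi S).
Local Notation et := (eta S).

Lemma endoD X Y : ph (X + Y) = ph X + ph Y. Proof. exact: raddfD. Qed.
Lemma endoN X : ph (- X) = - ph X. Proof. exact: raddfN. Qed.
Lemma endo0 : ph 0 = 0. Proof. exact: raddf0. Qed.
Lemma endoZ f X : ph (f *: X) = f *: ph X. Proof. exact: linearZ. Qed.
Lemma eta_Z f X : et (f *: X) = f * et X. Proof. exact: linearZ. Qed.

Lemma phv2 X : ph (ph X) = - X + (et X : C^oo M) *: xi.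
Proof. exact: phi2. Qed.

(** From $\phi^2\xi = 0$ one gets $\phi\xi = \eta(\phi\xi)\xi$ and then $\eta(\phi\xi)^2 = 0$. The
    square is removed pointwise, since [C^oo M] has zero divisors. *)
Lemma phi_xi : ph xi = 0.
Proof.
have H : ph (ph xi) = 0 by rewrite phv2 eta_xi scale1r addNr.
have H1 : ph xi = (et (ph xi) : C^oo M) *: xi.
  by have := phv2 (ph xi); rewrite H endo0 => /esym/eqP; rewrite addrC subr_eq0 => /eqP.
have : et (ph xi) * et (ph xi) = 0.
  rewrite -[X in _ * X]mulr1 -(eta_xi S) -eta_Z mulrC -eta_Z.
  by rewrite -H1 -endoZ -H1 H; exact: raddf0.
move=> H2; have E : et (ph xi) = 0.
  apply: smooth_funP => p; have := congr1 (fun f : C^oo M => f p) H2.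
  by rewrite /= => /eqP; rewrite mulf_eq0 orbb => /eqP.
by rewrite H1 E scale0r.
Qed.

Lemma eta_g X : et X = g X xi.
Proof.
have := metric_phi S X xi; rewrite -!/(phv S _) phi_xi g0r eta_xi mulr1 => /esym/eqP.
by rewrite subr_eq0 => /eqP.
Qed.

Lemma g_phi_xi X : g (ph X) xi = 0.
Proof.
have := phv2 (ph X); rewrite (phv2 X) endoD endoN endoZ phi_xi scaler0 addr0.
move=> /(congr1 (fun Z => g Z xi)); rewrite !gDl !gZl -!eta_g eta_xi mulr1.
by rewrite -[LHS]addr0 => /addrI.
Qed.

Lemma g_xi_phi X : g xi (ph X) = 0.
Proof. by rewrite gC g_phi_xi. Qed.

Lemma g_xi_xi : g xi xi = 1.
Proof. by rewrite -eta_g eta_xi. Qed.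

Lemma phi2g X : ph (ph X) = - X + (g X xi) *: xi.
Proof. by rewrite phv2 eta_g. Qed.

Lemma g_phi_l X Y : g (ph X) Y = - g X (ph Y).
Proof.
have := metric_phi S X (ph Y); rewrite -!/(phv S _).
rewrite !eta_g phi2g gDr gNr gZr !g_phi_xi !mulr0 addr0 subr0 => <-.
by rewrite opprK.
Qed.

Lemma g_phi_phi X Y : g (ph X) (ph Y) = g X Y - g X xi * g Y xi.
Proof. by rewrite -(eta_g X) -(eta_g Y); exact: metric_phi. Qed.
End AlmostContactAlgebra.

Section QuasiSasakian.
Variables (R : realType) (m : nat) (M : manifold R m) (g : metric M).
Variables (D : levi_civita g) (S : almost_contact g).
Local Notation vf := (vfield M).
Implicit Types (X Y Z W : vf) (f : C^oo M) (p : M).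
Local Notation ph := (phv S).
Local Notation xi := (xi S).

Lemma nablaDr X Y Z : D X (Y + Z) = D X Y + D X Z.
Proof. exact: nabla_additive. Qed.
Lemma nablaNr X Y : D X (- Y) = - D X Y.
Proof.
have D0 : D X 0 = 0 by have /eqP := nablaDr X 0 0; rewrite addr0 -subr_eq subrr eq_sym => /eqP.
by apply/eqP; rewrite -addr_eq0 -nablaDr addNr D0.
Qed.
Lemma nablaZr X f Y : D X (f *: Y) = (X f : C^oo M) *: Y + f *: D X Y.
Proof. exact: nabla_leibniz. Qed.
Lemma nablaDl X Y Z : D (X + Y) Z = D X Z + D Y Z.
Proof. by have := nabla_linearl D 1 X Y Z; rewrite !scale1r. Qed.
Lemma nabla0l Z : D 0 Z = 0.
Proof. by have /eqP := nablaDl 0 0 Z; rewrite addr0 -subr_eq subrr eq_sym => /eqP. Qed.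
Lemma nablaZl f X Z : D (f *: X) Z = f *: D X Z.
Proof. by have := nabla_linearl D f X 0 Z; rewrite nabla0l !addr0. Qed.
Lemma nablaNl X Z : D (- X) Z = - D X Z.
Proof. by rewrite -scaleN1r nablaZl scaleN1r. Qed.
Lemma lieE X Y : lie X Y = D X Y - D Y X.
Proof. by rewrite (nabla_torsion_free D). Qed.
Definition nablaE := (nablaDr, nablaNr, nablaZr, nablaDl, nablaNl, nablaZl).
Definition dxi X Y := g (D X xi) Y.
(** The form $g((\nabla_X\phi)Y, Z)$. Closedness and normality are rewritten as linear relations
    between [dphi] and [dxi]. *)
Definition dphi X Y Z := g (D X (ph Y) - ph (D X Y)) Z.

Lemma dxi_xi X : dxi X xi = 0.
Proof.
apply: smooth_funP => p; rewrite /dxi.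
have := ev_at p (nabla_metric D X xi xi).
rewrite g_xi_xi vfield1 (gC g _ xi) !smoothE; move=> *; lra.
Qed.

Lemma X_eta X Y : X (g Y xi) = g (D X Y) xi + dxi X Y.
Proof. by rewrite (nabla_metric D) (gC g Y). Qed.

Lemma dphi_skew X Y Z p : dphi X Y Z p = - dphi X Z Y p.
Proof.
have H1 := ev_at p (nabla_metric D X (ph Y) Z).
have H2 := ev_at p (nabla_metric D X Y (ph Z)).
move: H1 H2; rewrite /dphi !gE !g_phi_l vfieldN !smoothE.
rewrite (gC g (D X (ph Z)) Y) (gC g (D X Z)) g_phi_l !smoothE; move=> *; lra.
Qed.

(** The covariant derivative of $\phi^2 = -I + \eta\otimes\xi$. *)
Lemma dphi_phi X Y Z p :
  dphi X (ph Y) Z p - dphi X Y (ph Z) p = dxi X Y p * g Z xi p + g Y xi p * dxi X Z p.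
Proof.
have := ev_at p (X_eta X Y).
rewrite /dphi !gE !g_phi_l !phi2g !nablaE !gE /dxi !smoothE.
by move=> ->; rewrite (gC g xi Z); ring.
Qed.

Lemma dphi_xi X Y p : dphi X Y xi p = - dxi X (ph Y) p.
Proof.
have := ev_at p (nabla_metric D X (ph Y) xi).
rewrite g_phi_xi vfield0 /dphi /dxi !gE g_phi_xi (gC g _ (D X xi)) !smoothE; move=> *; lra.
Qed.

Hypothesis qS : quasi_sasakian S.

Lemma dphi_cyclic X Y Z p : dphi X Y Z p + dphi Y Z X p + dphi Z X Y p = 0.
Proof.
have := ev_at p (qS.2 X Y Z); rewrite /ext_d2 /fundamental_form -!/(phv S _) !(nabla_metric D).
have s1 := dphi_skew X Y Z p; have s2 := dphi_skew Y Z X p; have s3 := dphi_skew Z X Y p.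
move: s1 s2 s3; rewrite /dphi !lieE !gE !g_phi_l !smoothE.
rewrite (gC g Y (D X (ph Z))) (gC g Z (D Y (ph X))) (gC g X (D Z (ph Y))).
rewrite ?(gC g (ph X)) ?(gC g (ph Y)) ?(gC g (ph Z)).
move=> *; lra.
Qed.

(** Normality paired with [W], every bracket being written through [D]. *)
Lemma nijenhuis_dphi Y Z W p :
  dphi (ph Y) Z W p - dphi (ph Z) Y W p - dphi Z Y (ph W) p + dphi Y Z (ph W) p
  + (dxi Y Z p - dxi Z Y p) * g W xi p = 0.
Proof.
have := ev_at p (congr1 (fun V => g V W) (qS.1 Y Z)).
rewrite /nijenhuis /ext_d1 -!/(phv S _) !eta_g !X_eta mulr2n scalerDl.
rewrite /dphi /dxi !lieE !endoD !endoN !phi2g !gE !g_phi_l !smoothE.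
by rewrite !phi2g !gE !smoothE (gC g xi W) => H; lra.
Qed.

Lemma dxi_xi_l Y p : dxi xi Y p = 0.
Proof.
have := nijenhuis_dphi Y xi xi p; rewrite phi_xi.
have := dphi_xi (ph Y) xi p; rewrite phi_xi.
rewrite dxi_xi (ev_at p (g_xi_xi S)) /dphi /dxi !phi_xi !nabla0l !endo0 !gE !smoothE.
move=> *; lra.
Qed.

Lemma dxi_phi_alt Y Z p :
  dxi (ph Y) (ph Z) p - dxi (ph Z) (ph Y) p = dxi Y Z p - dxi Z Y p.
Proof.
have := nijenhuis_dphi Y Z xi p; rewrite phi_xi !dphi_xi.
have z U V : dphi U V 0 p = 0 by rewrite /dphi g0r.
by rewrite !z (ev_at p (g_xi_xi S)) smooth1 => H; lra.
Qed.

Lemma dxi_phi2_r X Z p : dxi X (ph (ph Z)) p = - dxi X Z p.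
Proof.
rewrite /dxi phi2g gDr gNr gZr !smoothE.
by rewrite (ev_at p (dxi_xi X)) mulr0 addr0.
Qed.

Lemma dxi_phi2_l Z Y p : dxi (ph (ph Z)) Y p = - dxi Z Y p.
Proof.
rewrite /dxi phi2g nablaDl nablaNl nablaZl gDl gNl gZl !smoothE.
by rewrite -/(dxi xi Y) dxi_xi_l mulr0 addr0.
Qed.

Lemma dxi_phi_mixed Y Z p :
  dxi (ph Y) Z p - dxi Z (ph Y) p + dxi Y (ph Z) p - dxi (ph Z) Y p = 0.
Proof.
have := dxi_phi_alt Y (ph Z) p; rewrite dxi_phi2_r dxi_phi2_l => H; lra.
Qed.

(** The analogue of the Kahler argument for a parallel complex structure: closedness at $(X,Y,Z)$
    and at $(X,\phi Y,\phi Z)$ is combined with normality at $(Y,Z)$ paired with $\phi X$. All that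
    survives of $\nabla\phi$ is given by $\nabla\xi$. *)
Lemma dphi_alt X Y Z p :
  2 * dphi X Y Z p = g Z xi p * (dxi (ph Y) X p - dxi X (ph Y) p)
                   - g Y xi p * (dxi (ph Z) X p - dxi X (ph Z) p).
Proof.
have N := nijenhuis_dphi Y Z (ph X) p.
have C1 := dphi_cyclic X Y Z p.
have C2 := dphi_cyclic X (ph Y) (ph Z) p.
have e2 U V : dphi U V (ph (ph X)) p = - dphi U V X p - g X xi p * dxi U (ph V) p.
  have -> : dxi U (ph V) p = - dphi U V xi p by rewrite dphi_xi opprK.
  by rewrite /dphi phi2g gDr gNr gZr !smoothE; ring.
have P1 := dphi_phi (ph Y) Z X p.
have P2 := dphi_phi (ph Z) Y X p.
have P3 := dphi_phi X Y (ph Z) p.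
have K1 := dphi_skew (ph Z) (ph Y) X p.
have K2 := dphi_skew Z Y X p.
have K3 : dphi X Y (ph (ph Z)) p = - dphi X Y Z p - g Z xi p * dxi X (ph Y) p.
  have -> : dxi X (ph Y) p = - dphi X Y xi p by rewrite dphi_xi opprK.
  by rewrite /dphi phi2g gDr gNr gZr !smoothE; ring.
have MX := dxi_phi_mixed Y Z p.
rewrite !e2 (ev_at p (g_phi_xi S X)) smooth0 mulr0 addr0 in N.
rewrite K3 (ev_at p (g_phi_xi S Z)) smooth0 mulr0 in P3.
(* The final combination is linear only once this relation has been multiplied by the function
   [g X xi]. *)
have MX' := congr1 (fun u => g X xi p * u) MX; rewrite /= mulr0 in MX'.
lra.
Qed.

(** [dphi_alt] at $Y = \xi$, together with [dphi_xi]: the field $\xi$ is Killing. *)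
Lemma dxi_skew X Y p : dxi X Y p = - dxi Y X p.
Proof.
have H Z : dxi X (ph Z) p = - dxi (ph Z) X p.
  have := dphi_alt X xi Z p; rewrite dphi_skew dphi_xi phi_xi (ev_at p (g_xi_xi S)) smooth1.
  have z : dxi 0 X p = 0 by rewrite /dxi nabla0l g0l.
  have z' : dxi X 0 p = 0 by rewrite /dxi g0r.
  by rewrite z z' => E; lra.
have := H (ph Y); rewrite dxi_phi2_r dxi_phi2_l => E; lra.
Qed.

(** The skew operator $\nabla\xi$ is composed with $\phi$ to give one that is symmetric and still
    commutes with $\phi$. *)
Definition shape_op X := locked (ph (D X xi)).

Lemma shape_opE X : shape_op X = ph (D X xi).
Proof. by rewrite /shape_op -lock. Qed.

Lemma nabla_xi X : D X xi = - ph (shape_op X).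
Proof.
rewrite shape_opE phi2g; have -> : g (D X xi) xi = 0 by rewrite -[LHS]/(dxi X xi) dxi_xi.
by rewrite scale0r addr0 opprK.
Qed.

Lemma shape_xi : shape_op xi = 0.
Proof.
rewrite shape_opE (_ : D xi xi = 0) ?endo0//.
by apply: (@g_inj _ _ _ g) => Z; apply: smooth_funP => p; rewrite g0l -/(dxi xi Z) dxi_xi_l.
Qed.

Lemma g_shape X Y : g (shape_op X) Y = - dxi X (ph Y).
Proof. by rewrite shape_opE g_phi_l. Qed.

Lemma shape_sym X Y : g (shape_op X) Y = g (shape_op Y) X.
Proof.
apply: smooth_funP => p; rewrite !g_shape !smoothE.
have := dxi_phi_mixed Y X p; have := dxi_skew X (ph Y) p; have := dxi_skew Y (ph X) p.
by move=> *; lra.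
Qed.

Lemma shape_phi X : shape_op (ph X) = ph (shape_op X).
Proof.
apply: (@g_inj _ _ _ g) => Y; apply: smooth_funP => p.
rewrite g_phi_l !g_shape !smoothE dxi_phi2_r.
have := dxi_phi_alt X Y p; have := dxi_skew X Y p; have := dxi_skew (ph X) (ph Y) p.
by move=> *; lra.
Qed.

(** Since $\xi$ is Killing, both differences in [dphi_alt] double up and cancel the factor 2. *)
Lemma nabla_phi X Y :
  D X (ph Y) = ph (D X Y) + g (shape_op X) Y *: xi - g Y xi *: shape_op X.
Proof.
apply: (@g_inj _ _ _ g) => Z; apply: smooth_funP => p.
have := dphi_alt X Y Z p; rewrite /dphi !gE !smoothE (gC g xi Z) !g_shape !smoothE.
have := dxi_skew X (ph Y) p; have := dxi_skew X (ph Z) p.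
by move=> -> ->; move=> *; lra.
Qed.

End QuasiSasakian.

(** * The common shape operator *)

Section Triple.
Variables (R : realType) (m : nat) (M : manifold R m) (g : metric M).
Local Notation vf := (vfield M).
Implicit Types (X Y Z W : vf) (f : C^oo M) (p : M).

Record contact_triple (a b c : almost_contact g) : Prop := ContactTriple {
  triple_phi : forall X, phv c X = phv a (phv b X) - g X (xi b) *: xi a;
  triple_phi' : forall X, phv c X = - phv b (phv a X) + g X (xi a) *: xi b;
  triple_xi : xi c = phv a (xi b);
  triple_xi' : xi c = - phv b (xi a);
  triple_eta : forall X, g X (xi c) = g (phv b X) (xi a) }.

Variables a b c : almost_contact g.
Hypotheses (Tabc : contact_triple a b c) (Tbca : contact_triple b c a)
  (Tcab : contact_triple c a b).

Lemma triple_xi_ab : g (xi a) (xi b) = 0.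
Proof. by rewrite (triple_xi Tbca) g_phi_xi. Qed.

Lemma triple_xi_ac : g (xi a) (xi c) = 0.
Proof. by rewrite (triple_xi Tabc) gC g_phi_xi. Qed.

Lemma triple_phi_c : phv a (xi c) = - xi b.
Proof. by rewrite (triple_xi' Tcab) opprK. Qed.

Variable D : levi_civita g.
Hypotheses (qa : quasi_sasakian a) (qb : quasi_sasakian b) (qc : quasi_sasakian c).

Local Notation A := (shape_op D).

(* The covariant derivative of [phv c = phv a phv b - eta b (x) xi a]. *)
Lemma triple_nabla_phi X Y :
  (g (A c X) Y - g (A b X) Y) *: xi c - g Y (xi c) *: (A c X - A a X) =
  (g (phv b (A b X)) Y - g (phv b (A a X)) Y) *: xi a
    - g Y (xi b) *: (phv a (A b X) - phv a (A a X)).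
Proof.
have H : D X (phv c Y) = D X (phv a (phv b Y) - g Y (xi b) *: xi a) by rewrite (triple_phi Tabc).
apply: (@g_inj _ _ _ g) => Z; apply: smooth_funP => p.
have := ev_at p (congr1 (g ^~ Z) H).
rewrite (nabla_phi D qc) nablaDr nablaNr nablaZr (nabla_phi D qa) (nabla_phi D qb).
rewrite (triple_phi Tabc) (nabla_metric D) (nabla_xi D a) (nabla_xi D b).
move: (A a X) (A b X) (A c X) (D X Y) => Aa Ab Ac DY.
rewrite !(endoD, endoN, endoZ) -(triple_xi Tabc) -(triple_eta Tabc) !gE !smoothE.
rewrite (gC g Y (phv b Ab)) !g_phi_l !smoothE.
by move=> E; lra.
Qed.

(** [triple_nabla_phi] paired with [xi c]; [A b] and [A c] kill their own [xi], so only [A a] is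
    left on the right. *)
Lemma triple_shape_diff X Y p :
  g (A c X) Y p - g (A b X) Y p =
    g Y (xi b) p * g (A a X) (xi b) p - g Y (xi c) p * g (A a X) (xi c) p.
Proof.
have := ev_at p (congr1 (g ^~ (xi c)) (triple_nabla_phi X Y)).
have z1 : g (A b X) (xi b) p = 0.
  by rewrite shape_sym// shape_xi// g0l.
have z2 : g (A c X) (xi c) p = 0.
  by rewrite shape_sym// shape_xi// g0l.
rewrite !gE !g_phi_l triple_phi_c triple_xi_ac g_xi_xi gNr opprK !smoothE.
rewrite z1 z2 !gNr !smoothE => E; lra.
Qed.
End Triple.

Section CommonShape.
Variables (R : realType) (m : nat) (M : manifold R m) (g : metric M).
Local Notation vf := (vfield M).
Implicit Types (X Y Z W : vf) (f : C^oo M) (p : M).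
Variables a b c : almost_contact g.
Hypotheses (Tabc : contact_triple a b c) (Tbca : contact_triple b c a)
  (Tcab : contact_triple c a b).
Variable D : levi_civita g.
Hypotheses (qa : quasi_sasakian a) (qb : quasi_sasakian b) (qc : quasi_sasakian c).
Local Notation A := (shape_op D).

Let Acc X p : g (A c X) (xi c) p = 0.
Proof. by rewrite shape_sym// shape_xi// g0l. Qed.

Lemma shape_bc X p : g (A b X) (xi c) p = g (A a X) (xi c) p.
Proof.
have := triple_shape_diff Tabc Tcab D qa qb qc X (xi c) p.
rewrite Acc g_xi_xi (gC g (xi c)) (triple_xi_ab Tcab) !smoothE => E; lra.
Qed.

(** The eigenvalue of [A a] on [xi b], and on [xi c] as well; it turns out not to depend on the
    triple and becomes [h]. *)
Definition shape_const : C^oo M := g (A a (xi b)) (xi b).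

Let E X Y p := triple_shape_diff Tabc Tcab D qa qb qc X Y p.

Let diff_sym X Y p :
  g Y (xi b) p * g (A a X) (xi b) p - g Y (xi c) p * g (A a X) (xi c) p =
  g X (xi b) p * g (A a Y) (xi b) p - g X (xi c) p * g (A a Y) (xi c) p.
Proof. by rewrite -!E (shape_sym D qb X) (shape_sym D qc X). Qed.

(** The symmetry [diff_sym] makes this entry skew under exchange of [xi b] and [xi c], whereas [A a]
    is symmetric. *)
Let off_diag p : g (A a (xi b)) (xi c) p = 0.
Proof.
have := diff_sym (xi c) (xi b) p.
rewrite (gC g (xi c) (xi b)) (triple_xi_ab Tcab) !g_xi_xi (shape_sym D qa (xi c) (xi b)) !smoothE => H; lra.
Qed.

Lemma shape_a_b X p : g (A a X) (xi b) p = shape_const p * g X (xi b) p.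
Proof.
have := diff_sym X (xi b) p; rewrite off_diag (triple_xi_ab Tcab) !g_xi_xi !smoothE /shape_const => H; lra.
Qed.

(** [xi c] is [phv a (xi b)], and [A a] commutes with [phv a]. *)
Lemma shape_const_c : g (A a (xi c)) (xi c) = shape_const.
Proof.
rewrite {1}(triple_xi Tabc) (shape_phi D qa) (triple_xi Tabc) g_phi_phi.
by rewrite (gC g (xi b)) (triple_xi_ab Tbca) mulr0 subr0.
Qed.

Lemma shape_a_c X p : g (A a X) (xi c) p = shape_const p * g X (xi c) p.
Proof.
have := diff_sym X (xi c) p; rewrite (shape_sym D qa (xi c) (xi b)) off_diag shape_const_c.
rewrite (gC g (xi c) (xi b)) (triple_xi_ab Tcab) !g_xi_xi !smoothE => H; lra.
Qed.

Lemma shape_const_next : g (A b (xi c)) (xi c) = shape_const.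
Proof. by rewrite -shape_const_c; apply: smooth_funP => p; exact: shape_bc. Qed.

Lemma shape_common X :
  A b X + (shape_const * g X (xi b)) *: xi b = A c X + (shape_const * g X (xi c)) *: xi c.
Proof.
apply: (@g_inj _ _ _ g) => Y; apply: smooth_funP => p.
have := E X Y p; rewrite shape_a_b shape_a_c !gE (gC g (xi b)) (gC g (xi c)) !smoothE => H; lra.
Qed.
End CommonShape.

(** The curvature computations below use nothing but these equations and the contact triples. *)
Record common_shape (R : realType) (m : nat) (M : manifold R m) (g : metric M)
    (D : levi_civita g) (S : 'I_3 -> almost_contact g)
    (A : vfield M -> vfield M) (h : C^oo M) : Prop := CommonShape {
  csh_linear : forall (f : C^oo M) X Y, A (f *: X + Y) = f *: A X + A Y;
  csh_sym : forall X Y, g (A X) Y = g X (A Y);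
  csh_xi : forall i, A (xi (S i)) = h *: xi (S i);
  csh_phi : forall i X, A (phv (S i) X) = phv (S i) (A X);
  csh_nabla_xi : forall i X, D X (xi (S i)) = - phv (S i) (A X);
  csh_nabla_phi : forall i X Y, D X (phv (S i) Y) =
    phv (S i) (D X Y) + g (A X) Y *: xi (S i) - g Y (xi (S i)) *: A X }.

Lemma ord3_arith : [/\ 1 + 1 = 2 :> 'I_3, 1 + 2 = 0 :> 'I_3, 2 + 1 = 0 :> 'I_3 & 2 + 2 = 1 :> 'I_3].
Proof. by split; apply/eqP. Qed.

Section ShiftedShape.
Variables (R : realType) (m : nat) (M : manifold R m) (g : metric M).
Variables (D : levi_civita g) (x : almost_contact g) (qx : quasi_sasakian x).
Variables (A : vfield M -> vfield M) (h : C^oo M).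
Hypothesis AE : forall X, A X = shape_op D x X + (h * g X (xi x)) *: xi x.
Implicit Types (X Y : vfield M) (f : C^oo M).

Lemma shape_linear f X Y : shape_op D x (f *: X + Y) = f *: shape_op D x X + shape_op D x Y.
Proof. by rewrite !shape_opE nablaDl nablaZl endoD endoZ. Qed.

Lemma shift_linear f X Y : A (f *: X + Y) = f *: A X + A Y.
Proof.
rewrite !AE shape_linear; apply: (@g_inj _ _ _ g) => Z; apply: smooth_funP => p.
by rewrite !gE !smoothE; ring.
Qed.

Lemma shift_sym X Y : g (A X) Y = g X (A Y).
Proof.
rewrite !AE; apply: smooth_funP => p; rewrite !gE (shape_sym D qx) (gC g _ X) (gC g (xi x)) !smoothE.
by ring.
Qed.

Lemma shift_xi : A (xi x) = h *: xi x.
Proof. by rewrite AE (shape_xi D qx) g_xi_xi mulr1 add0r. Qed.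

Lemma shift_phi X : A (phv x X) = phv x (A X).
Proof.
by rewrite !AE (shape_phi D qx) g_phi_xi mulr0 scale0r addr0 endoD endoZ phi_xi scaler0 addr0.
Qed.

Lemma shift_nabla_xi X : D X (xi x) = - phv x (A X).
Proof. by rewrite AE endoD endoZ phi_xi scaler0 addr0 -nabla_xi. Qed.

(** The shift contributes two multiples of [xi x] with coefficient [h * g X (xi x) * g Y (xi x)], of
    opposite signs. *)
Lemma shift_nabla_phi X Y : D X (phv x Y) =
  phv x (D X Y) + g (A X) Y *: xi x - g Y (xi x) *: A X.
Proof.
rewrite (nabla_phi D qx) AE; apply: (@g_inj _ _ _ g) => Z; apply: smooth_funP => p.
by rewrite !gE (gC g (xi x) Y) !smoothE; ring.
Qed.
End ShiftedShape.

Lemma ord3_cases (i : 'I_3) : [\/ i = 0, i = 1 | i = 2].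
Proof.
by case: i => -[|[|[|//]]] ?; [apply: Or31|apply: Or32|apply: Or33]; apply: val_inj.
Qed.

Section ThreeContact.
Variables (R : realType) (n : nat) (M : manifold R (4 * n + 3)%N) (g : metric M).
Variable S : almost_3contact g.
Implicit Types (X Y : vfield M).

Lemma rotation_perm (i : 'I_3) : exists s : 'S_3,
  [/\ ~~ odd_perm s, s 0 = i, s 1 = i + 1 & s 2 = i + 2].
Proof.
have inj (k : 'I_3) : injective (fun j : 'I_3 => j + k) by exact: addIr.
exists (perm (inj i)); split; rewrite ?permE ?add0r 1?[1 + i]addrC 1?[2 + i]addrC//.
(* Rotation by [i] is the square of rotation by [i + i], as $4i = i$ modulo 3, and squares are
   even. *)
have -> : perm (inj i) = (perm (inj (i + i)) * perm (inj (i + i)))%g.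
  apply/permP => j; rewrite permM !permE -addrA; congr (j + _).
  by case: (ord3_cases i) => ->; apply/eqP.
by rewrite odd_permM addbb.
Qed.

Lemma contact_triple_rotation (i : 'I_3) : contact_triple (S i) (S (i + 1)) (S (i + 2)).
Proof.
have [s [os s0 s1 s2]] := rotation_perm i.
have [H1 H2 [H3 H4] H5] := ac_compat S os.
rewrite s0 s1 s2 in H1 H2 H3 H4 H5; split => //.
- by move=> X; rewrite -eta_g; exact: H1.
- by move=> X; rewrite -eta_g; exact: H2.
- by move=> X; rewrite -!eta_g; have [-> _] := H5 X.
Qed.

Lemma common_shape_ex (D : levi_civita g) : (forall d, quasi_sasakian (S d)) ->
  exists A h, common_shape D S A h.
Proof.
move=> qS; have T0 := contact_triple_rotation 0; have T1 := contact_triple_rotation 1.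
have T2 := contact_triple_rotation 2.
rewrite !add0r in T0.
have [e11 e12 e21 e22] := ord3_arith; rewrite e11 e12 in T1; rewrite e21 e22 in T2.
pose h := shape_const (S 0) (S 1) D.
have h2 : shape_const (S 2) (S 0) D = h.
  by rewrite -(shape_const_next T2 T0 T1 D (qS 2) (qS 0) (qS 1)).
(* Index 1 is the pivot: a single use of [shape_common] links it to 0, and another links it to 2. *)
pose A X := shape_op D (S 1) X + (h * g X (xi (S 1))) *: xi (S 1).
have AE i X : A X = shape_op D (S i) X + (h * g X (xi (S i))) *: xi (S i).
  case: (ord3_cases i) => ->.
  - rewrite /A -h2; exact: esym (shape_common T2 T0 T1 D (qS 2) (qS 0) (qS 1) X).
  - by [].
  - exact: (shape_common T0 T1 T2 D (qS 0) (qS 1) (qS 2)).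
exists A, h; split.
- exact: (shift_linear (AE 0)).
- exact: (shift_sym (qS 0) (AE 0)).
- by move=> i; exact: (shift_xi (qS i) (AE i)).
- by move=> i; exact: (shift_phi (qS i) (AE i)).
- by move=> i; exact: (shift_nabla_xi (AE i)).
- by move=> i; exact: (shift_nabla_phi (qS i) (AE i)).
Qed.
End ThreeContact.

Lemma g_eq0 (R : realType) (m : nat) (M : manifold R m) (g : metric M) (X : vfield M) :
  g X X = 0 -> X = 0.
Proof.
move=> H; apply: val_inj; apply/funext => f; apply: smooth_funP => p.
by apply: (@metric_eq0 _ _ _ g); rewrite H.
Qed.

(** * Curvature *)

Section Curvature.
Variables (R : realType) (m : nat) (M : manifold R m) (g : metric M) (D : levi_civita g).
Local Notation vf := (vfield M).
Implicit Types (X Y Z W : vf) (f : C^oo M) (p : M).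
Local Notation Rm := (curvature D).

Lemma lie_apply X Y f : lie X Y f = X (Y f) - Y (X f).
Proof. by []. Qed.

Lemma jacobi X Y Z : lie (lie X Y) Z + lie (lie Y Z) X + lie (lie Z X) Y = 0.
Proof.
apply: val_inj; apply/funext => f; apply: smooth_funP => p.
change (lie (lie X Y) Z f p + lie (lie Y Z) X f p + lie (lie Z X) Y f p = 0).
rewrite !lie_apply !vfieldD !vfieldN !smoothE; ring.
Qed.

Lemma curvature_skew12 X Y Z : Rm X Y Z = - Rm Y X Z.
Proof.
rewrite /curvature; have -> : lie Y X = - lie X Y by rewrite !(lieE D) opprB.
apply: (@g_inj _ _ _ g) => W; apply: smooth_funP => p.
by rewrite nablaNl !gE !smoothE; ring.
Qed.

Lemma curvature_bianchi X Y Z : Rm X Y Z + Rm Y Z X + Rm Z X Y = 0.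
Proof.
have J := jacobi X Y Z; apply: (@g_inj _ _ _ g) => W; apply: smooth_funP => p.
have := ev_at p (congr1 (g ^~ W) J); rewrite !(lieE D (lie _ _)) /curvature !gE !smoothE.
have E (U V T : vf) : D U (lie V T) = D U (D V T) - D U (D T V) by rewrite (lieE D) nablaDr nablaNr.
by rewrite !E !gE !smoothE => H; lra.
Qed.

(** $XY - YX - [X,Y]$ kills the function $g(Z,W)$; metric compatibility expands this. *)
Lemma curvature_skew34 X Y Z W p : g (Rm X Y Z) W p = - g (Rm X Y W) Z p.
Proof.
have H1 (U V T L : vf) : U (g (D V T) L) p = g (D U (D V T)) L p + g (D V T) (D U L) p.
  by rewrite (nabla_metric D).
have H2 (U V : vf) : U (V (g Z W)) p = g (D U (D V Z)) W p + g (D V Z) (D U W) p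
    + g (D U Z) (D V W) p + g Z (D U (D V W)) p.
  by rewrite (nabla_metric D V) vfieldD !(nabla_metric D U) !smoothE; ring.
have := ev_at p (nabla_metric D (lie X Y) Z W); rewrite lie_apply !smoothE !H2.
rewrite /curvature !gE !smoothE (gC g Z (D (lie X Y) W)) (gC g Z (D X (D Y W))) (gC g Z (D Y (D X W))).
by move=> H; lra.
Qed.

(** The octahedron argument: four Bianchi identities combined with the two skew symmetries. *)
Lemma curvature_pair X Y Z W p : g (Rm X Y Z) W p = g (Rm Z W X) Y p.
Proof.
have B (U V T L : vf) : g (Rm U V T) L p + g (Rm V T U) L p + g (Rm T U V) L p = 0.
  by have := ev_at p (congr1 (g ^~ L) (curvature_bianchi U V T)); rewrite !gE !smoothE.
have S12 (U V T L : vf) : g (Rm U V T) L p = - g (Rm V U T) L p.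
  by rewrite {1}curvature_skew12 gNl smoothN.
have B1 := B X Y Z W; have B2 := B Y Z W X; have B3 := B Z W X Y; have B4 := B W X Y Z.
have a1 := curvature_skew34 X Y Z W p; have a2 := curvature_skew34 Y Z X W p.
have a3 := curvature_skew34 Z X Y W p; have a4 := curvature_skew34 Z W X Y p.
have a5 := curvature_skew34 W X Z Y p; have a6 := curvature_skew34 W Y Z X p.
have b1 := S12 Z X W Y; have b2 := S12 Y W Z X; have b3 := S12 X Y W Z.
have b4 := S12 X W Y Z; have b5 := S12 W X Z Y; have b6 := S12 Z Y W X.
have b7 := S12 X Z W Y; have b8 := S12 Y W X Z.
lra.
Qed.

Lemma curvature_linear1 f X X' Y Z : Rm (f *: X + X') Y Z = f *: Rm X Y Z + Rm X' Y Z.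
Proof.
have E : lie (f *: X + X') Y = f *: lie X Y + lie X' Y - (Y f : C^oo M) *: X.
  rewrite !(lieE D) nablaDl nablaZl nablaDr nablaZr.
  apply: (@g_inj _ _ _ g) => W; apply: smooth_funP => p; rewrite !gE !smoothE; ring.
rewrite /curvature E !nablaDl !nablaNl !nablaZl !nablaDr !nablaZr.
by apply: (@g_inj _ _ _ g) => W; apply: smooth_funP => p; rewrite !gE !smoothE; ring.
Qed.
End Curvature.

(** * The common operator: constancy of its eigenvalue, quadratic relation, parallelism *)

Section CommonGeometry.
Variables (R : realType) (m : nat) (M : manifold R m) (g : metric M) (D : levi_civita g).
Variables (S : 'I_3 -> almost_contact g).
Hypothesis T : forall i, contact_triple (S i) (S (i + 1)) (S (i + 2)).
Variables (A : vfield M -> vfield M) (h : C^oo M).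
Hypothesis CS : common_shape D S A h.
Local Notation vf := (vfield M).
Implicit Types (X Y Z W : vf) (f : C^oo M) (p : M) (i j : 'I_3).
Local Notation ph i := (phv (S i)).
Local Notation x i := (xi (S i)).
Local Notation Rm := (curvature D).

Lemma ord3_shift i : [/\ i + 1 + 1 = i + 2, i + 1 + 2 = i, i + 2 + 1 = i & i + 2 + 2 = i + 1].
Proof.
have [e11 e12 e21 e22] := ord3_arith.
by split; rewrite -addrA; [rewrite e11|rewrite e12 addr0|rewrite e21 addr0|rewrite e22].
Qed.

Lemma triple_rot1 i : contact_triple (S (i + 1)) (S (i + 2)) (S i).
Proof. by have := T (i + 1); have [-> -> _ _] := ord3_shift i. Qed.

Lemma triple_rot2 i : contact_triple (S (i + 2)) (S i) (S (i + 1)).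
Proof. by have := T (i + 2); have [_ _ -> ->] := ord3_shift i. Qed.

Lemma ord3_shift_cases i j : [\/ j = i, j = i + 1 | j = i + 2].
Proof.
have [E|E|E] := ord3_cases (j - i).
- by apply: Or31; apply/eqP; rewrite -subr_eq0 E.
- by apply: Or32; rewrite -E addrC subrK.
- by apply: Or33; rewrite -E addrC subrK.
Qed.

Lemma xi_ab i : g (x i) (x (i + 1)) = 0. Proof. exact: triple_xi_ab (triple_rot1 i). Qed.
Lemma xi_ca i : g (x (i + 2)) (x i) = 0. Proof. exact: triple_xi_ab (T i). Qed.
Lemma phi_ab i : ph i (x (i + 1)) = x (i + 2). Proof. by rewrite (triple_xi (T i)). Qed.
Lemma phi_ac i : ph i (x (i + 2)) = - x (i + 1). Proof. exact: triple_phi_c (triple_rot2 i). Qed.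

Lemma xi_orthonormal i j : g (x i) (x j) = (i == j)%:R.
Proof.
have [n1 n2] : i != i + 1 /\ i != i + 2.
  by rewrite -{1 3}[i]addr0 !(inj_eq (addrI i)).
case: (ord3_shift_cases i j) => ->.
- by rewrite g_xi_xi eqxx.
- by rewrite xi_ab (negbTE n1).
- by rewrite gC xi_ca (negbTE n2).
Qed.

(* Both vanish identically: see [nablaA0] and [defect0]. *)
Definition nablaA X Y := locked (D X (A Y) - A (D X Y)).
Definition defect X := locked (A (A X) - h *: A X).

Lemma nablaAE X Y : nablaA X Y = D X (A Y) - A (D X Y). Proof. by rewrite /nablaA -lock. Qed.
Lemma defectE X : defect X = A (A X) - h *: A X. Proof. by rewrite /defect -lock. Qed.

Lemma csh_add X Y : A (X + Y) = A X + A Y.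
Proof. by have := csh_linear CS 1 X Y; rewrite !scale1r. Qed.
Lemma csh_zero : A 0 = 0.
Proof. by have /eqP := csh_add 0 0; rewrite addr0 -subr_eq subrr eq_sym => /eqP. Qed.
Lemma csh_scale f X : A (f *: X) = f *: A X.
Proof. by have := csh_linear CS f X 0; rewrite csh_zero !addr0. Qed.
Lemma csh_opp X : A (- X) = - A X.
Proof. by rewrite -scaleN1r csh_scale scaleN1r. Qed.

Lemma nablaA_linear_r f X Y Z : nablaA X (f *: Y + Z) = f *: nablaA X Y + nablaA X Z.
Proof.
rewrite !nablaAE !(csh_add, csh_scale) !nablaDr !nablaZr !csh_add !csh_scale.
by apply: (@g_inj _ _ _ g) => W; apply: smooth_funP => p; rewrite !gE !smoothE; ring.
Qed.

Lemma nablaA_linear_l f X Y Z : nablaA (f *: X + Y) Z = f *: nablaA X Z + nablaA Y Z.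
Proof.
rewrite !nablaAE !nablaDl !nablaZl !csh_add !csh_scale.
by apply: (@g_inj _ _ _ g) => W; apply: smooth_funP => p; rewrite !gE !smoothE; ring.
Qed.

Lemma nablaA_sym X Y Z p : g (nablaA X Y) Z p = g (nablaA X Z) Y p.
Proof.
have := ev_at p (congr1 X (csh_sym CS Y Z)); rewrite !(nabla_metric D) !nablaAE !gE !smoothE.
rewrite !(csh_sym CS) (gC g Y (A (D X Z))) (csh_sym CS) (gC g Y (D X (A Z))) => H; lra.
Qed.

Lemma nablaA_xi X i : nablaA X (x i) = (X h : C^oo M) *: x i + ph i (defect X).
Proof.
rewrite nablaAE (csh_xi CS) nablaZr (csh_nabla_xi CS) csh_opp (csh_phi CS) defectE endoD endoN endoZ opprK.
by rewrite scalerN addrCA addrC -!addrA; congr (_ + _); rewrite addrC.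
Qed.

Lemma nablaA_phi X Y i : nablaA X (ph i Y) =
  ph i (nablaA X Y) + g Y (x i) *: defect X + g (defect X) Y *: x i.
Proof.
rewrite !nablaAE (csh_phi CS) !(csh_nabla_phi CS) !(csh_add, csh_opp, csh_scale) (csh_phi CS) (csh_xi CS).
rewrite defectE endoD endoN (csh_sym CS Y) (csh_xi CS).
apply: (@g_inj _ _ _ g) => W; apply: smooth_funP => p; rewrite !gE !(csh_sym CS (A X) Y) !smoothE.
ring.
Qed.

Lemma defect_xi i : defect (x i) = 0.
Proof. by rewrite defectE !(csh_xi CS) csh_scale (csh_xi CS) subrr. Qed.

Lemma defect_linear f X Y : defect (f *: X + Y) = f *: defect X + defect Y.
Proof.
rewrite !defectE !(csh_add, csh_scale).
by apply: (@g_inj _ _ _ g) => W; apply: smooth_funP => p; rewrite !gE !smoothE; ring.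
Qed.

Lemma defect_sym X Y : g (defect X) Y = g X (defect Y).
Proof. by rewrite !defectE !gE !(csh_sym CS). Qed.

Lemma defect_phi X i : defect (ph i X) = ph i (defect X).
Proof. by rewrite !defectE !(csh_phi CS) endoD endoN endoZ. Qed.

Lemma g_defect_xi X i : g (defect X) (x i) = 0.
Proof. by rewrite defect_sym defect_xi g0r. Qed.

Lemma curvature_xi X Y i : Rm X Y (x i) =
  h *: (g Y (x i) *: A X - g X (x i) *: A Y) - ph i (nablaA X Y - nablaA Y X).
Proof.
rewrite /curvature !(csh_nabla_xi CS) !nablaNr !(csh_nabla_phi CS) !(lieE D) !nablaAE.
rewrite !(csh_sym CS _ (x i)) !(csh_xi CS) !(csh_add, csh_opp) !(endoD, endoN).
apply: (@g_inj _ _ _ g) => W; apply: smooth_funP => p; rewrite !gE !smoothE.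
rewrite (gC g (A Y) (A X)).
ring.
Qed.

(** The Bianchi identity paired with [x i]: skewness in the last two slots moves [x i] into the
    curvature, where [curvature_xi] applies. *)
Lemma nablaA_cyclic X Y Z i p :
  g (ph i (nablaA X Y)) Z p + g (ph i (nablaA Y Z)) X p + g (ph i (nablaA Z X)) Y p
  + g (defect X) Y p * g Z (x i) p + g (defect Y) Z p * g X (x i) p + g (defect Z) X p * g Y (x i) p = 0.
Proof.
have B : g (Rm X Y Z) (x i) p + g (Rm Y Z X) (x i) p + g (Rm Z X Y) (x i) p = 0.
  by rewrite -!smoothD -!gDl curvature_bianchi g0l.
rewrite (curvature_skew34 D X Y Z) (curvature_skew34 D Y Z X) (curvature_skew34 D Z X Y) in B.
rewrite !curvature_xi !(endoD, endoN) !gE !smoothE in B.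
have C (U V W : vf) : g (ph i (nablaA V U)) W p =
    - g (ph i (nablaA V W)) U p - g U (x i) p * g (defect V) W p - g (defect V) U p * g W (x i) p.
  have := nablaA_sym V W (ph i U) p; rewrite nablaA_phi !gE (gC g _ (ph i U)) g_phi_l.
  rewrite (gC g U) (gC g (x i) W) !smoothE => H; lra.
have ds U V : g (defect U) V p = g (defect V) U p by rewrite defect_sym gC.
rewrite (C X Y Z) (C Y Z X) (C Z X Y) in B.
have As U V : g (A U) V p = g (A V) U p by rewrite (csh_sym CS) gC.
rewrite (As Z X) (As Z Y) (As Y X) in B.
by rewrite (ds Z X) (ds Y Z) (ds X Y) (ds X Z) in B *; lra.
Qed.

(** [nablaA_cyclic] on [Y] and the two other $\xi$ expresses $dh$ through $\eta_{i+1}$ and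
    $\eta_{i+2}$. Hence $\xi_i h = 0$ for each [i], and no coefficient is left. *)
Lemma h_killed X : X h = 0.
Proof.
have main i Y : Y h = (x (i + 1) h : C^oo M) * g Y (x (i + 1)) + (x (i + 2) h : C^oo M) * g Y (x (i + 2)).
  apply: smooth_funP => p; have := nablaA_cyclic Y (x (i + 1)) (x (i + 2)) i p.
  have -> : g (ph i (nablaA Y (x (i + 1)))) (x (i + 2)) p = Y h p.
    by rewrite g_phi_l phi_ac gNr opprK nablaA_xi gDl gZl g_xi_xi g_phi_xi mulr1 addr0.
  have -> : g (ph i (nablaA (x (i + 1)) (x (i + 2)))) Y p = - (x (i + 1) h p * g Y (x (i + 1)) p).
    by rewrite nablaA_xi defect_xi endo0 addr0 endoZ phi_ac gZl gNl (gC g Y) !smoothE mulrN.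
  have -> : g (ph i (nablaA (x (i + 2)) Y)) (x (i + 1)) p = - (x (i + 2) h p * g Y (x (i + 2)) p).
    rewrite g_phi_l phi_ab !smoothN nablaA_sym nablaA_xi defect_xi endo0 addr0 gZl (gC g Y) smoothM.
    by [].
  rewrite g_defect_xi !defect_xi !g0l !smoothE => H; lra.
have kill i : x i h = 0.
  by rewrite (main i (x i)) xi_ab (gC g (x i)) xi_ca !mulr0 addr0.
by rewrite (main 0 X) !kill !mul0r addr0.
Qed.

Definition horizontal X := forall i, g X (x i) = 0.

Lemma phi_xi_span i j : exists k, ph i (x j) = x k \/ ph i (x j) = - x k \/ ph i (x j) = 0.
Proof.
case: (ord3_shift_cases i j) => ->.
- by exists i; right; right; exact: phi_xi.
- by exists (i + 2); left; exact: phi_ab.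
- by exists (i + 1); right; left; exact: phi_ac.
Qed.

Lemma horizontal_phi X i : horizontal X -> horizontal (ph i X).
Proof.
move=> hX j; rewrite g_phi_l; have [k [->|[->|->]]] := phi_xi_span i j.
- by rewrite hX oppr0.
- by rewrite gNr hX !oppr0.
- by rewrite g0r oppr0.
Qed.

Lemma horizontal_phi2 X i : horizontal X -> ph i (ph i X) = - X.
Proof. by move=> hX; rewrite phi2g hX scale0r addr0. Qed.

Lemma horizontal_defect X : horizontal (defect X).
Proof. by move=> i; rewrite g_defect_xi. Qed.

Section Horizontal.
Variable p : M.
Local Notation tau X Y Z := (g (nablaA X Y) Z p).

Lemma tau_phi X Y Z i : horizontal Y -> horizontal Z -> tau X (ph i Y) Z = - tau X Y (ph i Z).
Proof.
move=> hY hZ; rewrite nablaA_phi !gE g_phi_l hY (gC g (x i)) hZ !smoothE; ring.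
Qed.

Lemma tau_phi_phi X Y Z i : horizontal Y -> horizontal Z -> tau X (ph i Y) (ph i Z) = tau X Y Z.
Proof.
move=> hY hZ; rewrite tau_phi//; last exact: horizontal_phi.
by rewrite horizontal_phi2// gNr smoothN opprK.
Qed.

Lemma tau_cyclic X Y Z i : horizontal X -> horizontal Y -> horizontal Z ->
  tau X Y (ph i Z) + tau Y Z (ph i X) + tau Z X (ph i Y) = 0.
Proof.
move=> hX hY hZ; have := nablaA_cyclic X Y Z i p.
rewrite !g_phi_l !smoothN hX hY hZ !smooth0 => H; lra.
Qed.

Lemma tau_shift X Y Z i : horizontal X -> horizontal Y -> horizontal Z ->
  tau (ph i Z) X (ph i Y) = tau X Y Z - tau Y X Z.
Proof.
move=> hX hY hZ; have := tau_cyclic i hX hY (horizontal_phi i hZ).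
rewrite horizontal_phi2// gNr smoothN (tau_phi_phi Y i hZ hX) (nablaA_sym Y Z) => H; lra.
Qed.

(* Each of the three hyperhermitian symmetries gives [tau_shift]; composing two
   of them and comparing with the third gives [a = b + c], where [a], [b], [c]
   are the cyclic permutations of [tau X Y Z]. *)
Lemma tau_horizontal X Y Z : horizontal X -> horizontal Y -> horizontal Z -> tau X Y Z = 0.
Proof.
have key (U V W : vf) : horizontal U -> horizontal V -> horizontal W ->
    tau U V W = tau V U W + tau W U V.
  move=> hU hV hW; pose j : 'I_3 := 0 + 1; pose k : 'I_3 := 0 + 2.
  have E L : horizontal L -> ph k L = ph 0 (ph j L).
    by move=> hL; rewrite (triple_phi (T 0)) hL scale0r subr0.
  have := tau_shift k hU hV hW; rewrite !E//.
  rewrite (tau_shift 0 hU (horizontal_phi j hV) (horizontal_phi j hW)).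
  rewrite tau_phi_phi// (tau_shift j hU hW hV) (nablaA_sym U W) => H; lra.
move=> hX hY hZ; have := key _ _ _ hX hY hZ; have := key _ _ _ hY hZ hX; have := key _ _ _ hZ hX hY.
rewrite (nablaA_sym Y X) (nablaA_sym X Z) (nablaA_sym Z Y) => *; lra.
Qed.

(** In [nablaA_cyclic] with [x i] in the third slot the two [defect] terms cancel by symmetry,
    leaving [nablaA (x i) X] paired with $\phi_i V$; every horizontal field is such an image up to
    sign. *)
Lemma nablaA_xi_horizontal i X Y : horizontal X -> horizontal Y -> tau (x i) X Y = 0.
Proof.
move=> hX hY; have key V : horizontal V -> tau (x i) X (ph i V) = 0.
  move=> hV; have := nablaA_cyclic X V (x i) i p.
  rewrite g_phi_xi nablaA_xi h_killed scale0r (add0r (ph i (defect V))) defect_xi g0l hX hV g_xi_xi.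
  rewrite (phi2g (S i) (defect V)) g_defect_xi scale0r addr0 (g_phi_l (S i) (nablaA (x i) X)).
  rewrite gNl (defect_sym V) (gC g V) !smoothE => H; lra.
have := key _ (horizontal_phi i hY); rewrite horizontal_phi2// gNr smoothN => H; lra.
Qed.

End Horizontal.

(** Bianchi for $X, Z, \xi_a$, paired with $\xi_b$: with $t = g(\phi_c\,\mathrm{defect}\,X, Z)$ the
    three terms are $2t$, $t$, $t$. Then $t = 0$ is used at $Z = \phi_c\,\mathrm{defect}\,X$. *)
Lemma defect_horizontal X : horizontal X -> defect X = 0.
Proof.
move=> hX; pose a : 'I_3 := 0; pose b := a + 1; pose c := a + 2.
have R1 (Y : vf) (p : M) : horizontal Y -> g (Rm X Y (x a)) (x b) p = 2 * g (ph c (defect X)) Y p.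
  move=> hY; rewrite curvature_xi !hX !hY !scale0r addrN scaler0 sub0r gNl g_phi_l phi_ab opprK.
  rewrite gDl gNl smoothD smoothN !(nablaA_sym _ _ (x c)) !nablaA_xi !h_killed !scale0r !add0r.
  rewrite (g_phi_l (S c) (defect Y)) defect_sym defect_phi (gC g Y) !smoothN; ring.
have R2 (U V : vf) (p : M) : horizontal U -> horizontal V ->
    g (Rm U (x a) (x b)) V p = g (ph c (defect U)) V p.
  move=> hU hV; rewrite curvature_xi xi_ab hU !scale0r addrN scaler0 sub0r gNl.
  rewrite endoD endoN nablaA_xi h_killed scale0r add0r gDl gNl !smoothE.
  rewrite (g_phi_l (S b) (nablaA (x a) U)) smoothN nablaA_xi_horizontal//; last exact: horizontal_phi.
  by rewrite (triple_phi' (T a)) gDl gNl gZl g_defect_xi mul0r addr0 !smoothE; ring.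
apply: (@g_eq0 _ _ _ g); apply: smooth_funP => p.
suff key (Z : vf) : horizontal Z -> g (ph c (defect X)) Z p = 0.
  by have := key _ (horizontal_phi c (horizontal_defect X)); rewrite g_phi_phi g_defect_xi mulr0 subr0.
move=> hZ.
have B : g (Rm X Z (x a)) (x b) p + g (Rm Z (x a) X) (x b) p + g (Rm (x a) X Z) (x b) p = 0.
  by rewrite -!smoothD -!gDl curvature_bianchi g0l.
have C : g (Rm (x a) X Z) (x b) p = g (Rm X (x a) (x b)) Z p.
  by rewrite curvature_skew12 gNl smoothN curvature_skew34 opprK.
have E : g (ph c (defect Z)) X p = - g (ph c (defect X)) Z p.
  by rewrite g_phi_l defect_sym defect_phi (gC g Z) smoothN.
rewrite R1// C R2// (curvature_skew34 D Z) R2// E in B; lra.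
Qed.

Definition hproj X := X - \sum_i g X (x i) *: x i.

Lemma hproj_horizontal X : horizontal (hproj X).
Proof.
move=> j; rewrite /hproj gDl gNl; apply/eqP; rewrite subr_eq0; apply/eqP.
apply: smooth_funP => p; rewrite (tensorial_sum (tensorial_g g (x j))).
rewrite (bigD1 j) //= xi_orthonormal eqxx big1 => [|i ij]; last first.
  by rewrite xi_orthonormal (negbTE ij) mulr0.
by rewrite addr0 smooth1 mulr1.
Qed.

Lemma tensorial_hproj (L : vf -> C^oo M) X p : tensorial L ->
  L X p = L (hproj X) p + \sum_i g X (x i) p * L (x i) p.
Proof.
move=> LT; rewrite -(tensorial_sum LT) -smoothD -(tensorialD LT); congr (L _ p).
by rewrite /hproj subrK.
Qed.

Lemma defect0 X : defect X = 0.
Proof.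
apply: (@g_inj _ _ _ g) => Y; apply: smooth_funP => p; rewrite g0l.
rewrite (@tensorial_hproj (fun U => g (defect U) Y)) => [|f U V]; last by rewrite defect_linear gDl gZl.
rewrite defect_horizontal ?g0l; last exact: hproj_horizontal.
by rewrite big1 ?addr0// => i _; rewrite defect_xi g0l mulr0.
Qed.

Lemma shape_square X : A (A X) = h *: A X.
Proof. by have := defect0 X; rewrite defectE => /eqP; rewrite subr_eq0 => /eqP. Qed.

Lemma nablaA0 X Y : nablaA X Y = 0.
Proof.
have xi0 U i : nablaA U (x i) = 0 by rewrite nablaA_xi h_killed scale0r defect0 endo0 addr0.
apply: (@g_inj _ _ _ g) => Z; apply: smooth_funP => p; rewrite g0l.
rewrite (@tensorial_hproj (fun V => g (nablaA X V) Z)) => [|f U V]; last by rewrite nablaA_linear_r gDl gZl.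
rewrite [X in _ + X]big1 ?addr0 => [|i _]; last by rewrite xi0 g0l mulr0.
rewrite nablaA_sym (@tensorial_hproj (fun V => g (nablaA X V) (hproj Y))) => [|f U V]; last by rewrite nablaA_linear_r gDl gZl.
rewrite [X in _ + X]big1 ?addr0 => [|i _]; last by rewrite xi0 g0l mulr0.
rewrite (@tensorial_hproj (fun V => g (nablaA V (hproj Z)) (hproj Y))) => [|f U V]; last by rewrite nablaA_linear_l gDl gZl.
rewrite big1 => [|i _]; last by rewrite nablaA_xi_horizontal ?mulr0//; exact: hproj_horizontal.
by rewrite addr0 tau_horizontal//; exact: hproj_horizontal.
Qed.

Lemma curvature_xiE X Y i : Rm X Y (x i) = h *: (g Y (x i) *: A X - g X (x i) *: A Y).
Proof. by rewrite curvature_xi !nablaA0 subrr endo0 subr0. Qed.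

Lemma nabla_shape X Y : D X (A Y) = A (D X Y).
Proof. by have := nablaA0 X Y; rewrite nablaAE => /eqP; rewrite subr_eq0 => /eqP. Qed.

(** The Ricci identity for $\phi_i$: second derivatives of $\phi_i$ involve only [A]
    undifferentiated, since [A] is parallel. *)
Lemma curvature_phi X Y Z i : Rm X Y (ph i Z) = ph i (Rm X Y Z)
  - g (A Y) Z *: ph i (A X) + g (ph i (A X)) Z *: A Y
  + g (A X) Z *: ph i (A Y) - g (ph i (A Y)) Z *: A X.
Proof.
have N U V W : D U (g (A V) W *: x i) = (g (A (D U V)) W + g (A V) (D U W)) *: x i - g (A V) W *: ph i (A U).
  rewrite nablaZr (csh_nabla_xi CS) (nabla_metric D) nabla_shape scalerN; congr (_ *: _ - _).
have N2 U V W : D U (g W (x i) *: A V) = (g (D U W) (x i) - g W (ph i (A U))) *: A V + g W (x i) *: A (D U V).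
  by rewrite nablaZr nabla_shape (nabla_metric D) (csh_nabla_xi CS) gNr.
rewrite /curvature !(csh_nabla_phi CS) !nablaDr !nablaNr !(csh_nabla_phi CS) !N !N2 (lieE D).
rewrite !(csh_add, csh_opp) !nablaDl !nablaNl !endoD !endoN.
apply: (@g_inj _ _ _ g) => W; apply: smooth_funP => p; rewrite !gE !smoothE.
rewrite !(g_phi_l (S i) (A _) Z) (gC g Z (ph i (A X))) (gC g Z (ph i (A Y))).
rewrite (g_phi_l (S i) (A X) Z) (g_phi_l (S i) (A Y) Z) !(endoD, endoN) !gE !smoothE.
ring.
Qed.
End CommonGeometry.

(** * The Ricci tensor *)

Section FrameTraces.
Variables (R : realType) (m : nat) (M : manifold R m) (g : metric M).
Variables (p : M) (E : 'I_m -> vfield M).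
Hypothesis EO : orthonormal_at g p E.
Local Notation vf := (vfield M).
Implicit Types (X Y Z W U V : vf).

Lemma parseval_g X Y : g X Y p = \sum_k g X (E k) p * g Y (E k) p.
Proof.
rewrite (parseval EO (tensorial_g g Y)); apply: eq_bigr => k _.
by rewrite (gC g (E k)).
Qed.

(** At [p] one has $\sum_k \phi E_k\otimes\phi E_k = \sum_k E_k\otimes E_k - \xi\otimes\xi$, because
    $\phi$ kills $\xi$ and is isometric on its complement. *)
Lemma trace_phi (x : almost_contact g) (B : vf -> vf -> C^oo M) :
  (forall U, tensorial (B U)) -> (forall V, tensorial (B ^~ V)) ->
  \sum_k B (phv x (E k)) (phv x (E k)) p =
  \sum_k B (E k) (E k) p - B (xi x) (xi x) p.
Proof.
move=> Br Bl.
have expand X : B X X p = \sum_k \sum_l (g X (E k) p * g X (E l) p) * B (E k) (E l) p.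
  rewrite (parseval EO (Bl X)); apply: eq_bigr => k _.
  rewrite (parseval EO (Br (E k))) mulr_sumr; apply: eq_bigr => l _.
  by rewrite mulrA.
rewrite [B (xi x) (xi x) p]expand; under eq_bigr => k _ do rewrite expand.
rewrite exchange_big -sumrB; apply: eq_bigr => k _.
rewrite exchange_big /=.
transitivity (\sum_l (g (phv x (E k)) (phv x (E l)) p * B (E k) (E l) p)).
  apply: eq_bigr => l _; rewrite -mulr_suml; congr (_ * _).
  rewrite parseval_g; apply: eq_bigr => j _.
  by rewrite !g_phi_l (gC g (E j) (phv x _)) (gC g (E j) (phv x (E l))) !g_phi_l !smoothN; ring.
transitivity (\sum_l ((k == l)%:R * B (E k) (E l) p
    - g (E k) (xi x) p * g (E l) (xi x) p * B (E k) (E l) p)).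
  by apply: eq_bigr => l _; rewrite g_phi_phi smoothD smoothN smoothM EO mulrBl.
rewrite sumrB; congr (_ - _); last first.
  by apply: eq_bigr => l _; rewrite (gC g (E k)) (gC g (E l)).
rewrite (bigD1 k) //= eqxx mul1r big1 ?addr0// => l lk.
by rewrite eq_sym (negbTE lk) mul0r.
Qed.
End FrameTraces.

Section Ricci.
Variables (R : realType) (m : nat) (M : manifold R m) (g : metric M) (D : levi_civita g).
Variables (S : 'I_3 -> almost_contact g).
Hypothesis T : forall i, contact_triple (S i) (S (i + 1)) (S (i + 2)).
Variables (A : vfield M -> vfield M) (h : C^oo M).
Hypothesis CS : common_shape D S A h.
Local Notation vf := (vfield M).
Implicit Types (X Y Z W U V : vf) (f : C^oo M) (p : M) (i j : 'I_3).
Local Notation ph i := (phv (S i)).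
Local Notation x i := (xi (S i)).
Local Notation Rm := (curvature D).

Let sA X Y : g (A X) Y = g (A Y) X.
Proof. by rewrite (csh_sym CS) gC. Qed.

(* What is left of the curvature tensor once the part determined by the
   structure vector fields is removed: it behaves like the curvature tensor of
   a hyper-Kähler manifold, hence is Ricci-flat. *)
Definition flat_part X Y Z :=
  locked (Rm X Y Z - (g (A Y) Z *: A X - g (A X) Z *: A Y)).
Local Notation K := flat_part.

Lemma flat_partE X Y Z : K X Y Z = Rm X Y Z - (g (A Y) Z *: A X - g (A X) Z *: A Y).
Proof. by rewrite /flat_part -lock. Qed.

Lemma g_flat X Y Z W : g (K X Y Z) W =
  g (Rm X Y Z) W - (g (A Y) Z * g (A X) W - g (A X) Z * g (A Y) W).
Proof. by rewrite flat_partE; move: (Rm X Y Z) => U; rewrite !gE. Qed.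

Lemma flat_skew12 X Y Z W p : g (K X Y Z) W p = - g (K Y X Z) W p.
Proof. by rewrite !g_flat {1}curvature_skew12 gNl !smoothE; ring. Qed.

Lemma flat_skew34 X Y Z W p : g (K X Y Z) W p = - g (K X Y W) Z p.
Proof. by rewrite !g_flat !smoothE {1}curvature_skew34; ring. Qed.

Lemma flat_pair X Y Z W p : g (K X Y Z) W p = g (K Z W X) Y p.
Proof.
rewrite !g_flat !smoothE {1}curvature_pair (sA W X) (sA Z Y) (sA Z X) (sA W Y); ring.
Qed.

Lemma flat_bianchi X Y Z W p :
  g (K X Y Z) W p + g (K Y Z X) W p + g (K Z X Y) W p = 0.
Proof.
have B : g (Rm X Y Z) W p + g (Rm Y Z X) W p + g (Rm Z X Y) W p = 0.
  by rewrite -!smoothD -!gDl curvature_bianchi g0l.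
rewrite !g_flat !smoothE (sA Z X) (sA Z Y) (sA Y X); lra.
Qed.

Lemma flat_xi X Y i : K X Y (x i) = 0.
Proof.
rewrite flat_partE (curvature_xiE T CS) !(csh_sym CS _ (x i)) (csh_xi CS).
apply: (@g_inj _ _ _ g) => W; apply: smooth_funP => p; rewrite !gE !smoothE.
by ring.
Qed.

Lemma flat_phi X Y Z i : K X Y (ph i Z) = ph i (K X Y Z).
Proof.
rewrite !flat_partE (curvature_phi T CS) !(endoD, endoN, endoZ).
apply: (@g_inj _ _ _ g) => W; apply: smooth_funP => p; rewrite !gE.
rewrite !(g_phi_l (S i) (A _) Z) !smoothE; ring.
Qed.

Lemma flat_phi12 X Y Z W i p : g (K X (ph i Y) Z) W p = - g (K (ph i X) Y Z) W p.
Proof.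
by rewrite flat_pair [in RHS]flat_pair flat_phi g_phi_l smoothN opprK.
Qed.

Lemma flat_linear1 f X X' Y Z : K (f *: X + X') Y Z = f *: K X Y Z + K X' Y Z.
Proof.
rewrite !flat_partE curvature_linear1 (csh_linear CS).
by apply: (@g_inj _ _ _ g) => W; apply: smooth_funP => p; rewrite !gE !smoothE; ring.
Qed.

Lemma flat_linear3 f X Y Z Z' : K X Y (f *: Z + Z') = f *: K X Y Z + K X Y Z'.
Proof.
apply: (@g_inj _ _ _ g) => W; apply: smooth_funP => p.
rewrite flat_pair flat_linear1 !gDl !gZl !smoothE; congr (_ * _ + _); exact: flat_pair.
Qed.

Section At.
Variables (p : M) (E : 'I_m -> vf).
Hypothesis EO : orthonormal_at g p E.

Definition flat_ricci X Y := \sum_k g (K (E k) X Y) (E k) p.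
Local Notation t := flat_ricci.

Lemma flat_ricci_phi_phi X Y i : t (ph i X) (ph i Y) = t X Y.
Proof.
have H : \sum_k g (K (ph i (E k)) X Y) (ph i (E k)) p = t X Y - g (K (x i) X Y) (x i) p.
  apply: (trace_phi EO (S i) (B := fun U V => g (K U X Y) V)).
    by move=> U f V W; rewrite gDr gZr.
  by move=> V f U W; rewrite flat_linear1 gDl gZl.
have z : g (K (x i) X Y) (x i) p = 0 by rewrite flat_skew34 flat_xi g0l smooth0 oppr0.
rewrite z subr0 in H; rewrite -H; apply: eq_bigr => k _.
by rewrite flat_phi g_phi_l smoothN flat_phi12 opprK.
Qed.

Lemma flat_ricci_xi X i : t X (x i) = 0.
Proof. by apply: big1 => k _; rewrite flat_xi g0l. Qed.

Lemma flat_ricci_sym X Y : t X Y = t Y X.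
Proof.
apply: eq_bigr => k _.
by rewrite flat_pair flat_skew12 flat_skew34 opprK.
Qed.

Lemma flat_ricci_linear f X Y Z : t X (f *: Y + Z) = f p * t X Y + t X Z.
Proof.
rewrite /t mulr_sumr -big_split; apply: eq_bigr => k _ /=.
by rewrite flat_linear3 gDl gZl.
Qed.

Lemma flat_ricci_phi2 X Y i : t X (ph i (ph i Y)) = - t X Y.
Proof.
rewrite phi2g addrC flat_ricci_linear flat_ricci_xi mulr0 add0r -scaleN1r -[_ *: Y]addr0.
rewrite flat_ricci_linear (_ : t X 0 = 0) ?addr0 ?mulN1r//.
by have := flat_ricci_linear (-1) X (x i) (x i); rewrite scaleN1r addNr flat_ricci_xi mulr0 addr0.
Qed.

(** As on a Kahler manifold, the Bianchi identity identifies the Ricci form with the Ricci tensor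
    twisted by $\phi_i$. *)
Lemma flat_rho X Y i : \sum_k g (K X Y (E k)) (ph i (E k)) p = 2 * t X (ph i Y).
Proof.
have -> : \sum_k g (K X Y (E k)) (ph i (E k)) p = t X (ph i Y) - t Y (ph i X).
  rewrite -sumrB; apply: eq_bigr => k _.
  have := flat_bianchi X Y (E k) (ph i (E k)) p.
  rewrite (flat_skew12 Y) !flat_phi !g_phi_l !smoothN => H; lra.
by rewrite -(flat_ricci_phi_phi Y (ph i X) i) flat_ricci_phi2 flat_ricci_sym; ring.
Qed.

(** Replacing the frame by its image under $\phi_b$ preserves the trace by [trace_phi]. It also
    changes its sign, as $\phi_b$ commutes with [K X Y] and anticommutes with $\phi_i$ up to
    multiples of the $\xi$, which [K] kills. *)
Lemma flat_rho0 X Y i : \sum_k g (K X Y (E k)) (ph i (E k)) p = 0.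
Proof.
set rho := LHS; pose b := i + 1; pose c := i + 2.
have H : \sum_k g (K X Y (ph b (E k))) (ph i (ph b (E k))) p =
    rho - g (K X Y (x b)) (ph i (x b)) p.
  apply: (trace_phi EO (S b) (B := fun U V => g (K X Y U) (ph i V))).
    by move=> U f V W; rewrite endoD endoZ gDr gZr.
  by move=> V f U W; rewrite flat_linear3 gDl gZl.
rewrite flat_xi g0l smooth0 subr0 in H.
have : \sum_k g (K X Y (ph b (E k))) (ph i (ph b (E k))) p = - rho.
  rewrite /rho -sumrN; apply: eq_bigr => k _.
  have -> : ph i (ph b (E k)) = - ph b (ph i (E k)) + g (E k) (x i) *: x b + g (E k) (x b) *: x i.
    have := triple_phi (T i) (E k); rewrite (triple_phi' (T i)) => /esym/eqP.
    by rewrite subr_eq => /eqP.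
  have z j U : g (K X Y U) (x j) = 0.
    by apply: smooth_funP => q; rewrite flat_skew34 flat_xi g0l smooth0 oppr0.
  rewrite flat_phi !gE g_phi_phi !g_phi_l phi_xi g0r !z -/b.
  have -> : ph b (x i) = - x c by have := triple_xi' (T i); rewrite -/b -/c => ->; rewrite opprK.
  by rewrite gNr z !smoothE; ring.
by rewrite H => ?; lra.
Qed.

Lemma flat_ricci0 X Y : t X Y = 0.
Proof.
have E0 U V : t U (ph 0 V) = 0 by have := flat_rho U V 0; rewrite flat_rho0 => H; lra.
by have := flat_ricci_phi2 X Y 0; rewrite E0 => H; lra.
Qed.
End At.

Definition shape_trace p := \sum_k g (A (frame_at g p k)) (frame_at g p k) p.

(** The Gauss term contracts to $(\mathrm{tr} A)\,g(AX,Y) - g(AX,AY)$, and $A^2 = hA$ turns the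
    second summand into $h\,g(AX,Y)$. *)
Lemma ricciE X Y p : ricci D X Y p = (shape_trace p - h p) * g (A X) Y p.
Proof.
have EO := frame_at_orthonormal g p; rewrite /ricci /shape_trace; set E := frame_at g p in EO *.
rewrite mulrBl.
have -> : h p * g (A X) Y p = \sum_k g (A X) (E k) p * g (A Y) (E k) p.
  by rewrite -parseval_g// -(csh_sym CS (A X)) (shape_square T CS) gZl.
rewrite (_ : _ * _ - _ = \sum_k (g (A (E k)) (E k) p * g (A X) Y p - g (A X) (E k) p * g (A Y) (E k) p)); last first.
  by rewrite sumrB mulr_suml.
have := flat_ricci0 EO X Y; rewrite /flat_ricci => H.
apply/subr0_eq; rewrite -sumrB -[RHS]H; apply: eq_bigr => k _.
rewrite g_flat !smoothE (sA (E k) Y); ring.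
Qed.
End Ricci.

(** * Rank *)

Section Pfaffian.
Variable R : realType.
Implicit Types (b : 'I_4 -> 'I_4 -> R).

Local Notation i0 := (0 : 'I_4).
Local Notation i1 := (1 : 'I_4).
Local Notation i2 := (2 : 'I_4).
Local Notation i3 := (3 : 'I_4).

(** The last three indices are permuted cyclically, so all signs are positive. *)
Definition pfaffian b := b i0 i1 * b i2 i3 + b i0 i2 * b i3 i1 + b i0 i3 * b i1 i2.

Lemma ord4_cases (i : 'I_4) : [\/ i = i0, i = i1, i = i2 | i = i3].
Proof.
by case: i => -[|[|[|[|//]]]] ?; [apply: Or41|apply: Or42|apply: Or43|apply: Or44]; apply: val_inj.
Qed.

Lemma pfaffian_tperm b (i j : 'I_4) : (forall k l, b k l = - b l k) -> i != j ->
  pfaffian (fun k l => b (tperm i j k) (tperm i j l)) = - pfaffian b.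
Proof.
move=> sb ij; rewrite /pfaffian.
have s10 := sb i1 i0; have s20 := sb i2 i0; have s30 := sb i3 i0.
have s21 := sb i2 i1; have s31 := sb i3 i1; have s32 := sb i3 i2.
case: (ord4_cases i) ij => ->; case: (ord4_cases j) => -> // _;
  rewrite ?(tpermL, tpermR) ?tpermD// ?s10 ?s20 ?s30 ?s21 ?s31 ?s32; ring.
Qed.

Lemma pfaffian_perm b (s : 'S_4) : (forall k l, b k l = - b l k) ->
  pfaffian (fun k l => b (s k) (s l)) = (-1) ^+ odd_perm s * pfaffian b.
Proof.
have [ts -> dts] := prod_tpermP s.
elim: ts dts b => [_|t ts IHt /= /andP[dt dts]] b sb.
  by rewrite big_nil odd_perm1 mul1r /pfaffian !perm1.
rewrite big_cons odd_mul_tperm; set u := (\prod_(_ <- ts) _)%g in IHt *.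
transitivity (- pfaffian (fun k l => b (u k) (u l))).
  by rewrite -(pfaffian_tperm (i := t.1) (j := t.2))// /pfaffian !permM.
by rewrite (IHt dts b sb) dt signr_addb expr1 mulN1r mulNr.
Qed.

(* Averaging over the cyclic permutations of the last three indices. *)
Lemma alternate_square b : (forall k l, b k l = - b l k) ->
  \sum_(s : 'S_4) (-1) ^+ odd_perm s * (b (s i0) (s i1) * b (s i2) (s i3)) = 8 * pfaffian b.
Proof.
move=> sb; pose F (s : 'S_4) := (-1) ^+ odd_perm s * (b (s i0) (s i1) * b (s i2) (s i3)).
have [r [[r0 r1 r2 r3] re]] : exists r : 'S_4,
    [/\ r i0 = i0, r i1 = i2, r i2 = i3 & r i3 = i1] /\
    forall s, odd_perm (r * s)%g = odd_perm s.
  exists (tperm i1 i2 * tperm i1 i3)%g; split; last by move=> s; rewrite !odd_permM !odd_tperm.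
  split; rewrite permM; [by rewrite !tpermD|by rewrite tpermL tpermD|by rewrite tpermR tpermL|].
  by rewrite (tpermD (x := i1) (y := i2))// tpermR.
have shift : \sum_s F (r * s)%g = \sum_s F s by rewrite [RHS](reindex_inj (mulgI r)).
have shift2 : \sum_s F (r * (r * s))%g = \sum_s F s.
  by rewrite [RHS](reindex_inj (mulgI r)) [RHS](reindex_inj (mulgI r)).
have : \sum_s (F s + F (r * s)%g + F (r * (r * s))%g) = 24 * pfaffian b.
  rewrite (eq_bigr (fun=> pfaffian b)) => [|s _].
    by rewrite sumr_const card_Sn mulr_natl.
  rewrite /F !re !permM !(r0, r1, r2, r3) -!mulrDr.
  have -> : b (s i0) (s i1) * b (s i2) (s i3) + b (s i0) (s i2) * b (s i3) (s i1)
      + b (s i0) (s i3) * b (s i1) (s i2) = pfaffian (fun k l => b (s k) (s l)) by [].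
  by rewrite pfaffian_perm// mulrA -signr_addb addbb mul1r.
rewrite !big_split /= shift shift2 => H.
change (\sum_s F s = 8 * pfaffian b); lra.
Qed.
End Pfaffian.

Section Wedge.
Variables (R : realType) (m : nat) (M : manifold R m).
Local Notation vf := (vfield M).
Implicit Types (X Y : vf) (p : M).

Lemma wedge_at k l (a : kform M k) (b : kform M l) V p : wedge a b V p =
  ((k + l)`!%:R)^-1 * \sum_(s : 'S_(k + l)) (-1) ^+ odd_perm s *
    (a (fun i => V (s (lshift l i))) p * b (fun j => V (s (rshift k j))) p).
Proof.
rewrite /wedge smoothZ smooth_sumE; congr (_ * _); apply: eq_bigr => s _.
by rewrite smoothM smoothM; case: (odd_perm s).
Qed.

Lemma wedge_vanish k l (a : kform M k) (b : kform M l) p :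
  (forall V, b V p = 0) -> forall V, wedge a b V p = 0.
Proof.
by move=> b0 V; rewrite wedge_at big1 ?mulr0// => s _; rewrite b0 !mulr0.
Qed.

Lemma wedge_exp_vanish (a : kform M 2) p q r : (q <= r)%N ->
  (forall V, @wedge_exp _ _ _ a q V p = 0) -> forall V, @wedge_exp _ _ _ a r V p = 0.
Proof.
move=> /subnK <- H; elim: (r - q)%N => [//|k IHk] V.
exact: (@wedge_vanish 2 ((k + q) * 2) a (@wedge_exp _ _ _ a (k + q)) p IHk V).
Qed.

Variable a : vf -> vf -> C^oo M.
Hypothesis ska : forall X Y, a X Y = - a Y X.

Lemma wedge_exp1 (V : 'I_2 -> vf) p : @wedge_exp _ _ _ (form2 a) 1 V p = a (V 0) (V 1) p.
Proof.
change (@wedge _ _ _ 2 0 (form2 a) (fun=> 1) V p = a (V 0) (V 1) p).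
rewrite wedge_at (eq_bigr (fun=> a (V 0) (V 1) p)) => [|s _].
  by rewrite sumr_const card_Sn -[X in _ * X]mulr_natl mulrA mulVf ?mul1r// pnatr_eq0.
rewrite smooth1 mulr1 /form2.
have -> : @lshift 2 0 ord0 = 0 :> 'I_2 by apply: val_inj.
have -> : @lshift 2 0 ord_max = 1 :> 'I_2 by apply: val_inj.
have [-> | ->] : s = 1%g \/ s = tperm 0 1.
  have c2 (i : 'I_2) : i = 0 \/ i = 1.
    by case: i => -[|[|//]] ?; [left|right]; apply: val_inj.
  have n01 : (0 : 'I_2) != 1 by [].
  case: (c2 (s 0)) => s0; [left|right]; apply/permP => i; case: (c2 i) => ->;
    rewrite ?perm1 ?tpermL ?tpermR ?s0//; case: (c2 (s 1)) => s1 //;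
    by move: n01; rewrite -(inj_eq (@perm_inj _ s)) s0 s1 eqxx.
- by rewrite odd_perm1 !perm1 expr0 mul1r.
- by rewrite odd_tperm tpermL tpermR expr1 mulN1r ska smoothN opprK.
Qed.

(** The constant is $8/4!$: [alternate_square] gives 8 Pfaffians, and the wedge divides by $4!$. *)
Lemma wedge_exp2 (V : 'I_4 -> vf) p : @wedge_exp _ _ _ (form2 a) 2 V p =
  3^-1 * pfaffian (fun i j => a (V i) (V j) p).
Proof.
change (@wedge _ _ _ 2 2 (form2 a) (@wedge_exp _ _ _ (form2 a) 1) V p =
  3^-1 * pfaffian (fun i j => a (V i) (V j) p)).
rewrite wedge_at; under eq_bigr => s _ do rewrite wedge_exp1.
have := alternate_square (b := fun i j => a (V i) (V j) p); rewrite /form2.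
have -> : @lshift 2 2 ord0 = 0 :> 'I_4 by apply: val_inj.
have -> : @lshift 2 2 ord_max = 1 :> 'I_4 by apply: val_inj.
have -> : @rshift 2 2 0 = 2 :> 'I_4 by apply: val_inj.
have -> : @rshift 2 2 1 = 3 :> 'I_4 by apply: val_inj.
move=> ->; last by move=> k l; rewrite ska smoothN.
rewrite mulrA; congr (_ * _).
by rewrite (_ : (2 + 2)`! = 24)//; lra.
Qed.
End Wedge.

Section ShapeConsequences.
Variables (R : realType) (m : nat) (M : manifold R m) (g : metric M) (D : levi_civita g).
Variables (S : 'I_3 -> almost_contact g).
Hypothesis T : forall i, contact_triple (S i) (S (i + 1)) (S (i + 2)).
Variables (A : vfield M -> vfield M) (h : C^oo M).
Hypothesis CS : common_shape D S A h.
Local Notation vf := (vfield M).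
Implicit Types (X Y Z W U V : vf) (f : C^oo M) (p : M) (i j : 'I_3).
Local Notation ph i := (phv (S i)).
Local Notation x i := (xi (S i)).
Local Notation hor := (horizontal S).
Local Notation hp := (hproj S).

(** $\phi_i A$ is skew, so two equal terms arise and cancel the factor $1/2$ of the convention. *)
Lemma ext_d1_eta i X Y : ext_d1 (eta (S i)) X Y = - g (ph i (A X)) Y.
Proof.
apply: smooth_funP => p.
rewrite /ext_d1 !eta_g !(nabla_metric D) (lieE D) !(csh_nabla_xi CS) !gE !smoothE.
have -> : g X (ph i (A Y)) p = - g (ph i (A X)) Y p.
  by rewrite gC g_phi_l (csh_sym CS) (csh_phi CS) smoothN gC.
by rewrite (gC g Y); lra.
Qed.

Lemma ext_d1_eta_skew i X Y : ext_d1 (eta (S i)) X Y = - ext_d1 (eta (S i)) Y X.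
Proof.
by rewrite !ext_d1_eta opprK g_phi_l (csh_sym CS) (csh_phi CS) gC opprK.
Qed.

(** $|AX|^2 = g(X, A^2X) = h\,g(X, AX)$. *)
Lemma shape_eq0 X : h = 0 -> A X = 0.
Proof.
by move=> h0; apply: (@g_eq0 _ _ _ g); rewrite (csh_sym CS) (shape_square T CS) h0 scale0r g0r.
Qed.

Lemma shape_horizontal X : hor X -> hor (A X).
Proof. by move=> hX i; rewrite (csh_sym CS) (csh_xi CS) gZr hX mulr0. Qed.

Lemma shape_split X Y p :
  g (A X) Y p = g (A (hp X)) Y p + h p * \sum_i g X (x i) p * g (x i) Y p.
Proof.
have LT : tensorial (fun U => g (A U) Y) by move=> f U V; rewrite (csh_linear CS) gDl gZl.
rewrite (tensorial_hproj S X p LT); congr (_ + _).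
rewrite mulr_sumr; apply: eq_bigr => i _.
by rewrite (csh_xi CS) gZl smoothM mulrCA.
Qed.

Section Trace.
Variables (p : M) (E : 'I_m -> vf).
Hypothesis EO : orthonormal_at g p E.

Lemma trace_horizontal (L : vf -> vf) (c : C^oo M) :
  (forall f X Y, L (f *: X + Y) = f *: L X + L Y) ->
  (forall X Y, g (L X) Y = g X (L Y)) -> (forall i, L (x i) = c *: x i) ->
  \sum_k g (L (E k)) (E k) p = c p * 3 + \sum_k g (L (hp (E k))) (hp (E k)) p.
Proof.
move=> Ll Ls Lx.
have step k : g (L (E k)) (E k) p =
    c p * (\sum_i g (E k) (x i) p * g (E k) (x i) p) + g (L (hp (E k))) (hp (E k)) p.
  have LT : tensorial (fun U => g (L U) (E k)) by move=> f U V; rewrite Ll gDl gZl.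
  rewrite (tensorial_hproj S (E k) p LT) addrC; congr (_ + _).
    rewrite mulr_sumr; apply: eq_bigr => i _.
    by rewrite Lx gZl smoothM (gC g (x i)) mulrCA.
  rewrite (gC g _ (E k)) (tensorial_hproj S (E k) p (tensorial_g g _)).
  rewrite big1 ?addr0 1?gC// => i _.
  by rewrite -Ls Lx gZl (gC g (x i)) (hproj_horizontal T) mulr0 smooth0 mulr0.
rewrite (eq_bigr _ (fun k _ => step k)) big_split /= -mulr_sumr exchange_big /=.
congr (_ * _ + _).
rewrite (eq_bigr (fun=> 1)) => [|i _]; last first.
  transitivity (g (x i) (x i) p); last by rewrite g_xi_xi.
  by rewrite (parseval_g EO); apply: eq_bigr => k _; rewrite (gC g (x i)).
by rewrite sumr_const card_ord.
Qed.

Lemma shape_trace_horizontal :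
  \sum_k g (A (E k)) (E k) p = h p * 3 + \sum_k g (A (hp (E k))) (hp (E k)) p.
Proof.
apply: trace_horizontal; [exact: csh_linear CS|exact: csh_sym CS|exact: csh_xi CS].
Qed.

(** The trace of the identity. If all horizontal projections of a frame vanish, the dimension is
    3. *)
Lemma horizontal_dim : m%:R = 3 + \sum_k g (hp (E k)) (hp (E k)) p :> R.
Proof.
transitivity (\sum_k g (E k) (E k) p).
  rewrite (eq_bigr (fun=> 1)) => [|k _]; last by rewrite EO eqxx.
  by rewrite sumr_const card_ord.
rewrite (trace_horizontal (L := id) (c := 1))//; first by rewrite smooth1 mul1r.
by move=> i; rewrite scale1r.
Qed.
End Trace.

Local Notation tr := (shape_trace g A).

(* Since [A ^ 2 = h A], the product [h tr A] is a sum of squares. *)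
Lemma ricci_factor_neq0 p : h p != 0 -> tr p - h p != 0.
Proof.
move=> h0; have EO := frame_at_orthonormal g p.
rewrite /shape_trace (shape_trace_horizontal EO); set s := \sum_k _.
have hs : 0 <= h p * s.
  rewrite mulr_sumr sumr_ge0// => k _.
  by rewrite -smoothM -gZl -(shape_square T CS) (csh_sym CS) Defs.metric_ge0.
have : 0 < h p * (h p * 3 + s - h p).
  have : 0 < h p * h p by rewrite -expr2 exprn_even_gt0.
  by move: hs; nra.
by apply: contraTneq => ->; rewrite mulr0 ltxx.
Qed.
End ShapeConsequences.

Section Rank.
Variables (R : realType) (m : nat) (M : manifold R m) (g : metric M) (D : levi_civita g).
Variables (S : 'I_3 -> almost_contact g).
Hypothesis T : forall i, contact_triple (S i) (S (i + 1)) (S (i + 2)).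
Variables (A : vfield M -> vfield M) (h : C^oo M).
Hypothesis CS : common_shape D S A h.
Local Notation vf := (vfield M).
Implicit Types (X Y Z W U V : vf) (f : C^oo M) (p : M) (i j : 'I_3).
Local Notation ph i := (phv (S i)).
Local Notation x i := (xi (S i)).
Local Notation hor := (horizontal S).
Local Notation deta i := (ext_d1 (eta (S i))).

Lemma ord3_sum (F : 'I_3 -> R) i : \sum_j F j = F i + F (i + 1) + F (i + 2).
Proof.
rewrite (reindex_inj (addrI i)) (bigD1 0) //= (bigD1 1) //= (bigD1 2) //= big1 => [|j].
  by rewrite !addr0 addrA.
by case: (ord3_cases j) => ->.
Qed.

Lemma ext_d1_xi i : deta i (x (i + 1)) (x (i + 2)) = - h.
Proof.
by rewrite (ext_d1_eta CS) (csh_xi CS) endoZ (phi_ab T) gZl g_xi_xi mulr1.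
Qed.

(** At such a point $d\eta_i$ is a multiple of $\eta_{i+1}\wedge\eta_{i+2}$. *)
Lemma ext_d1_vertical p i X Y : (forall X Y, hor X -> g (A X) Y p = 0) ->
  deta i X Y p = - h p *
    (g X (x (i + 1)) p * g Y (x (i + 2)) p - g X (x (i + 2)) p * g Y (x (i + 1)) p).
Proof.
move=> A0; rewrite (ext_d1_eta CS) g_phi_l opprK (shape_split CS).
rewrite (A0 _ _ (hproj_horizontal T _)) add0r (ord3_sum _ i) g_xi_phi.
rewrite !(gC g _ (ph i Y)) !g_phi_l (phi_ab T) (phi_ac T) gNr opprK !smoothE.
by ring.
Qed.

(** The Pfaffian of a decomposable form vanishes: the Plucker relation. *)
Lemma wedge_exp2_vertical p i (V : 'I_4 -> vf) : (forall X Y, hor X -> g (A X) Y p = 0) ->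
  @wedge_exp _ _ _ (form2 (deta i)) 2 V p = 0.
Proof.
move=> A0; rewrite wedge_exp2; last exact: ext_d1_eta_skew CS i.
by rewrite /pfaffian !(ext_d1_vertical _ _ _ A0); ring.
Qed.

(** Rank 1 would force $d\eta_i = 0$, against the value $-h$ on $\xi_{i+1}, \xi_{i+2}$. Rank 5 or
    more would make $\eta_i\wedge(d\eta_i)^q$ nonzero at [p], where already $(d\eta_i)^2 = 0$. One
    point suffices because the rank is constant. *)
Lemma has_rank3_of_vertical p i r : h p != 0 -> (forall X Y, hor X -> g (A X) Y p = 0) ->
  has_rank (eta (S i)) r -> r = 3%N.
Proof.
move=> h0 A0 [q -> [nz van]]; case: q nz van => [|[|q]] nz van //.
- pose V (k : 'I_2) := if k == 0 then x (i + 1) else x (i + 2).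
  have := ev_at p (van V); rewrite wedge_exp1; last exact: ext_d1_eta_skew CS i.
  by rewrite ext_d1_xi smoothN smooth0 => /eqP; rewrite oppr_eq0 (negbTE h0).
- have [V] := nz p; rewrite wedge_vanish ?eqxx// => W.
  apply: (@wedge_exp_vanish _ _ _ (form2 (deta i)) p 2) => // U.
  exact: wedge_exp2_vertical.
Qed.

(** $A = 0$ gives $d\eta_i = 0$, against $\eta_i\wedge d\eta_i \ne 0$; this excludes $h = 0$ in rank
    3. *)
Lemma rank3_shape_neq0 i p : has_rank (eta (S i)) 3 -> (forall X, A X = 0) -> False.
Proof.
move=> [[|[|q]] //= _ [nz _]] A0; have [V] := nz p.
rewrite wedge_vanish ?eqxx// => W; rewrite wedge_exp1; last exact: ext_d1_eta_skew CS i.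
by rewrite (ext_d1_eta CS) A0 endo0 g0l oppr0.
Qed.

(* Evaluate [(d eta)^2 = 0] on [(xi_b, xi_c, X, phi (A X))]. *)
Lemma rank3_vertical i X : (forall p, h p != 0) -> has_rank (eta (S i)) 3 -> hor X ->
  A X = 0.
Proof.
move=> h0 [[|[|q]] //= _ [_ van]] hX; pose Z := ph i (A X).
apply: (@g_eq0 _ _ _ g); apply: smooth_funP => p.
have hAX := shape_horizontal CS hX.
have hZ : hor Z by exact: horizontal_phi.
pose V (k : 'I_4) := nth 0 [:: x (i + 1); x (i + 2); X; Z] k.
have := ev_at p (van V); rewrite wedge_exp2; last exact: ext_d1_eta_skew CS i.
have z j U : hor U -> deta i (x j) U p = 0.
  move=> hU; rewrite (ext_d1_eta CS) (csh_xi CS) endoZ gZl g_phi_l gC.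
  by rewrite (horizontal_phi T i hU) oppr0 mulr0 oppr0.
rewrite /pfaffian /V [nth _ _ 0]/= [nth _ _ 1]/= [nth _ _ 2]/= [nth _ _ 3]/=.
rewrite ext_d1_xi (z (i + 1) X hX) (z (i + 1) Z hZ) !mul0r !addr0 (ext_d1_eta CS i X Z).
rewrite !smoothN mulrNN smooth0 => /eqP; rewrite !mulf_eq0 invr_eq0 pnatr_eq0 (negbTE (h0 p)) /=.
by rewrite /Z g_phi_phi hAX mulr0 subr0 => /eqP.
Qed.
End Rank.

(** * The classification *)

Section Classification.
Variables (R : realType) (n : nat) (M : manifold R (4 * n + 3)%N) (g : metric M).
Variables (D : levi_civita g) (S : almost_3contact g).
Variables (A : vfield M -> vfield M) (h : C^oo M).
Hypothesis CS : common_shape D S A h.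
Local Notation vf := (vfield M).
Implicit Types (X Y Z W U V : vf) (f : C^oo M) (p : M) (i j : 'I_3).
Local Notation ph i := (phv (S i)).
Local Notation x i := (xi (S i)).
Local Notation T := (contact_triple_rotation S).
Local Notation tr := (shape_trace g A).
Local Notation hor := (horizontal S).
Local Notation hp := (hproj S).

Let trE p : tr p =
  h p * 3 + \sum_k g (A (hp (frame_at g p k))) (hp (frame_at g p k)) p.
Proof. exact (shape_trace_horizontal T CS (frame_at_orthonormal g p)). Qed.

(** The equation $d\eta_i = a\Phi_i$ only says that [A] is [a] on $\ker\eta_i$, and $\xi_i$ has
    eigenvalue [h]. But $\xi_{i+1}$ lies in $\ker\eta_i$ with eigenvalue [h] too, so [h = a]. *)
Lemma alpha_sasakian_shape (a : R) i : alpha_sasakian (S i) a ->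
  forall X Y p, g (A X) Y p = a * g X Y p.
Proof.
case=> _ _ da.
have H X Y p : g (A X) Y p = a * g X Y p + (h p - a) * g X (x i) p * g Y (x i) p.
  have := ev_at p (da X (ph i Y)).
  rewrite (ext_d1_eta CS) /fundamental_form -!/(phv _ _) g_phi_l opprK phi2g smoothZ !gDr !gNr !gZr.
  by rewrite (csh_sym CS X (x i)) (csh_xi CS) gZr !smoothE => E; lra.
move=> X Y p; have E := H (x (i + 1)) (x (i + 1)) p.
have z : g (x (i + 1)) (x i) p = 0 by rewrite gC (xi_ab T).
rewrite (csh_xi CS) gZl z g_xi_xi !smoothE in E; rewrite H (_ : h p = a); last by lra.
by ring.
Qed.

Lemma shape_alpha_sasakian (a : R) i : a != 0 -> quasi_sasakian (S i) ->
  (forall X Y p, g (A X) Y p = a * g X Y p) -> alpha_sasakian (S i) a.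
Proof.
move=> a0 [nS _] Aa; split => // X Y; apply: smooth_funP => p.
rewrite (ext_d1_eta CS) /fundamental_form -!/(phv _ _) g_phi_l opprK smoothZ; exact: Aa.
Qed.

Lemma cosymplectic_shape i : cosymplectic (S i) -> h = 0.
Proof.
case=> _ _ d0; have := d0 (x (i + 1)) (x (i + 2)).
by rewrite (ext_d1_xi T CS) => /eqP; rewrite oppr_eq0 => /eqP.
Qed.

(** Here $\mathrm{tr} A = (4n+3)a$ and $h = a$; for $a = 1$ the factor is the classical $4n+2$. *)
Lemma ricci_of_scalar_shape (a : R) X Y p : (forall X Y p, g (A X) Y p = a * g X Y p) ->
  ricci D X Y p = ((4 * n + 3)%:R - 1) * a ^+ 2 * g X Y p.
Proof.
move=> Aa; rewrite (ricciE T CS) Aa.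
have -> : tr p = a * (4 * n + 3)%:R.
  rewrite /shape_trace (eq_bigr (fun=> a)) => [|k _].
    by rewrite sumr_const card_ord mulr_natr.
  by rewrite Aa (frame_at_orthonormal g p) eqxx mulr1.
have -> : h p = a by have := Aa (x 0) (x 0) p; rewrite (csh_xi CS) gZl g_xi_xi !smoothE !mulr1.
by ring.
Qed.

Lemma eta_einstein_horizontal (a b : C^oo M) p X Y :
  (forall X Y p, ricci D X Y p =
    a p * g X Y p + b p * \sum_(d < 3) eta (S d) X p * eta (S d) Y p) ->
  hor X -> (tr p - h p) * g (A X) Y p = a p * g X Y p.
Proof.
move=> E hX; rewrite -(ricciE T CS) E big1 ?mulr0 ?addr0// => d _.
by rewrite eta_g hX smooth0 mul0r.
Qed.

(* At each point an eta-Einstein [A] is a multiple of the identity on horizontal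
   vectors, hence is [h] or [0] there since [A ^ 2 = h A]. *)
Lemma eta_einstein_dichotomy p : eta_einstein S D -> h p != 0 ->
  (forall X Y, hor X -> g (A X) Y p = h p * g X Y p) \/
  (forall X Y, hor X -> g (A X) Y p = 0).
Proof.
case=> a [b E] h0; have k0 := ricci_factor_neq0 T CS h0.
pose c := a p / (tr p - h p).
have Ac X Y : hor X -> g (A X) Y p = c * g X Y p.
  move=> hX; have H := eta_einstein_horizontal p Y E hX.
  by apply: (mulfI k0); rewrite H /c; field.
have [hc|hc] := eqVneq c (h p); first by left => X Y hX; rewrite Ac// hc.
right => X Y hX.
have := Ac (A X) Y (shape_horizontal CS hX).
rewrite (shape_square T CS) gZl smoothM => /eqP.
by rewrite -subr_eq0 -mulrBl mulf_eq0 subr_eq0 eq_sym (negbTE hc) => /eqP.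
Qed.

Lemma horizontal_shape_scalar p X Y :
  (forall X Y, hor X -> g (A X) Y p = h p * g X Y p) -> g (A X) Y p = h p * g X Y p.
Proof.
move=> H; rewrite (shape_split CS) H; last exact: (hproj_horizontal T).
by rewrite -mulrDr (tensorial_hproj S X p (tensorial_g g Y)).
Qed.

Hypothesis hc : exists a : R, forall p, h p = a.

Lemma eta_einstein_cases : three_quasi_sasakian S -> eta_einstein S D ->
  [\/ three_alpha_sasakian S, three_cosymplectic S | rank3qs S 3].
Proof.
move=> qS E; have [a ha] := hc; have [a0|a0] := eqVneq a 0.
  have h0 : h = 0 by apply: smooth_funP => p; rewrite ha a0.
  apply: Or32 => d; have [[nS dP] _] := qS d; split => // X Y.
  by rewrite (ext_d1_eta CS) (shape_eq0 T CS) // endo0 g0l oppr0.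
have [[p Ap]|nAp] := pselect (exists p, forall X Y, hor X -> g (A X) Y p = 0).
  apply: Or33 => d; have [_ [r rS]] := qS d.
  have r3 : r = 3%N by apply: (has_rank3_of_vertical T CS _ Ap rS); rewrite ha.
  by rewrite r3 in rS.
apply: Or31 => d; exists a; have [qd _] := qS d.
apply: shape_alpha_sasakian => // X Y p; rewrite -(ha p); apply: horizontal_shape_scalar.
have hp0 : h p != 0 by rewrite ha.
have [//|Ap] := eta_einstein_dichotomy E hp0.
by case: nAp; exists p.
Qed.

Lemma alpha_sasakian_einstein : three_alpha_sasakian S ->
  einstein D /\ (forall p, 0 < scalar_curvature D p).
Proof.
move=> /(_ 0)[a aS]; have [_ a0 _] := aS; have Aa := alpha_sasakian_shape aS.
split.
  exists ((((4 * n + 3)%:R - 1) * a ^+ 2) *: (1 : C^oo M)) => X Y p.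
  by rewrite (ricci_of_scalar_shape _ _ _ Aa) smoothZ smooth1 mulr1.
move=> p; rewrite /scalar_curvature (eq_bigr (fun=> ((4 * n + 3)%:R - 1) * a ^+ 2)) => [|k _].
  rewrite sumr_const card_ord pmulrn_lgt0; last by rewrite addn3.
  rewrite mulr_gt0 ?exprn_even_gt0// subr_gt0 ltr1n; by rewrite addn3.
by rewrite (ricci_of_scalar_shape _ _ _ Aa) (frame_at_orthonormal g p) eqxx mulr1.
Qed.

Lemma cosymplectic_ricci_flat : three_cosymplectic S -> ricci_flat D.
Proof.
move=> /(_ 0) /cosymplectic_shape h0 X Y p.
by rewrite (ricciE T CS) (shape_eq0 T CS) // g0l mulr0.
Qed.

Lemma rank3_eta_einstein : rank3qs S 3 ->
  eta_einstein S D /\ ((0 < n)%N -> ~ einstein D).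
Proof.
move=> rS; have [a ha] := hc.
have h0 p : h p != 0.
  rewrite ha; apply/eqP => a0; apply: (rank3_shape_neq0 CS p (rS 0)) => X.
  by apply: (shape_eq0 T CS); apply: smooth_funP => q; rewrite ha a0.
have Ah X : hor X -> A X = 0 := rank3_vertical T CS h0 (rS 0).
have hpH X : hor (hp X) by exact: (hproj_horizontal T).
(* [A] vanishes on horizontal fields, so $\mathrm{tr} A = 3h$ and $\mathrm{tr} A - h = 2h$. *)
have Ric X Y p : ricci D X Y p = 2 * h p * g (A X) Y p.
  rewrite (ricciE T CS) trE big1 => [|k _]; first by ring.
  by rewrite Ah// g0l.
split.
  (* $A = h\sum_d \eta_d\otimes\xi_d$, hence $\mathrm{Ric} = 2h^2\sum_d \eta_d\otimes\eta_d$. *)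
  exists 0, (2 *: (h * h)) => X Y p.
  rewrite Ric (shape_split CS) Ah// g0l !smoothE mul0r !add0r mulrA mulrA; congr (_ * _).
  by apply: eq_bigr => d _; rewrite !eta_g (gC g (x d)).
(* An Einstein factor would be $2h^2 \ne 0$ on $\xi_0$ but 0 on horizontal vectors. Only for
   [n = 0], where no nonzero horizontal vector exists, is there no contradiction. *)
move=> n0 [c Ec]; have [p _] := manifold_nonempty M.
have cp : c p != 0.
  have := Ec (x 0) (x 0) p; rewrite Ric (csh_xi CS) gZl g_xi_xi !smoothE !mulr1 => <-.
  by rewrite !mulf_neq0// pnatr_eq0.
have := horizontal_dim T (frame_at_orthonormal g p).
rewrite big1 => [|k _].
  by rewrite addr0 => /eqP; rewrite eqr_nat addn3; case: n n0.
have := Ec (hp (frame_at g p k)) (hp (frame_at g p k)) p.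
by rewrite Ric Ah// g0l mulr0 => /esym/eqP; rewrite mulf_eq0 (negbTE cp) => /eqP.
Qed.
End Classification.

Theorem corollary5p12 (R : realType) (n : nat) (M : manifold R (4 * n + 3)%N)
    (connM : connected [set: M]) (g : metric M) (D : levi_civita g)
    (S : almost_3contact g) (qsS : three_quasi_sasakian S) :
  [/\ eta_einstein S D ->
        [\/ three_alpha_sasakian S, three_cosymplectic S | rank3qs S 3],
      three_alpha_sasakian S ->
        einstein D /\ (forall p : M, 0 < scalar_curvature D p),
      three_cosymplectic S -> ricci_flat D
    & rank3qs S 3 ->
        eta_einstein S D /\ ((0 < n)%N -> ~ einstein D)].
Proof.
have [A [h CS]] : exists A h, common_shape D S A h.
  by apply: common_shape_ex => d; have [] := qsS d.
(* Connectedness enters here: it turns $X h = 0$ for all [X] into a single constant, so that the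
   case $h = 0$ and the case $h \ne 0$ are global alternatives. *)
have hc := killed_constant connM (h_killed (contact_triple_rotation S) CS).
split.
- exact: (eta_einstein_cases CS hc qsS).
- exact: (alpha_sasakian_einstein CS).
- exact: (cosymplectic_ricci_flat CS).
- exact: (rank3_eta_einstein CS hc).
Qed.
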